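(* Let $G$ be a simple $2$-connected claw-free cubic graph. Then $G$ is tightly two-face-embeddable if and only if $G\in\mathcal{F}$.
   Context: A cubic graph is $3$-regular; $G$ is claw-free if it has no induced subgraph isomorphic to $K_{1,3}$. For connected $H$, $\beta(H)=|E(H)|-|V(H)|+1$. A connected graph is upper-embeddable if it has a cellular embedding (all faces open discs) in a closed orientable surface with at most two faces; a cubic upper-embeddable graph with odd $\beta$ is two-face-embeddable. In an upper-embeddable cubic graph $G$, a pair $\{x,y\}$ of distinct vertices is removable if $x,y$ are joined by exactly one edge, $xy$ is not a bridge, and $G-\{x,y\}$ is (connected and) upper-embeddable. A two-face-embeddable cubic graph is tightly two-face-embeddable if it has no removable pair. Inflating a vertex $v$ of a cubic graph to a triangle: replace $v$ by a triangle $W_v$ and attach the three edges formerly incident with $v$ to distinct vertices of $W_v$. A diamond is $K_4$ minus an edge, its two $2$-valent vertices being its ends. Replacing an edge $uv$ with a string of $k\ge1$ diamonds: replace it by the alternating sequence $uu_1, D_1, v_1u_2, D_2,\dots, v_{k-1}u_k, D_k, v_kv$ where $D_i$ is a diamond with $2$-valent vertices $u_i,v_i$. The necklace $L_4$ is obtained from a $4$-cycle by replacing every second edge by a pair of parallel edges. The family $\mathcal{F}$: take $K\in\{K_4,L_4\}$, inflate each vertex to a triangle (vertex-triangles), then replace each edge not lying on a vertex-triangle by a string of diamonds of positive length (lengths may differ between edges); $\mathcal{F}$ consists of all graphs so obtained. *)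

(* Defs.v *)
From mathcomp Require Import all_boot perm.
Set Implicit Arguments. Unset Strict Implicit. Unset Printing Implicit Defensive.

Section Graphs.
Variables (T : finType) (g : rel T).

Definition simple_graph := symmetric g /\ irreflexive g.

Definition cubic := forall x : T, #|[pred y | g x y]| = 3.

Definition conn_in (r : rel T) (S : {set T}) :=
  forall x y, x \in S -> y \in S ->
    connect [rel a b | r a b && (a \in S) && (b \in S)] x y.

Definition connected_graph := conn_in g setT.

Definition two_connected :=
  2 < #|T| /\ conn_in g setT /\ forall v : T, conn_in g (setT :\ v).

Definition claw_free :=
  ~ exists v a b c : T,
      [/\ g v a, g v b, g v c & [&& a != b, a != c, b != c,
                                  ~~ g a b, ~~ g a c & ~~ g b c]].

Definition darts (S : {set T}) : {set T * T} :=
  [set d | g d.1 d.2 && (d.1 \in S) && (d.2 \in S)].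

Definition nedges (S : {set T}) := #|darts S| %/ 2.

Definition beta (S : {set T}) := nedges S + 1 - #|S|.

Definition rotation_system (S : {set T}) (rho : {perm T * T}) :=
  [/\ forall d, d \notin darts S -> rho d = d,
      forall d, (rho d).1 = d.1 &
      forall d d', d \in darts S -> d' \in darts S -> d.1 = d'.1 ->
        fconnect rho d d'].

Definition face_perm (S : {set T}) (rho : {perm T * T}) (d : T * T) :=
  if d \in darts S then rho (d.2, d.1) else d.

Definition nfaces (S : {set T}) (rho : {perm T * T}) :=
  if #|darts S| == 0 then 1 else fcard (face_perm S rho) (darts S).

(* upper-embeddable: connected and has a cellular orientable embedding
   (= rotation system, Heffter-Edmonds) with at most two faces *)
Definition upper_embeddable (S : {set T}) :=
  conn_in g S /\ exists rho, rotation_system S rho /\ nfaces S rho <= 2.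

Definition two_face_embeddable :=
  cubic /\ upper_embeddable setT /\ odd (beta setT).

Definition removable (x y : T) :=
  [/\ x != y, g x y,
      conn_in (fun a b => g a b && ~~ (((a == x) && (b == y)) || ((a == y) && (b == x)))) setT
    & upper_embeddable (~: [set x; y])].

Definition tightly_two_face_embeddable :=
  two_face_embeddable /\ ~ exists x y, removable x y.

End Graphs.

(* Base multigraph K (b = true : K4, b = false : L4) on vertices 0..3,
   edges indexed 0..5. L4: 4-cycle 0-1-2-3-0 with edges 01 and 23 doubled. *)
Definition Kedges (b : bool) : seq (nat * nat) :=
  if b then [:: (0,1); (0,2); (0,3); (1,2); (1,3); (2,3)]
  else [:: (0,1); (0,1); (1,2); (2,3); (2,3); (3,0)].

Definition endpoint (b : bool) (e : nat) (s : bool) : nat :=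
  let p := nth (0,0) (Kedges b) e in if s then p.2 else p.1.

(* Vertices of the constructed graph:
   inl (e, s)      : vertex of the vertex-triangle W_v attached to end s of
                     edge e (v = endpoint b e s);
   inr (e, i, j)   : vertex j (0 = u_i, 1,2 = middle, 3 = v_i) of the i-th
                     diamond of the string replacing edge e. *)
Definition FV := ((nat * bool) + (nat * nat * nat))%type.

Definition FV_valid (k : nat -> nat) (v : FV) : bool :=
  match v with
  | inl (e, _) => e < 6
  | inr (e, i, j) => [&& e < 6, i < k e & j < 4]
  end.

Definition diamond_edge (j j' : nat) : bool :=
  ((j, j') == (0,1)) || ((j, j') == (0,2)) || ((j, j') == (1,2))
  || ((j, j') == (1,3)) || ((j, j') == (2,3)).

Definition Fadj0 (b : bool) (k : nat -> nat) (v w : FV) : bool :=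
  match v, w with
  | inl (e, s), inl (e', s') =>
      ((e, s) != (e', s')) && (endpoint b e s == endpoint b e' s')
  | inl (e, s), inr (e', i, j) =>
      (e == e') && (if s then (i.+1 == k e) && (j == 3) else (i == 0) && (j == 0))
  | inr (e, i, j), inr (e', i', j') =>
      (e == e') && (((i == i') && diamond_edge j j')
                    || ((i' == i.+1) && (j == 3) && (j' == 0)))
  | _, _ => false
  end.

Definition Fadj (b : bool) (k : nat -> nat) (v w : FV) : bool :=
  Fadj0 b k v w || Fadj0 b k w v.

Definition in_F (T : finType) (g : rel T) :=
  exists (b : bool) (k : nat -> nat), (forall e, e < 6 -> 0 < k e) /\
    exists f : T -> FV,
      [/\ injective f, forall x, FV_valid k (f x),
          forall v, FV_valid k v -> exists x, f x = v
        & forall x y, g x y = Fadj b k (f x) (f y)].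

(* Main.v *)
(** Delete the edges that lie in no triangle: when [G] is not [K4], what remains is [t] disjoint
    triangles and some disjoint diamonds.  Cutting an edge of an embedded graph changes the number of
    faces by one, and each remaining block has at least one face and, by Euler's formula, a face
    number of known parity.  Comparing with two faces gives [t <= 4] for an upper-embeddable [G].
    If [t = 4] and every edge between blocks meets a diamond, the same count for [G - {x, y}] shows
    that no pair is removable.

    Embeddings with few faces are obtained by growing a spanning tree with a single face and adding
    cotree edges in adjacent pairs; if a pair creates three faces, all of them meet at the common
    vertex, and reversing the rotation there merges them.

    Odd [beta] means that [4] divides [t].  If [t = 0], then [G] is [K4] or a ring of diamonds and
    the middle vertices of a diamond form a removable pair.  If [t = 4], following strings of
    diamonds from triangle to triangle exhibits [G] as an inflation of a cubic multigraph on four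
    vertices, which is [K4] or [L4] by 2-connectedness; an empty string would be an edge whose ends
    form a removable pair, so tightness gives [G \in F]. *)

Require Import Defs.
From mathcomp Require Import all_boot perm zify.
Set Implicit Arguments. Unset Strict Implicit. Unset Printing Implicit Defensive.

(** With [d] diamonds the comparison reads [2t + d <= 2 + (3t + 2d)/2]. At [t = 4] it is an
    equality, and this absence of slack is what forbids removable pairs: a deletion that loses cross
    edges without lowering the weights of the blocks as much breaks the bound.

    Edges outside a subgraph survive as half-edges, so a single rotation serves all subgraphs and
    adding an edge multiplies the face permutation by a transposition. Euler's formula is needed
    only modulo 2, where it compares signs of permutations; no genus is ever defined.

    For embeddings the obstacle is that two edges added as a pair must meet at a vertex of degree
    three, and no edge may belong to two pairs. Hence a set of centres, pairwise not joined by a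
    withheld edge: one middle vertex of each diamond and one vertex in some of the triangles.
    Withholding two edges at every centre must leave precisely a spanning tree, that is, a connected
    graph with the right number of darts. Connectedness is transferred from the base multigraph,
    where it is a finite check on [K4] and [L4]. *)

Lemma in_sep (I : finType) (A : {set I}) (P : pred I) x :
  (x \in [set y in A | P y]) = (x \in A) && P x.
Proof. exact: in_set. Qed.

(** * Cycles of permutations *)

Section PermCycles.
Variable (D : finType).
Implicit Types (s t : {perm D}) (x y z : D) (A B : {set D}).

Definition cyc s A := #|porbit s @: A|.

Definition one_cycle s A := {in A &, forall x y, y \in porbit s x}.

Lemma fconnect_porbit s x y : fconnect s x y = (y \in porbit s x).
Proof.
apply/idP/porbitP => [/iter_findex <-|[i ->]]; last by rewrite permX fconnect_iter.
by exists (findex s x y); rewrite permX.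
Qed.

Lemma porbit_trans s x y z :
  y \in porbit s x -> z \in porbit s y -> z \in porbit s x.
Proof. by rewrite -!fconnect_porbit; apply: connect_trans. Qed.

Lemma porbit1 s x : s x \in porbit s x.
Proof. by rewrite -fconnect_porbit fconnect1. Qed.

(* [R] need not be transitive: it relates the start of the walk to its current position. *)
Lemma porbit_ind s x (R : D -> Prop) :
  R x -> (forall y, R y -> R (s y)) -> forall y, y \in porbit s x -> R y.
Proof.
move=> Rx Rs y /porbitP[i ->]; elim: i => [|i IH]; first by rewrite perm1.
by rewrite expgSr permM; apply: Rs.
Qed.

Lemma porbit_stable s A x y :
  (forall z, z \in A -> s z \in A) -> x \in A -> y \in porbit s x -> y \in A.
Proof. by move=> sA xA; apply: (porbit_ind (R := fun y => y \in A)). Qed.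

Lemma eq_porbit_in s t A x : (forall z, z \in A -> s z \in A) ->
  {in A, s =1 t} -> x \in A -> porbit s x = porbit t x.
Proof.
move=> sA est xA; have iE i : (s ^+ i)%g x = (t ^+ i)%g x /\ (s ^+ i)%g x \in A.
  elim: i => [|i [IH1 IH2]]; first by rewrite !perm1.
  by rewrite !expgSr !permM -IH1 -est // sA.
apply/setP => y; apply/porbitP/porbitP => -[i ->]; exists i; by case: (iE i).
Qed.

Lemma eq_cyc s t A : (forall z, z \in A -> s z \in A) -> {in A, s =1 t} ->
  cyc s A = cyc t A.
Proof. by move=> sA est; congr #|pred_of_set _|; apply: eq_in_imset => x; apply: eq_porbit_in. Qed.

Lemma cycT s : cyc s setT = #|porbits s|.
Proof. by congr #|pred_of_set _|; apply/setP=> P; apply/imsetP/imsetP => -[x _ ->]; exists x. Qed.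

Lemma cycU s A B : (forall z, z \in A -> s z \in A) -> [disjoint A & B] ->
  cyc s (A :|: B) = cyc s A + cyc s B.
Proof.
move=> sA dAB; rewrite /cyc imsetU -cardsUI.
rewrite [in RHS](_ : _ :&: _ = set0) ?cards0 ?addn0 //; apply/setP => P; rewrite !inE.
apply/negP => /andP[/imsetP[x xA ->] /imsetP[y yB] e].
have : y \in porbit s x by rewrite e porbit_id.
by move/(porbit_stable sA xA) => yA; move/pred0P/(_ y): dAB; rewrite /= yA yB.
Qed.

Lemma cyc_id s A : {in A, forall x, s x = x} -> cyc s A = #|A|.
Proof.
move=> sA; have po x : x \in A -> porbit s x = [set x].
  move=> xA; apply/setP => y; rewrite inE; apply/idP/eqP => [|->]; last exact: porbit_id.
  by apply: (porbit_ind (R := fun y => y = x)) => // z ->; apply: sA.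
rewrite /cyc card_in_imset // => x y xA yA; rewrite !po // => /setP/(_ x).
by rewrite !inE eqxx => /esym/eqP.
Qed.

Lemma cyc_gt0 s A : (0 < cyc s A) = (0 < #|A|).
Proof.
rewrite !card_gt0 /cyc; apply/set0Pn/set0Pn => [[_ /imsetP[x xA _]]|[x xA]]; first by exists x.
by exists (porbit s x); apply: imset_f.
Qed.

(** Every cycle meeting [A] contains exactly one root, and stability keeps that root in [A]. *)
Lemma fcard_cyc s A : (forall z, z \in A -> s z \in A) -> fcard s A = cyc s A.
Proof.
move=> sA; pose B := [set x in A | froots s x].
have iB : porbit s @: A = porbit s @: B.
  apply/setP => P; apply/imsetP/imsetP => -[x xA ->]; last first.
    by exists x => //; move: xA; rewrite inE => /andP[].
  have xr : froot s x \in porbit s x by rewrite -fconnect_porbit connect_root.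
  exists (froot s x); last by apply/eqP; rewrite eq_porbit_mem porbit_sym.
  rewrite inE (porbit_stable sA xA xr) roots_root //; exact/fconnect_sym/perm_inj.
rewrite /cyc iB card_in_imset => [|x y].
  by apply: eq_card => x; rewrite !inE andbC.
rewrite !inE => /andP[_ /eqP rx] /andP[_ /eqP ry] /eqP.
rewrite eq_porbit_mem -fconnect_porbit -(root_connect (fconnect_sym (@perm_inj _ s))).
by rewrite rx ry => /eqP ->.
Qed.

(** Multiplying twice by the transposition gives back [s], so [porbits_mul_tperm] applies in both
    directions; the two counts together determine whether [x] and [y] share a cycle afterwards. *)
Lemma porbits_merge s x y : x \notin porbit s y ->
  #|porbits s| = #|porbits (tperm x y * s)|.+1 /\ x \in porbit (tperm x y * s) y.
Proof.
move=> nxy; have neq : x != y by apply: contraNneq nxy => ->; apply: porbit_id.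
have h1 := porbits_mul_tperm s x y; have h2 := porbits_mul_tperm (tperm x y * s) x y.
move: h1 h2; rewrite /= nxy neq mulgA tperm2 mul1g; case: (x \in _) => /=; lia.
Qed.

Lemma porbits_split s x y : x != y -> x \in porbit s y ->
  #|porbits (tperm x y * s)| = #|porbits s|.+1 /\ x \notin porbit (tperm x y * s) y.
Proof.
move=> neq xy; have h1 := porbits_mul_tperm s x y; have h2 := porbits_mul_tperm (tperm x y * s) x y.
move: h1 h2; rewrite /= xy neq mulgA tperm2 mul1g; case: (x \in _) => /=; lia.
Qed.

Lemma porbits_tperm_le s x y : #|porbits s| <= #|porbits (tperm x y * s)|.+1.
Proof.
case: (boolP (x \in porbit s y)) => [xy|nxy]; last by case: (porbits_merge nxy) => ->.
have [->|neq] := eqVneq x y; first by rewrite tperm1 mul1g.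
by case: (porbits_split neq xy) => ->; lia.
Qed.

(** Along the old cycle the new permutation takes the same steps, except that the successors of [x]
    and [y] are exchanged: after either of them the walk continues as one that started at the
    other. *)
Lemma porbit_tperm s x y z u : z \in porbit s u ->
  [\/ z \in porbit (tperm x y * s) u, z \in porbit (tperm x y * s) x
    | z \in porbit (tperm x y * s) y].
Proof.
pose t := (tperm x y * s)%g; apply: (porbit_ind (R := fun z => [\/ z \in porbit t u,
  z \in porbit t x | z \in porbit t y])); first by constructor 1; apply: porbit_id.
move=> v Rv; have tv : t (tperm x y v) = s v by rewrite permM tpermK.
have [vx|vx] := eqVneq v x.
  by constructor 3; rewrite -tv vx tpermL porbit1.
have [vy|vy] := eqVneq v y.
  by constructor 2; rewrite -tv vy tpermR porbit1.
have {}tv : s v \in porbit t v by rewrite -tv tpermD 1?eq_sym // porbit1.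
by case: Rv => Rv; [constructor 1|constructor 2|constructor 3]; apply: porbit_trans Rv tv.
Qed.

Lemma porbit_tperm_off s x y u : x \notin porbit s u -> y \notin porbit s u ->
  porbit (tperm x y * s) u = porbit s u.
Proof.
move=> nx ny; apply/esym/(@eq_porbit_in _ _ (porbit s u)); last exact: porbit_id.
  by move=> z zu; apply: porbit_trans zu (porbit1 _ _).
move=> z zu; rewrite permM tpermD //; [apply: contraNneq nx|apply: contraNneq ny] => ->; exact: zu.
Qed.

End PermCycles.

(** * Faces of an embedded graph *)

Section Darts.
Variable T : finType.
Implicit Types (d : T * T) (X Y : {set T * T}).

Definition sw d := (d.2, d.1).

Lemma swK : involutive sw. Proof. by case. Qed.

Definition symset X := forall d, d \in X -> sw d \in X.

(** Testing both [d] and [sw d] makes this an involution for every [X], so that [glue] is a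
    permutation without any symmetry assumption. *)
Definition glue_fun X d := if (d \in X) && (sw d \in X) then sw d else d.

Lemma glue_inj X : injective (glue_fun X).
Proof.
apply: (can_inj (g := glue_fun X)) => d; rewrite /glue_fun.
by have [/andP[h1 h2]|h] := boolP ((d \in X) && (sw d \in X)); rewrite ?swK ?h1 ?h2 // (negbTE h).
Qed.

Definition glue X : {perm T * T} := perm (@glue_inj X).

Lemma symset_sw X d : symset X -> (sw d \in X) = (d \in X).
Proof. by move=> sX; apply/idP/idP => /sX; rewrite ?swK. Qed.

Lemma symsetU X Y : symset X -> symset Y -> symset (X :|: Y).
Proof. by move=> sX sY d; rewrite !inE => /orP[/sX ->|/sY ->]; rewrite ?orbT. Qed.

Lemma symset2 d : symset [set d; sw d].
Proof. by move=> e; rewrite !inE => /orP[] /eqP->; rewrite ?swK eqxx ?orbT. Qed.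

Lemma glueE X d : symset X -> glue X d = if d \in X then sw d else d.
Proof. by move=> sX; rewrite permE /glue_fun symset_sw // andbb. Qed.

Lemma glueK X : symset X -> involutive (glue X).
Proof. by move=> sX d; rewrite !glueE //; case: (boolP (d \in X)) => dX; rewrite ?symset_sw // ?dX ?swK ?(negbTE dX). Qed.

(** Conjugation moves a change of the rotation to the left of the face permutation, where the lemmas
    on merging and splitting cycles apply. *)
Lemma glue_tperm X x y : (glue X * tperm (glue X x) (glue X y) = tperm x y * glue X)%g.
Proof. by apply/permP => z; rewrite !permM (inj_tperm _ _ _ perm_inj). Qed.

Lemma glue_add X d : symset X -> d \notin X -> d.1 != d.2 ->
  glue (X :|: [set d; sw d]) = (tperm d (sw d) * glue X)%g.
Proof.
move=> sX dX dn; have sdX : sw d \notin X by rewrite symset_sw.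
have dd : d != sw d by apply: contraNneq dn => /(congr1 fst) /= ->.
apply/permP => e; rewrite permM glueE; last exact/symsetU/symset2.
have [->|ed] := eqVneq e d.
  by rewrite tpermL !inE eqxx orbT glueE // (negbTE sdX).
have [->|esd] := eqVneq e (sw d).
  by rewrite tpermR !inE eqxx !orbT glueE // (negbTE dX) swK.
by rewrite tpermD 1?eq_sym // !inE (negbTE ed) (negbTE esd) !orbF glueE.
Qed.

Lemma symset_ind (P : {set T * T} -> Prop) : P set0 ->
  (forall X d, symset X -> d \notin X -> d.1 != d.2 -> P X ->
     P (X :|: [set d; sw d])) ->
  forall X, symset X -> (forall d, d \in X -> d.1 != d.2) -> P X.
Proof.
move=> P0 PS X; have [n] := ubnP #|X|; elim: n X => // n IH X ltX sX nX.
have [->//|[d dX]] := set_0Vmem X.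
pose Y := X :\: [set d; sw d].
have eX : X = Y :|: [set d; sw d].
  apply/setP => e; rewrite !inE; have [->|_] := eqVneq e d; first by rewrite dX orbT.
  by have [->|_] := eqVneq e (sw d); rewrite /= ?orbT ?orbF ?symset_sw ?dX.
have sY : symset Y.
  move=> e; rewrite !inE !(can2_eq swK swK) swK symset_sw // => /andP[].
  by rewrite orbC => -> ->.
have ltY : #|Y| < #|X|.
  by apply: proper_card; rewrite properE subsetDl; apply/subsetPn; exists d; rewrite ?inE ?eqxx.
rewrite eX; apply: PS => //; first by rewrite !inE eqxx.
  exact: nX.
by apply: IH => // [|e]; [lia|rewrite inE => /andP[_ /nX]].
Qed.

Lemma card_symsetU2 X d : symset X -> d \notin X -> d.1 != d.2 ->
  #|X :|: [set d; sw d]| = #|X|.+2.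
Proof.
move=> sX dX dn; rewrite cardsU cards2 (_ : d != sw d); last first.
  by apply: contraNneq dn => /(congr1 fst) /= ->.
rewrite (_ : _ :&: _ = set0) ?cards0; first lia.
apply/setP => e; rewrite !inE; apply/negP => /andP[eX /orP[]/eqP E]; move: eX; rewrite E.
  by rewrite (negbTE dX).
by rewrite symset_sw // (negbTE dX).
Qed.

(** [glue X] is a product of one transposition per edge, so its sign is the parity of the number of
    edges. This is where edges enter Euler's formula modulo 2. *)
Lemma odd_glue X : symset X -> (forall d, d \in X -> d.1 != d.2) ->
  odd_perm (glue X) = odd #|X|./2 /\ ~~ odd #|X|.
Proof.
move: X; apply: symset_ind => [|X d sX dX dn [IH1 IH2]].
  rewrite cards0 (_ : glue set0 = 1%g) ?odd_perm1 //.
  by apply/permP => d; rewrite permE perm1 /glue_fun !inE.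
rewrite glue_add // odd_mul_tperm IH1 card_symsetU2 //= negbK IH2; split => //.
have -> // : d != sw d by apply: contraNneq dn => /(congr1 fst) /= ->.
Qed.

(* The faces of the subgraph with dart set [X], in which all other darts survive as pending half-edges. *)
Definition phi (rho : {perm T * T}) X := (glue X * rho)%g.

Lemma phiE rho X d : symset X -> phi rho X d = rho (if d \in X then sw d else d).
Proof. by move=> sX; rewrite permM glueE. Qed.

Lemma phi_add rho X d : symset X -> d \notin X -> d.1 != d.2 ->
  phi rho (X :|: [set d; sw d]) = (tperm d (sw d) * phi rho X)%g.
Proof. by move=> *; rewrite /phi glue_add // mulgA. Qed.

(** Each edge of [Y] contributes one transposition, which changes the number of cycles by at most
    one. *)
Lemma porbits_phiU rho X Y : symset X -> symset Y -> [disjoint X & Y] ->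
  (forall d, d \in Y -> d.1 != d.2) ->
  #|porbits (phi rho X)| <= #|porbits (phi rho (X :|: Y))| + #|Y|./2.
Proof.
move=> sX sY dXY nY.
suff [] : symset Y /\ ([disjoint X & Y] ->
  #|porbits (phi rho X)| <= #|porbits (phi rho (X :|: Y))| + #|Y|./2) by move=> _; apply.
move: Y sY nY {dXY}; apply: symset_ind.
  by split=> [d|_]; [rewrite !inE|rewrite setU0 leq_addr].
move=> Y d sY dY dn [_ IH]; split; first exact/symsetU/symset2.
rewrite -setI_eq0 setIUr setU_eq0 => /andP[]; rewrite setI_eq0 => dXY.
rewrite -subset0 => /subsetP/(_ d); rewrite !inE eqxx /= andbT => dX.
rewrite setUA phi_add //; last 2 first.
- exact: symsetU.
- by rewrite !inE (negbTE dY) orbF; apply/negP => /dX.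
have := porbits_tperm_le (phi rho (X :|: Y)) d (sw d).
rewrite card_symsetU2 //=; move: (IH dXY) => {IH}; set a := #|porbits _|; set b := #|porbits _|; set c := #|porbits _|; set e := _./2; lia.
Qed.

End Darts.

Section Rotation.
Variables (T : finType) (g : rel T).
Hypotheses (gsym : symmetric g) (girr : irreflexive g).
Variables (S : {set T}) (rho : {perm T * T}).
Hypothesis rot : rotation_system g S rho.
Implicit Types (X : {set T * T}).

Let D := darts g S.

Lemma dartsE x y : ((x, y) \in darts g S) = [&& g x y, x \in S & y \in S].
Proof. by rewrite inE /= andbA. Qed.

Lemma darts_sym : symset D.
Proof. by move=> [x y]; rewrite !dartsE gsym => /and3P[-> -> ->]. Qed.

Lemma darts_neq d : d \in D -> d.1 != d.2.
Proof. by case: d => x y; rewrite dartsE => /and3P[gxy _ _]; apply: contraTneq gxy => /= ->; rewrite girr. Qed.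

Lemma rho_darts d : (rho d \in D) = (d \in D).
Proof.
case: rot => fixr _ _; apply/idP/idP => h.
  by apply/negPn/negP => dD; move: (dD); rewrite -(fixr d) // h.
apply/negPn/negP => rD; have /perm_inj E := fixr _ rD.
by rewrite E h in rD.
Qed.

Lemma rho1 d : (rho d).1 = d.1. Proof. by case: rot. Qed.

Lemma phi_darts X d : symset X -> X \subset D -> d \in D -> phi rho X d \in D.
Proof.
move=> sX XD dD; rewrite phiE // rho_darts; case: ifP => // /(subsetP XD).
exact: darts_sym.
Qed.

(** Off the darts the permutation is the identity, so counting cycles on all of [T * T] only adds a
    constant that is the same for every [X]. *)
Lemma porbits_phi X : symset X -> X \subset D ->
  #|porbits (phi rho X)| = cyc (phi rho X) D + #|~: D|.
Proof.
move=> sX XD; rewrite -cycT -(setUCr D) cycU; last 2 first.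
- by move=> d; apply: phi_darts.
- by rewrite -setI_eq0 setICr.
congr (_ + _); apply: cyc_id => d; rewrite inE => dD.
rewrite phiE // ifN; first by case: rot => ->.
by apply: contra dD; apply: (subsetP XD).
Qed.

Lemma nfacesE : 0 < #|D| -> nfaces g S rho = cyc (phi rho D) D.
Proof.
move=> D0; rewrite /nfaces -/D gtn_eqF // -fcard_cyc; last first.
  by move=> d; apply: phi_darts => //; apply: darts_sym.
apply: eq_fcard => d; rewrite phiE; last exact: darts_sym.
rewrite /face_perm -/D; case: ifP => // dD; by case: rot => ->; rewrite ?dD.
Qed.

(** * Lower bound on the number of faces from a partition into blocks *)

Section LowerBound.
Hypothesis hasdart : forall v, v \in S -> exists2 w, w \in S & g v w.
Variables (I : finType) (p : T -> I).

Definition at_block i := [set d in D | p d.1 == i].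
Definition in_block i := [set d in D | (p d.1 == i) && (p d.2 == i)].
Definition inner := [set d in D | p d.1 == p d.2].
Definition cross := [set d in D | p d.1 != p d.2].

Let at_blockE i d : (d \in at_block i) = (d \in D) && (p d.1 == i).
Proof. by rewrite in_set. Qed.

Let in_blockE i d : (d \in in_block i) = [&& d \in D, p d.1 == i & p d.2 == i].
Proof. by rewrite in_set. Qed.

Let innerE d : (d \in inner) = (d \in D) && (p d.1 == p d.2).
Proof. by rewrite in_set. Qed.

Let crossE d : (d \in cross) = (d \in D) && (p d.1 != p d.2).
Proof. by rewrite in_set. Qed.

Let nverts i := #|[set v in S | p v == i]|.

(** The cycles of a rotation system are its vertices, a cycle being sent to the common tail of its
    darts; [hasdart] provides a cycle at every vertex. *)
Lemma cyc_rho i : cyc rho (at_block i) = nverts i.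
Proof.
have pf d : d \in D -> forall e, e \in porbit rho d -> e.1 = d.1.
  move=> dD; apply: (porbit_ind (R := fun e => e.1 = d.1)) => // e.
  by rewrite rho1.
pose F (P : {set T * T}) := [set d.1 | d in P].
have Fp d : d \in D -> F (porbit rho d) = [set d.1].
  move=> dD; apply/setP => v; rewrite inE; apply/imsetP/eqP => [[e /(pf _ dD) ee ->//]|->].
  by exists d => //; apply: porbit_id.
rewrite /cyc /nverts -(card_imset _ (@set1_inj T)).
rewrite -(@card_in_imset _ _ F).
  rewrite -imset_comp; congr #|pred_of_set _|; apply/setP => Q; apply/imsetP/imsetP => -[].
    move=> d; rewrite inE => /andP[dD pd] ->; exists d.1; last by rewrite /= Fp.
    by rewrite inE pd andbT; case: d dD {pd} => x y; rewrite dartsE => /and3P[].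
  move=> v; rewrite inE => /andP[vS pv] ->; have [w wS vw] := hasdart vS.
  by exists (v, w); rewrite /= ?Fp ?inE /= ?vw ?vS ?wS.
have sub d : d \in at_block i -> d \in D by rewrite at_blockE => /andP[].
move=> P Q /imsetP[d /sub dD ->] /imsetP[e /sub eD ->].
rewrite !Fp // => /set1_inj de; apply/eqP; rewrite eq_porbit_mem -fconnect_porbit.
by case: rot => _ _; apply.
Qed.

Lemma inner_sym : symset inner.
Proof. by move=> d; rewrite !innerE eq_sym => /andP[/darts_sym-> ->]. Qed.

Lemma in_block_sym i : symset (in_block i).
Proof. by move=> d; rewrite !in_blockE => /and3P[/darts_sym-> -> ->]. Qed.

Lemma cross_sym : symset cross.
Proof. by move=> d; rewrite !crossE eq_sym => /andP[/darts_sym-> ->]. Qed.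

Lemma inner_at_block i d : d \in at_block i -> phi rho inner d \in at_block i.
Proof.
rewrite !at_blockE => /andP[dD pd]; rewrite phi_darts //; last 2 first.
- exact: inner_sym.
- by apply/subsetP => e; rewrite innerE => /andP[].
rewrite phiE ?rho1; last exact: inner_sym.
by case: ifP => //; rewrite innerE => /andP[_ /eqP <-].
Qed.

(** Euler's formula modulo 2 as an identity of signs: the face permutation of the block is
    [glue (in_block i)] times [rho]. Off the block it agrees with [rho], so the cycles there cancel
    and only the vertices, edges and faces of the block remain. *)
Lemma parity_block i :
  odd (cyc (phi rho inner) (at_block i)) = odd (nverts i + #|in_block i|./2).
Proof.
have sub : in_block i \subset at_block i.
  by apply/subsetP => d; rewrite in_blockE at_blockE => /and3P[-> ->].
have eqI : {in at_block i, phi rho inner =1 phi rho (in_block i)}.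
  move=> d; rewrite at_blockE => /andP[dD /eqP pd].
  rewrite !phiE; [|exact: in_block_sym|exact: inner_sym].
  by rewrite innerE in_blockE pd eqxx /= eq_sym.
have st := @inner_at_block i.
have st' d : d \in at_block i -> phi rho (in_block i) d \in at_block i.
  by move=> dA; rewrite -eqI // st.
have str d : d \in at_block i -> rho d \in at_block i.
  by rewrite !at_blockE rho1 rho_darts.
have eqC : {in ~: at_block i, phi rho (in_block i) =1 rho}.
  move=> d; rewrite inE => dA; rewrite phiE; last exact: in_block_sym.
  by rewrite ifN //; apply: contra dA; apply: (subsetP sub).
have stC d : d \in ~: at_block i -> phi rho (in_block i) d \in ~: at_block i.
  move=> dA; rewrite eqC // inE; move: dA; rewrite inE.
  by rewrite !at_blockE rho1 rho_darts.
have dis : [disjoint at_block i & ~: at_block i] by rewrite -setI_eq0 setICr.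
have := odd_permM (glue (in_block i)) rho.
have [|-> _] := odd_glue (@in_block_sym i).
  by move=> d; rewrite in_blockE => /andP[/darts_neq].
rewrite /odd_perm -!cycT -(setUCr (at_block i)) !cycU // (eq_cyc stC eqC).
rewrite -/(phi rho (in_block i)) -(eq_cyc st eqI) cyc_rho !oddD.
by do 5!case: (odd _).
Qed.

(** A positive number known to be even is at least 2; the term [~~ odd] is this extra face. *)
Lemma cyc_block i : i \in p @: S ->
  1 + ~~ odd (nverts i + #|in_block i|./2) <= cyc (phi rho inner) (at_block i).
Proof.
move=> /imsetP[v vS ->]; rewrite -parity_block.
have : 0 < cyc (phi rho inner) (at_block (p v)).
  rewrite cyc_gt0; apply/card_gt0P; have [w wS vw] := hasdart vS.
  by exists (v, w); rewrite !inE /= vw vS wS eqxx.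
by case: (cyc _ _) => [|[|n]] //= _; case: (odd _).
Qed.

Lemma cyc_sum (J : seq I) : uniq J ->
  cyc (phi rho inner) [set d in D | p d.1 \in J] =
  \sum_(i <- J) cyc (phi rho inner) (at_block i).
Proof.
elim: J => [_|i J IH /= /andP[iJ uJ]].
  by rewrite big_nil /cyc (_ : [set _ in _ | _] = set0) ?imset0 ?cards0 //; apply/setP => d; rewrite !inE andbF.
rewrite big_cons -IH // -cycU; first last.
- rewrite -setI_eq0; apply/eqP/setP => d; rewrite !inE.
  by apply/negP => /andP[/andP[_ /eqP ->]]; rewrite (negbTE iJ) andbF.
- by move=> d; apply: inner_at_block.
by congr (cyc _ _); apply/setP => d; rewrite in_setU at_blockE !in_sep in_cons -andb_orr.
Qed.

(* Cutting an edge changes the number of faces by one, and each block of the cut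
   surface has at least one face, with parity given by Euler's formula. *)
Theorem faces_lower_bound : 0 < #|D| ->
  \sum_(i in p @: S) (1 + ~~ odd (nverts i + #|in_block i|./2))
  <= nfaces g S rho + #|cross|./2.
Proof.
move=> D0; rewrite nfacesE //.
have innerD : inner \subset D by apply/subsetP => d; rewrite innerE => /andP[].
have eD : D = inner :|: cross.
  by apply/setP => d; rewrite in_setU innerE crossE; case: (d \in D) => //=; case: eqP.
have dis : [disjoint inner & cross].
  rewrite -setI_eq0; apply/eqP/setP => d; rewrite in_setI innerE crossE in_set0.
  by case: eqP; rewrite /= ?andbF.
have := porbits_phiU rho inner_sym cross_sym dis.
rewrite -eD !porbits_phi //; [|exact: darts_sym|exact: inner_sym].
move=> le; have {le} := le (fun d dc => darts_neq (proj1 (andP (etrans (esym (crossE d)) dc)))).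
suff : \sum_(i in p @: S) (1 + ~~ odd (nverts i + #|in_block i|./2)) <= cyc (phi rho inner) D.
  by move: (cyc _ _) (cyc _ _) #|_|./2 #|_| => ? ? ? ?; lia.
rewrite (_ : D = [set d in D | p d.1 \in enum (p @: S)]); last first.
  apply/setP => d; rewrite in_sep; case: (boolP (d \in D)) => //= dD.
  by rewrite mem_enum imset_f //; move: dD; case: d => x y; rewrite dartsE => /and3P[].
rewrite cyc_sum ?enum_uniq // big_enum /=.
by apply: leq_sum => i; apply: cyc_block.
Qed.

End LowerBound.
End Rotation.

Lemma connect_prop (T : finType) (e : rel T) (P : T -> Prop) x y : connect e x y -> P x ->
  (forall u v, P u -> e u v -> P v) -> P y.
Proof.
move=> /connectP[p ep ->] Px st; elim: p x ep Px => //= z p IH x /andP[xz zp] Px.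
by apply: IH zp _; apply: st xz.
Qed.

Lemma connect_exit (T : finType) (e : rel T) (P : {set T}) x y :
  connect e x y -> x \in P -> y \notin P -> exists u v, [/\ u \in P, v \notin P & e u v].
Proof.
move=> /connectP[p ep ->]; elim: p x ep => [|z p IH] x /=; first by move=> _ ->.
move=> /andP[exz ep] xP lP; have [zP|zP] := boolP (z \in P); first exact: (IH z).
by exists x, z.
Qed.

Lemma one_cycle_center (D : finType) (s : {perm D}) (A : {set D}) c :
  (forall z, z \in A -> z \in porbit s c) -> one_cycle s A.
Proof.
by move=> h x y xA yA; rewrite -eq_porbit_mem; have := h _ xA; have := h _ yA;
   rewrite -!eq_porbit_mem => /eqP -> /eqP ->.
Qed.

(** * Embeddings with one face *)

Section RotationExists.
Variables (T : finType) (g : rel T).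

Variables (S : {set T}).

Let nbrs v := [seq w <- enum S | g v w].
Let D := darts g S.

Let mem_nbrs d : d \in D = (d.1 \in S) && (d.2 \in nbrs d.1).
Proof. by case: d => x y; rewrite dartsE mem_filter mem_enum /=; case: (g x y); rewrite ?andbF. Qed.

Let uniq_nbrs v : uniq (nbrs v). Proof. exact/filter_uniq/enum_uniq. Qed.

(** The neighbours of a vertex are turned in their enumeration order. Any cyclic order would do as a
    start, since [glue_vertex] may replace it later. *)
Let rot_fun d := if d \in D then (d.1, next (nbrs d.1) d.2) else d.

Let rot_darts d : (rot_fun d \in D) = (d \in D).
Proof. by rewrite /rot_fun; case: ifP => [|-> //]; rewrite !mem_nbrs /= mem_next. Qed.

Let rot_inj : injective rot_fun.
Proof.
move=> d e E; have := rot_darts d; rewrite E rot_darts.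
move: E; rewrite /rot_fun => E de; move: E; rewrite de; case: (d \in D) => //.
case: d e {de} => x y [x' y'] [<-] /(can_inj (prev_next (uniq_nbrs x))).
by move=> ->.
Qed.

Lemma rotation_exists : exists rho, rotation_system g S rho.
Proof.
exists (perm rot_inj); split.
- by move=> d; rewrite permE /rot_fun => /negbTE ->.
- by move=> d; rewrite permE /rot_fun; case: ifP.
move=> [x y] [x' y'] dD + /= E; rewrite -{x'}E => dD'.
have itE n : iter n (perm rot_inj) (x, y) = (x, iter n (next (nbrs x)) y)
             /\ iter n (perm rot_inj) (x, y) \in D.
  elim: n => //= n [IH1 IH2]; move: IH2; rewrite permE rot_darts => IH2; split=> //.
  by rewrite /rot_fun IH2 IH1.
have yn : y \in nbrs x by move: dD; rewrite mem_nbrs => /andP[].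
have : fconnect (next (nbrs x)) y y'.
  rewrite (fconnect_cycle (cycle_next (uniq_nbrs x))) //.
  by move: dD'; rewrite mem_nbrs => /andP[].
move=> /iter_findex <-; have [<- _] := itE (findex (next (nbrs x)) y y').
exact: fconnect_iter.
Qed.

End RotationExists.

Section TreeFace.
Variables (T : finType) (g : rel T).
Hypotheses (gsym : symmetric g) (girr : irreflexive g).
Variables (S : {set T}) (rho : {perm T * T}).
Hypothesis rot : rotation_system g S rho.

Let D := darts g S.

(* Growing a tree one leaf at a time merges the unique cycle with the rotation at the new leaf. *)
Lemma tree_one_cycle (H : {set T * T}) r : symset H -> H \subset D -> r \in S ->
  conn_in (fun x y => (x, y) \in H) S ->
  exists X, [/\ symset X, X \subset H, #|X| + 2 = 2 * #|S| & one_cycle (phi rho X) D].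
Proof.
move=> sH HD rS cH.
(* A tree on [P] has [#|P| - 1] edges, hence [2 * #|P| - 2] darts. *)
suff grow n : forall P X, #|S :\: P| <= n -> r \in P -> P \subset S -> symset X ->
    X \subset H -> (forall d, d \in X -> d.1 \in P) -> #|X| + 2 = 2 * #|P| ->
    one_cycle (phi rho X) [set d in D | d.1 \in P] ->
    exists X, [/\ symset X, X \subset H, #|X| + 2 = 2 * #|S| & one_cycle (phi rho X) D].
  apply: (grow _ [set r] set0 (leqnn _)); rewrite ?set11 ?sub1set ?sub0set ?cards0 ?cards1 //.
  - by move=> d; rewrite in_set0.
  - by move=> d; rewrite in_set0.
  move=> d e; rewrite !in_sep !in_set1 => /andP[dD /eqP dr] /andP[eD /eqP er].
  have -> : phi rho set0 = rho.
    by apply/permP => z; rewrite phiE ?inE // => z'; rewrite inE.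
  by rewrite -fconnect_porbit; case: rot => _ _; apply => //; rewrite dr er.
elim: n => [|n IH] P X.
  rewrite leqn0 cards_eq0 setD_eq0 => SP _ PS sX XH _ cX oc.
  have ePS : P = S by apply/eqP; rewrite eqEsubset PS.
  exists X; split; rewrite // -?ePS // => d e dD eD.
  have inP z : z \in D -> z \in [set d in D | d.1 \in P].
    move=> zD; rewrite in_sep zD /= ePS.
    by case: z zD => x y; rewrite dartsE => /and3P[].
  by apply: oc; apply: inP.
move=> le rP PS sX XH XP cX oc.
have [SP|] := boolP (S \subset P).
  by apply: (IH P X) => //; move: SP; rewrite -setD_eq0 => /eqP ->; rewrite cards0.
move=> /subsetPn[y yS yP].
have [u [v [uP vP /= /andP[/andP[uvH uS] vS]]]] := connect_exit (cH _ _ rS yS) rP yP.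
pose d := (u, v).
have dX : d \notin X by apply: contra vP => /sX /XP.
have dD : d \in D by apply: (subsetP HD).
have sdD : sw d \in D by apply: darts_sym.
have dn : d.1 != d.2 by apply: darts_neq dD.
set s := phi rho X in oc *.
pose DP := [set d in D | d.1 \in P].
have inDP z : z \in DP = (z \in D) && (z.1 \in P) by rewrite in_sep.
have XD : X \subset D := subset_trans XH HD.
have stDP z : z \in DP -> s z \in DP.
  rewrite !inDP => /andP[zD zP]; rewrite phi_darts //= phiE // (rho1 rot).
  by case: ifP => // zX; apply: XP; apply: sX.
have dDP : d \in DP by rewrite inDP dD.
(* The cycle of [d] stays among the darts that start in [P], whereas [sw d] starts at the new
   leaf. *)
have ns : d \notin porbit s (sw d).
  apply/negP; rewrite porbit_sym => /(porbit_stable stDP dDP).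
  by rewrite inDP /= (negbTE vP) andbF.
have [_ mer] := porbits_merge ns.
have es : phi rho (X :|: [set d; sw d]) = (tperm d (sw d) * s)%g by rewrite /s phi_add.
have atv z : z \in D -> z.1 = v -> z \in porbit s (sw d).
  move=> zD zv; pose A := [set z in D | z.1 == v].
  have inA z' : z' \in A = (z' \in D) && (z'.1 == v) by rewrite in_sep.
  have rA z' : z' \in A -> rho z' \in A by rewrite !inA (rho_darts rot) (rho1 rot).
  have eA : {in A, rho =1 s}.
    move=> z'; rewrite inA => /andP[_ /eqP zv']; rewrite /s phiE // ifN //.
    by apply: contra vP => /XP; rewrite zv'.
  rewrite -(eq_porbit_in rA eA) ?inA ?sdD ?eqxx //.
  by rewrite -fconnect_porbit; case: rot => _ _; apply.
apply: (IH (v |: P) (X :|: [set d; sw d])).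
- rewrite -ltnS; apply: leq_trans le; apply: proper_card.
  rewrite properE setDS ?subsetUr //=; apply/subsetPn; exists v; by rewrite !inE ?eqxx ?vP.
- by rewrite !inE rP orbT.
- by rewrite subUset sub1set vS.
- exact/symsetU/symset2.
- rewrite subUset XH; apply/subsetP => z; rewrite !inE => /orP[]/eqP-> //; exact: sH.
- by move=> z; rewrite !inE => /orP[/XP->|/orP[]/eqP->]; rewrite ?orbT ?eqxx //= uP orbT.
- by rewrite card_symsetU2 // cardsU1 vP; move: cX; clear; move: #|X| #|P|; lia.
rewrite es; apply: (@one_cycle_center _ _ _ (sw d)) => z.
rewrite in_sep in_setU1 => /andP[zD zvP].
have : z \in porbit s d \/ z \in porbit s (sw d).
  case/predU1P: zvP => [zv|zP]; first by right; apply: atv.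
  by left; apply: oc; rewrite -/DP inDP ?dD ?zD.
by case=> /(@porbit_tperm _ s d (sw d)) [] // /(porbit_trans mer).
Qed.

End TreeFace.

Section PairFace.
Variables (T : finType) (g : rel T).
Hypotheses (gsym : symmetric g) (girr : irreflexive g).
Variables (S : {set T}).
Let D := darts g S.

Section Flip.
Variables (rho : {perm T * T}) (X : {set T * T}) (v : T) (d1 d2 d3 : T * T).
Hypothesis rot : rotation_system g S rho.
Hypotheses (sX : symset X) (XD : X \subset D) (oc : one_cycle (phi rho X) D).
Hypotheses (v1 : d1.1 = v) (v2 : d2.1 = v) (v3 : d3.1 = v).
Hypotheses (D1 : d1 \in D) (D2 : d2 \in D) (D3 : d3 \in D).
Hypotheses (n12 : d1 != d2) (n13 : d1 != d3) (n23 : d2 != d3).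
Hypothesis atv : forall d, d \in D -> d.1 = v -> [|| d == d1, d == d2 | d == d3].
Hypotheses (X1 : d1 \notin X) (X2 : d2 \notin X).

Hypotheses (r1 : rho d1 = d2) (r2 : rho d2 = d3) (r3 : rho d3 = d1).

(** The rotation [d1 d2 d3] at [v] becomes [d1 d3 d2]. Writing the change as two transpositions lets
    its effect on the faces be computed by two merges. *)
Definition flip := (tperm d1 d2 * tperm d1 d3 * rho)%g.

Let f1 : flip d1 = d3.
Proof. by rewrite !permM tpermL tpermD // 1?eq_sym // r2. Qed.
Let f2 : flip d2 = d1.
Proof. by rewrite !permM tpermR tpermL r3. Qed.
Let f3 : flip d3 = d2.
Proof. by rewrite !permM (tpermD n13 n23) tpermR r1. Qed.
Let f_off d : [&& d != d1, d != d2 & d != d3] -> flip d = rho d.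
Proof.
move=> /and3P[e1 e2 e3].
by rewrite !permM (_ : tperm d1 d2 d = d) !tpermD // eq_sym.
Qed.

Lemma rotation_flip : rotation_system g S flip.
Proof.
case: (rot) => fixr _ trr; split.
- move=> d dD; rewrite f_off ?fixr //.
  by apply/and3P; split; apply: contraNneq dD => ->.
- move=> d; have [->|n1] := eqVneq d d1; first by rewrite f1 v3.
  have [->|n2] := eqVneq d d2; first by rewrite f2 v1.
  have [->|n3] := eqVneq d d3; first by rewrite f3 v2.
  by rewrite f_off ?n1 ?n2 // (rho1 rot).
move=> d d' dD d'D dd'; rewrite fconnect_porbit.
have [dv|dv] := eqVneq d.1 v.
  have {d'D dd'} d'v : [|| d' == d1, d' == d2 | d' == d3] by apply: atv; rewrite -?dd'.
  have {dD dv} dv : [|| d == d1, d == d2 | d == d3] by apply: atv.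
  have c z : [|| z == d1, z == d2 | z == d3] -> z \in porbit flip d1.
    move=> /or3P[]/eqP->; first exact: porbit_id.
      by apply: (porbit_trans (y := d3)); [rewrite -f1|rewrite -f3]; apply: porbit1.
    by rewrite -f1 porbit1.
  have := c _ dv; have := c _ d'v.
  by rewrite -!eq_porbit_mem => /eqP -> /eqP ->.
pose A := [set z in D | z.1 == d.1].
have inA z' : z' \in A = (z' \in D) && (z'.1 == d.1) by rewrite in_sep.
have rA z' : z' \in A -> rho z' \in A by rewrite !inA (rho_darts rot) (rho1 rot).
have eA : {in A, rho =1 flip}.
  move=> z; rewrite inA => /andP[_ zd]; rewrite f_off //.
  apply/and3P; split; apply: contraNneq dv => e; by rewrite -(eqP zd) e ?v1 ?v2 ?v3.
by rewrite -(eq_porbit_in rA eA) ?inA ?dD ?eqxx // -fconnect_porbit; apply: trr.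
Qed.

Let d1' := sw d1.
Let d2' := sw d2.
Let XX := X :|: [set d1; d1'] :|: [set d2; d2'].

Let sw_ne d e : d \in D -> e.1 = v -> d.1 = v -> d != sw e.
Proof.
move=> dD ev dv; apply/eqP => E; have := darts_neq girr dD.
by rewrite {2}E /= ev dv eqxx.
Qed.

(* Glueing the two edges at [d1] and [d2] either leaves one face or produces three faces all
   incident with the vertex [v]; in the latter case, reversing the rotation at [v] merges them. *)
Lemma glue_pair : exists rho', rotation_system g S rho' /\ one_cycle (phi rho' XX) D.
Proof.
have dn1 := darts_neq girr D1; have dn2 := darts_neq girr D2.
have sX1 : symset (X :|: [set d1; sw d1]) by exact/symsetU/symset2.
have sXX : symset XX by exact/symsetU/symset2.
have d2X1 : d2 \notin X :|: [set d1; sw d1].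
  by rewrite in_setU in_set2 (negbTE X2) eq_sym (negbTE n12) (negbTE (sw_ne _ _ _)).
have nsw e : e \in D -> e.1 = v -> forall e', e'.1 = v -> e != sw e'.
  by move=> eD ev e' ev'; apply: sw_ne.
have D1' : d1' \in D by apply: darts_sym.
have D2' : d2' \in D by apply: darts_sym.
pose s := phi rho X; have ocs : one_cycle s D := oc.
pose t1 := (tperm d1 d1' * s)%g; pose t2 := (tperm d2 d2' * t1)%g.
have et2 : phi rho XX = t2 by rewrite /XX !phi_add.
have s1 : s d1 = d2 by rewrite phiE // (negbTE X1).
have n1 : d1 != d1' by apply: nsw.
have n2 : d2 != d2' by apply: nsw.
(* The edge at [d1] splits the only face. As [t1] sends [d1'] to [d2], the darts [d1] and [d2] end
   up on different faces. *)
have [_ sp1] := porbits_split n1 (ocs _ _ D1' D1).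
have t1d1' : d2 \in porbit t1 d1'.
  by have := porbit1 t1 d1'; rewrite permM tpermR s1.
have o12 : d1 \notin porbit t1 d2.
  by apply: contra sp1; apply: porbit_trans.
have in_t1 z : z \in D -> z \in porbit t1 d1 \/ z \in porbit t1 d2.
  move=> zD; have [||zd] := @porbit_tperm _ s d1 d1' z d1 (ocs _ _ D1 zD); [by left|by left|right].
  by apply: porbit_trans zd; rewrite porbit_sym.
(* If [d2'] is on the face of [d1], the second edge merges the two faces again and the rotation can
   stay. *)
have [same|diff] := boolP (d2 \in porbit t1 d2'); last first.
  exists rho; split=> //; rewrite et2; have [_ mer] := porbits_merge diff.
  have d2'1 : d2' \in porbit t1 d1.
    by case: (in_t1 _ D2') => //; rewrite porbit_sym (negbTE diff).
  apply: (@one_cycle_center _ _ _ d2') => z /in_t1[zd1|zd2].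
    have zd2' : z \in porbit t1 d2' by rewrite porbit_sym in d2'1; apply: porbit_trans zd1.
    by have [||] := @porbit_tperm _ t1 d2 d2' z d2' zd2' => // /(porbit_trans mer).
  by have [||] := @porbit_tperm _ t1 d2 d2' z d2 zd2 => // /(porbit_trans mer).
have [_ sp2] := porbits_split n2 same.
have o12' : d2' \notin porbit t1 d1.
  apply: contra o12 => d2'1; rewrite porbit_sym.
  by apply: porbit_trans d2'1 _; rewrite porbit_sym in same; rewrite porbit_sym.
have o21 : d2 \notin porbit t1 d1 by rewrite porbit_sym.
have et2d1 := porbit_tperm_off o21 o12'.
have in_t2 z : z \in D -> [\/ z \in porbit t2 d1, z \in porbit t2 d2 | z \in porbit t2 d2'].
  move=> /in_t1[zd1|zd2]; first by constructor 1; rewrite et2d1.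
  by have [||] := @porbit_tperm _ t1 d2 d2' z d2 zd2; [constructor 2|constructor 2|constructor 3].
have o_d1 z : z \in porbit t1 d2 -> d1 \notin porbit t2 z.
  move=> zd2; rewrite porbit_sym et2d1; apply: contra o21 => zd1.
  by apply: porbit_trans zd1 _; rewrite porbit_sym.
(* Under [t2] the darts [d1'], [d2'], [d3'] are followed by [d2], [d3], [d1], and they lie on the
   three different faces. The third edge may be absent, in which case [glue XX d3] is the half-edge
   [d3] itself. *)
pose d3' := glue XX d3.
have i1 : glue XX d1' = d1 by rewrite glueE // /XX !inE eqxx !orbT swK.
have i2 : glue XX d2' = d2 by rewrite glueE // /XX !inE eqxx !orbT swK.
have i3 : glue XX d3' = d3 by rewrite glueK.
have t2E e : t2 e = rho (glue XX e) by rewrite -et2 permM.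
have p1 : d2 \in porbit t2 d1' by rewrite -r1 -i1 -t2E porbit1.
have p2 : d3 \in porbit t2 d2' by rewrite -r2 -i2 -t2E porbit1.
have p3 : d1 \in porbit t2 d3' by rewrite -r3 -i3 -t2E porbit1.
(* Reversing the rotation at [v] amounts to two transpositions among [d1'], [d2'], [d3'], and each
   of them merges two faces. *)
pose t3 := (tperm d1' d3' * t2)%g; pose t4 := (tperm d1' d2' * t3)%g.
have et4 : phi flip XX = t4.
  have c2 := glue_tperm XX d1' d2'; have c3 := glue_tperm XX d1' d3'.
  rewrite i1 i2 in c2; rewrite i1 i3 in c3.
  by rewrite /phi /flip !mulgA c2 -(mulgA _ (glue XX)) c3 -!mulgA -/(phi rho XX) et2.
have q1 : d1' \notin porbit t2 d3'.
  apply: contra (o_d1 d2 (porbit_id _ _)) => h; rewrite porbit_sym in h.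
  by rewrite porbit_sym in p1; apply: porbit_trans (porbit_trans p1 h) p3.
have q2 : d1' \notin porbit t2 d2'.
  by apply: contra sp2 => h; apply: porbit_trans h p1.
have q3 : d3' \notin porbit t2 d2'.
  apply: contra (o_d1 d2' _) => [h|]; last by rewrite porbit_sym.
  exact: porbit_trans h p3.
have q4 : d1' \notin porbit t3 d2' by rewrite porbit_tperm_off.
have [_ m3] := porbits_merge q1; have [_ m4] := porbits_merge q4.
exists flip; split; first exact: rotation_flip.
rewrite et4; apply: (@one_cycle_center _ _ _ d2') => z /in_t2 zt2.
have {}zt2 : [\/ z \in porbit t2 d3', z \in porbit t2 d1' | z \in porbit t2 d2'].
  by case: zt2 => h; [constructor 1|constructor 2|constructor 3]; apply: porbit_trans h; rewrite ?porbit_id.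
have {}zt2 : z \in porbit t3 d3' \/ z \in porbit t3 d2'.
  case: zt2 => [h|h|h].
  - by left; have [||] := @porbit_tperm _ t2 d1' d3' z d3' h => // /(porbit_trans m3).
  - by left; have [||] := @porbit_tperm _ t2 d1' d3' z d1' h => // /(porbit_trans m3).
  - by right; rewrite porbit_tperm_off.
have d3t4 : d3' \in porbit t4 d2'.
  rewrite porbit_sym in m3.
  by have [||] := @porbit_tperm _ t3 d1' d2' d3' d1' m3 => // /(porbit_trans m4).
case: zt2 => h.
  by have [/(porbit_trans d3t4)||] := @porbit_tperm _ t3 d1' d2' z d3' h => // /(porbit_trans m4).
by have [||] := @porbit_tperm _ t3 d1' d2' z d2' h => // /(porbit_trans m4).
Qed.

End Flip.

(** The rotation at a vertex of degree three is one of two 3-cycles. The second reduces to the first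
    by exchanging the roles of [a] and [b]. *)
Lemma glue_vertex rho X v a b c : rotation_system g S rho -> symset X -> X \subset D ->
  one_cycle (phi rho X) D -> [/\ (v, a) \in D, (v, b) \in D & (v, c) \in D] ->
  [/\ a != b, a != c & b != c] -> (forall w, (v, w) \in D -> [|| w == a, w == b | w == c]) ->
  (v, a) \notin X -> (v, b) \notin X ->
  exists rho', rotation_system g S rho' /\
    one_cycle (phi rho' (X :|: [set (v, a); (a, v)] :|: [set (v, b); (b, v)])) D.
Proof.
move=> rot sX XD oc [Da Db Dc] [nab nac nbc] at_v Xa Xb.
have at_v' d : d \in D -> d.1 = v -> [|| d == (v, a), d == (v, b) | d == (v, c)].
  by case: d => v' w wD /= E; move: wD; rewrite E => /at_v; rewrite !xpair_eqE eqxx.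
have rhov w : (v, w) \in D -> [|| rho (v, w) == (v, a), rho (v, w) == (v, b) | rho (v, w) == (v, c)].
  by move=> wD; apply: at_v'; rewrite ?(rho_darts rot) // (rho1 rot).
have ne x y : x != y -> (v, x) != (v, y) by rewrite xpair_eqE eqxx.
have closed_orbit (P : pred (T * T)) d e : d \in D -> e \in D -> d.1 = e.1 ->
    P d -> (forall z, P z -> P (rho z)) -> P e.
  move=> dD eD de Pd Pr; apply: (@porbit_ind _ rho d (fun z => P z)) => //.
  by rewrite -fconnect_porbit; case: rot => _ _; apply.
have nofix x y : (v, x) \in D -> (v, y) \in D -> x != y -> rho (v, x) != (v, x).
  move=> xD yD nxy; apply: contraNneq nxy => fx.
  have := @closed_orbit (pred1 (v, x)) _ _ xD yD erefl (eqxx _).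
  rewrite /= xpair_eqE eqxx eq_sym; apply=> z /eqP ->; by rewrite fx.
have no2 x y z : [/\ (v, x) \in D, (v, y) \in D & (v, z) \in D] -> z != x -> z != y ->
    rho (v, x) = (v, y) -> rho (v, y) != (v, x).
  move=> [xD yD zD] zx zy rx; apply/negP => /eqP ry.
  have := @closed_orbit (pred2 (v, x) (v, y)) _ _ xD zD erefl (predU1l _ erefl).
  rewrite /= !xpair_eqE !eqxx (negbTE zx) (negbTE zy) /= => h.
  by apply: notF; apply: h => u /orP[]/eqP->; rewrite ?rx ?ry eqxx ?orbT.
have cyc3 x y z : (forall w, (v, w) \in D -> [|| w == x, w == y | w == z]) ->
    [/\ (v, x) \in D, (v, y) \in D & (v, z) \in D] ->
    [/\ x != y, x != z & y != z] -> rho (v, x) = (v, y) ->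
    rho (v, y) = (v, z) /\ rho (v, z) = (v, x).
  move=> at_w [xD yD zD] [nxy nxz nyz] rx.
  have rw w : (v, w) \in D -> [|| rho (v, w) == (v, x), rho (v, w) == (v, y) | rho (v, w) == (v, z)].
    move=> wD; have := rho_darts rot (v, w); have := rho1 rot (v, w).
    by rewrite wD; case: (rho _) => v' w' /= -> /at_w; rewrite !xpair_eqE eqxx.
  have ry : rho (v, y) = (v, z).
    case/or3P: (rw y yD) => /eqP // E; last by move/eqP: E; rewrite (negbTE (nofix y z _ _ _)).
    by have := no2 x y z; rewrite E eqxx eq_sym nxz eq_sym nyz => /(_ (And3 xD yD zD) isT isT rx).
  split=> //; case/or3P: (rw z zD) => /eqP // E.
    by move: rx; rewrite -E => /perm_inj [] /eqP; rewrite (negbTE nxz).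
  by move: ry; rewrite -E => /perm_inj [] /eqP; rewrite (negbTE nyz).
have /or3P[/eqP E|/eqP E|/eqP E] := rhov _ Da.
- by have := nofix a b Da Db nab; rewrite E eqxx.
- have [rb rc] := cyc3 a b c at_v (And3 Da Db Dc) (And3 nab nac nbc) E.
  by have := @glue_pair rho X v (v, a) (v, b) (v, c) rot; apply => //; apply: ne.
have at_v2 w : (v, w) \in D -> [|| w == a, w == c | w == b].
  by move=> /at_v /or3P[] ->; rewrite ?orbT.
have [rb rc] := cyc3 a c b at_v2 (And3 Da Dc Db) (And3 nac nab (etrans (congr1 negb (eq_sym _ _)) nbc)) E.
rewrite -setUA [X in _ :|: X]setUC setUA.
have := @glue_pair rho X v (v, b) (v, a) (v, c) rot; apply => //; try apply: ne => //.
  by rewrite eq_sym.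
by move=> d dD dv; have /or3P[] := at_v' d dD dv => ->; rewrite ?orbT.
Qed.

(** At each centre [v] in [M] only the edge to [q v] is kept at first. What remains is connected,
    and the count, with four darts withheld per centre, forces it to be a spanning tree. The
    withheld pairs then return one centre at a time by [glue_vertex]; no edge is withheld twice
    because [a] and [b] are not centres. *)
Theorem one_face_exists (X0 : {set T * T}) (M : {set T}) (q : T -> T) r :
  symset X0 -> X0 \subset D -> r \in S ->
  (forall v, v \in M -> exists a b, [/\
     [/\ (v, a) \in X0, (v, b) \in X0 & (v, q v) \in D],
     [/\ a != b, a != q v & b != q v],
     (forall w, (v, w) \in D -> [|| w == a, w == b | w == q v]),
     a \notin M & b \notin M]) ->
  conn_in (fun x y => [&& (x, y) \in X0, (x \in M) ==> (y == q x) & (y \in M) ==> (x == q y)]) S ->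
  #|X0| + 2 = 2 * #|S| + 4 * #|M| ->
  exists rho, rotation_system g S rho /\ one_cycle (phi rho X0) D.
Proof.
move=> sX0 X0D rS HM cH card0.
(* The list [s] holds the centres whose pair has already been returned. *)
pose ok (s : seq T) v w := (v \in M) && (v \notin s) ==> (w == q v).
pose XX s := [set d in X0 | ok s d.1 d.2 && ok s d.2 d.1].
have inXX s d : d \in XX s = [&& d \in X0, ok s d.1 d.2 & ok s d.2 d.1] by rewrite in_sep.
have sXX s : symset (XX s).
  by move=> d; rewrite !inXX => /and3P[/sX0 -> ? ?]; apply/and3P.
have XXD s : XX s \subset D.
  by apply/subsetP => d; rewrite inXX => /and3P[/(subsetP X0D)].
have step v s : v \in M -> v \notin s -> uniq s -> exists a b, [/\
     [/\ (v, a) \in D, (v, b) \in D & (v, q v) \in D],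
     [/\ a != b, a != q v & b != q v],
     (forall w, (v, w) \in D -> [|| w == a, w == b | w == q v]),
     (v, a) \notin XX s /\ (v, b) \notin XX s &
     XX (v :: s) = XX s :|: [set (v, a); (a, v)] :|: [set (v, b); (b, v)]].
  move=> vM vs us; have [a [b [[Xa Xb Dq] nn at_v aM bM]]] := HM v vM.
  have [nab naq nbq] := nn.
  have nvM w : w \notin M -> w == v = false by move=> wM; apply: contraNF wM => /eqP ->.
  have okv w : ok s v w = (w == q v) by rewrite /ok vM vs.
  have okv' w : ok (v :: s) v w by rewrite /ok vM inE eqxx.
  have okM s' w w' : w \notin M -> ok s' w w' by rewrite /ok => /negbTE ->.
  have okn w w' : w != v -> ok (v :: s) w w' = ok s w w'.
    by move=> wv; rewrite /ok inE (negbTE wv).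
  exists a, b; split=> //; first by split=> //; apply: (subsetP X0D).
    by rewrite !inXX /= !okv (negbTE naq) (negbTE nbq) !andbF.
  have nvv : ((v, v) \in X0) = false.
    by apply/negP => /(subsetP X0D) /(darts_neq girr); rewrite /= eqxx.
  have nav : v == a = false by apply: contraTF Xa => /eqP <-; rewrite nvv.
  have nbv : v == b = false by apply: contraTF Xb => /eqP <-; rewrite nvv.
  have atX y : y != v -> ((v, y) \in X0) && ok (v :: s) y v =
      [|| [&& (v, y) \in X0, y == q v & ok s y v], y == a | y == b].
    move=> yv; rewrite okn //.
    have [->|ya] := eqVneq y a; first by rewrite Xa okM //= orbT.
    have [->|yb] := eqVneq y b; first by rewrite Xb okM //= !orbT.
    rewrite !orbF; have [yX|//] := boolP ((v, y) \in X0).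
    by have := at_v y (subsetP X0D _ yX); rewrite (negbTE ya) (negbTE yb) /= => ->.
  apply/setP => -[x y]; rewrite !in_setU !in_set1 !inXX !xpair_eqE /=.
  have [->|xv] := eqVneq x v.
    have [->|yv] := eqVneq y v; first by rewrite nvv nav nbv.
    by rewrite !andbF /= !orbF okv okv' /= atX // orbA.
  have [->|yv] := eqVneq y v; last by rewrite /= !andbF /= !orbF !okn.
  have -> : ((x, v) \in X0) = ((v, x) \in X0) by rewrite -(symset_sw (v, x) sX0).
  by rewrite /= !andbT okv okv' andbT atX // (andbC (ok s x v)) orbA.
have main s : uniq s -> {subset s <= M} -> #|XX s| = #|XX [::]| + 4 * size s /\
    ((exists rho, rotation_system g S rho /\ one_cycle (phi rho (XX [::])) D) ->
     exists rho, rotation_system g S rho /\ one_cycle (phi rho (XX s)) D).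
  elim: s => [|v s IH]; first by rewrite muln0 addn0.
  move=> /= /andP[vs us] sM; have vM : v \in M by apply: sM; rewrite inE eqxx.
  have [|cs IHs] := IH us; first by move=> w ws; apply: sM; rewrite inE ws orbT.
  have [a [b [[Da Db Dq] [nab naq nbq] at_v [Xa Xb] ->]]] := step v s vM vs us.
  split.
    have sXa : symset (XX s :|: [set (v, a); (a, v)]).
      by apply: symsetU => //; apply: symset2.
    have nb : (v, b) \notin XX s :|: [set (v, a); (a, v)].
      rewrite !in_setU !in_set1 (negbTE Xb) !xpair_eqE eqxx eq_sym (negbTE nab) /=.
      by have := darts_neq girr Da; case: eqVneq.
    rewrite (@card_symsetU2 _ _ (v, b)) // ?(@card_symsetU2 _ _ (v, a)) ?cs //.
    - by move: #|XX _| (size s); clear; lia.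
    - exact: (darts_neq girr Da).
    - exact: (darts_neq girr Db).
  by move=> /IHs[rho [rot oc]]; apply: (glue_vertex rot _ _ oc (c := q v)).
have [|cM oneM] := main (enum M) (enum_uniq M); first by move=> v; rewrite mem_enum.
have eX0 : XX (enum M) = X0.
  apply/setP => d; rewrite inXX /ok !mem_enum; case: (d.1 \in M); case: (d.2 \in M);
    by rewrite /= !andbT.
rewrite eX0 -cardE in cM oneM; apply: oneM.
have eXX x y : ((x, y) \in XX [::]) =
    [&& (x, y) \in X0, (x \in M) ==> (y == q x) & (y \in M) ==> (x == q y)].
  by rewrite inXX /ok /= !andbT.
have [rho rot] := rotation_exists g S; exists rho; split=> //.
have [|X [sX XH cX oc]] := @tree_one_cycle T g gsym girr S rho rot (XX [::]) r (sXX _) (XXD _) rS.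
  move=> x y xS yS; rewrite (eq_connect (e' := [rel a b | [&& (a, b) \in X0, (a \in M) ==> (b == q a) & (b \in M) ==> (a == q b)] && (a \in S) && (b \in S)])); first exact: cH.
  by move=> u w /=; rewrite eXX.
have <- // : X = XX [::].
apply/eqP; rewrite eqEcard XH /=; move: cX card0; rewrite cM.
by move: #|X| #|XX _| #|S| #|M|; clear; lia.
Qed.

End PairFace.

Section FewFaces.
Variables (T : finType) (g : rel T).
Hypotheses (gsym : symmetric g) (girr : irreflexive g).
Variables (S : {set T}) (rho : {perm T * T}).
Hypothesis rot : rotation_system g S rho.
Let D := darts g S.

Lemma nfaces_le2 d : d \in D ->
  (forall z, z \in D -> z \in porbit (phi rho D) d \/ z \in porbit (phi rho D) (sw d)) ->
  nfaces g S rho <= 2.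
Proof.
move=> dD h; rewrite (nfacesE gsym rot); last by apply/card_gt0P; exists d.
apply: (@leq_trans #|[set porbit (phi rho D) d; porbit (phi rho D) (sw d)]|); last first.
  by rewrite cards2; case: (_ == _).
apply/subset_leq_card/subsetP => _ /imsetP[z /h zD ->].
by rewrite in_set2 !eq_porbit_mem; apply/orP.
Qed.

Lemma nfaces_one_cycle d : d \in D -> one_cycle (phi rho D) D -> nfaces g S rho <= 2.
Proof. by move=> dD oc; apply: (nfaces_le2 dD) => z zD; left; apply: oc. Qed.

(** The last edge can split the single face only into the faces of its own two darts. *)
Lemma nfaces_one_cycle_setD d : d \in D ->
  one_cycle (phi rho (D :\: [set d; sw d])) D -> nfaces g S rho <= 2.
Proof.
move=> dD oc; apply: (nfaces_le2 dD) => z zD.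
set X := D :\: _ in oc; have sX : symset X.
  move=> e; rewrite !in_setD !in_set2 !(can2_eq (@swK _) (@swK _)) swK orbC.
  by move=> /andP[-> eD]; apply: darts_sym.
have eD : D = X :|: [set d; sw d].
  apply/setP => e; rewrite in_setU in_setD.
  case: (boolP (e \in [set d; sw d])); rewrite ?orbF ?orbT // in_set2.
  by move=> /orP[]/eqP->; rewrite ?dD //; apply: darts_sym.
rewrite eD phi_add //; last 2 first.
- by rewrite in_setD in_set2 eqxx.
- exact: darts_neq dD.
by have [||] := porbit_tperm d (sw d) (oc d z dD zD); [left|left|right].
Qed.

End FewFaces.

(** * Neighbourhoods and edge counts in cubic graphs *)

Lemma perm_132 (I : eqType) (a b c : I) : perm_eq [:: a; b; c] [:: a; c; b].
Proof. by apply/seq.permP => P /=; lia. Qed.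

Lemma perm_213 (I : eqType) (a b c : I) : perm_eq [:: a; b; c] [:: b; a; c].
Proof. by apply/seq.permP => P /=; lia. Qed.

Lemma perm_231 (I : eqType) (a b c : I) : perm_eq [:: a; b; c] [:: b; c; a].
Proof. by apply/seq.permP => P /=; lia. Qed.

Lemma perm_1243 (I : eqType) (a b c d : I) : perm_eq [:: a; b; c; d] [:: a; b; d; c].
Proof. by apply/seq.permP => P /=; lia. Qed.

Section Neighbours.
Variables (T : finType) (g : rel T).

Definition nb x (s : seq T) := [/\ size s = 3, uniq s & forall y, g x y = (y \in s)].

Lemma nb_perm x s t : perm_eq s t -> nb x s -> nb x t.
Proof.
by move=> st [s3 us h]; split; rewrite -?(perm_size st) -?(perm_uniq st) // => y; rewrite -(perm_mem st).
Qed.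

Lemma nb_eqi x s t : nb x s -> size t = 3 -> uniq t -> (forall y, y \in t -> g x y) -> nb x t.
Proof.
move=> [s3 us h] t3 ut ht; split=> // y; rewrite h.
have sub : {subset t <= s} by move=> z /ht; rewrite h.
by have [_ ->] := uniq_min_size ut sub (eq_leq (etrans s3 (esym t3))).
Qed.

Hypothesis cub : cubic g.

Lemma nb_exists x : exists a b c, nb x [:: a; b; c].
Proof.
have := cub x; rewrite cardE; case E : (enum _) => [|a [|b [|c [|? ?]]]] // _.
exists a, b, c; split=> // [|y]; first by rewrite -E enum_uniq.
by rewrite -E mem_enum.
Qed.

Lemma nb3 x a b c : uniq [:: a; b; c] -> g x a -> g x b -> g x c -> nb x [:: a; b; c].
Proof.
move=> us xa xb xc; have [a' [b' [c' nx]]] := nb_exists x.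
by apply: (nb_eqi nx) => // y; rewrite !inE => /or3P[]/eqP->.
Qed.

Lemma nb2 x y z : g x y -> g x z -> y != z -> exists w, nb x [:: y; z; w].
Proof.
move=> xy xz yz; have [a [b [c [_ us h]]]] := nb_exists x.
have [w] : exists w, (w \in [:: a; b; c]) && (w \notin [:: y; z]).
  apply/existsP/negbNE/negP; rewrite negb_exists => /forallP m.
  have sub : {subset [:: a; b; c] <= [:: y; z]}.
    by move=> w wa; have := m w; rewrite wa negbK.
  by have := uniq_leq_size us sub.
rewrite -h => /andP[xw]; rewrite !inE negb_or => /andP[wy wz].
by exists w; apply: nb3 => //=; rewrite !inE negb_or yz eq_sym wy eq_sym wz.
Qed.

End Neighbours.

(* [K4] is the only graph of this kind in which diamonds overlap. *)
Class claw_free_cubic (T : finType) (g : rel T) : Prop := ClawFreeCubic {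
  cfc_sym : symmetric g;
  cfc_irr : irreflexive g;
  cfc_cubic : cubic g;
  cfc_claw_free : claw_free g;
  cfc_noK4 : forall x a b c, nb g x [:: a; b; c] -> ~ [/\ g a b, g a c & g b c]
}.

Lemma in_setC2 (T : finType) (x y v : T) : (v \in ~: [set x; y]) = (v != x) && (v != y).
Proof. by rewrite !inE negb_or. Qed.

Lemma card_pairs (T : finType) (A : {set T * T}) :
  #|A| = \sum_x \sum_y ((x, y) \in A : nat).
Proof.
rewrite pair_big /= -sum1_card big_mkcond; apply: eq_bigr => -[x y] _ /=.
by case: (_ \in A).
Qed.

Lemma conn_in_edge (T : finType) (r : rel T) (S : {set T}) v : conn_in r S -> 1 < #|S| ->
  v \in S -> exists2 w, w \in S & r v w.
Proof.
move=> cS; rewrite (cardsD1 v) => c1 vS; rewrite vS ltnS in c1.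
have /card_gt0P[w] := c1; rewrite !inE => /andP[wv wS].
have /connectP[[|z p] /=] := cS v w vS wS; first by move=> _ E; rewrite E eqxx in wv.
by move=> /andP[/andP[/andP[vz _] zS] _] _; exists z.
Qed.

Lemma sum_setC2 (T : finType) (F : T -> nat) x y : x != y ->
  \sum_(b in ~: [set x; y]) F b + F x + F y = \sum_b F b.
Proof.
move=> nxy; rewrite [RHS](bigD1 x) //= [in RHS](bigD1 y) 1?eq_sym //=.
rewrite (eq_bigl (fun b => (b != x) && (b != y))); last by move=> b; apply: in_setC2.
by rewrite -addnA addnC addnA.
Qed.

Section TwoConnected.
Variables (T : finType) (g : rel T).
Hypotheses (gsym : symmetric g) (girr : irreflexive g) (two : two_connected g) (cub : cubic g).

Lemma sum_nb x : \sum_y (g x y : nat) = 3.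
Proof.
by rewrite -(cub x) -sum1_card [RHS]big_mkcond; apply: eq_bigr => y _; rewrite inE; case: (g x y).
Qed.

Lemma card_darts (S : {set T}) : #|darts g S| = \sum_(x in S) \sum_(y in S) g x y.
Proof.
rewrite card_pairs [RHS]big_mkcond; apply: eq_bigr => x _; case: ifP => xS; last first.
  by apply: big1 => y _; rewrite dartsE xS andbF.
rewrite [RHS]big_mkcond; apply: eq_bigr => y _; rewrite dartsE xS /=.
by case: (y \in S); rewrite ?andbT ?andbF.
Qed.

Lemma card_darts_setT : #|darts g setT| = 3 * #|T|.
Proof.
rewrite card_darts (eq_bigr (fun=> 3)) ?sum_nat_const ?cardsT 1?mulnC // => x _.
by rewrite -(sum_nb x); apply: eq_bigl => y; rewrite inE.
Qed.

(** The ten lost darts belong to five edges: [xy] and two more at each of its ends. *)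
Lemma card_darts_setC2 x y : g x y -> #|darts g (~: [set x; y])| + 10 = 3 * #|T|.
Proof.
move=> xy; have nxy : x != y by apply: contraTneq xy => ->; rewrite girr.
have h z : g x z + g y z + \sum_(b in ~: [set x; y]) g z b = 3.
  by rewrite -(sum_nb z) -(sum_setC2 _ nxy) !(gsym z) addnC addnA.
have hS z : z \in [set x; y] -> \sum_(b in ~: [set x; y]) g z b = 2.
  have := h z; rewrite in_set2 => + /orP[]/eqP E; rewrite E !girr ?(gsym y x) xy;
    by move: (\sum_(b in _) _); clear; lia.
have hx w : w \in [set x; y] -> \sum_(b in ~: [set x; y]) g b w = 2.
  by move=> /hS <-; apply: eq_bigr => b _; rewrite gsym.
have : \sum_(a in ~: [set x; y]) (g x a + g y a + \sum_(b in ~: [set x; y]) g a b) =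
       3 * #|~: [set x; y]|.
  by rewrite (eq_bigr (fun=> 3)) ?sum_nat_const 1?mulnC // => z _; apply: h.
rewrite !big_split /= !hS ?in_set2 ?eqxx ?orbT // -card_darts.
have := cardsC [set x; y]; rewrite cards2 nxy /=.
by move: #|T| #|darts _ _| #|~: _|; clear; lia.
Qed.

(** [G - x] already connects [y] to everything except [x], and [x] has a neighbour other than [y]
    because [G - y] is connected. *)
Lemma no_bridge x y : g x y ->
  conn_in (fun a b => g a b && ~~ (((a == x) && (b == y)) || ((a == y) && (b == x)))) setT.
Proof.
move=> xy a b _ _; have [T2 [_ conV]] := two.
have nxy : x != y by apply: contraTneq xy => ->; rewrite girr.
set e := (X in connect X).
have e_sym : connect_sym e.
  apply: sym_connect_sym => u v; rewrite /e /= !inE !andbT gsym.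
  by congr (_ && ~~ _); rewrite orbC andbC [X in _ || X]andbC.
suff h z : connect e y z by apply: connect_trans (h b); rewrite e_sym.
have toy w : w != x -> connect e y w.
  move=> wx; have := conV x y w; rewrite !inE eq_sym nxy wx => /(_ isT isT).
  apply: connect_sub => u v /=; rewrite !inE !andbT => /andP[/andP[uv ux] vx].
  by apply: connect1; rewrite /e /= !inE uv (negbTE ux) (negbTE vx) !andbF.
have [->|zx] := eqVneq z x; last exact: toy.
have c1 : 1 < #|[set: T] :\ y| by move: T2; rewrite -cardsT (cardsD1 y) inE.
have [|w] := @conn_in_edge _ _ _ x (conV y) c1; first by rewrite !inE nxy.
rewrite !inE andbT => wy xw; have wx : w != x by apply: contraTneq xw => ->; rewrite girr.
apply: connect_trans (toy w wx) _; apply: connect1.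
by rewrite /e /= !inE gsym xw (negbTE wx) (negbTE wy).
Qed.

Lemma removableI x y : g x y -> conn_in g (~: [set x; y]) ->
  (exists rho, rotation_system g (~: [set x; y]) rho /\
     one_cycle (phi rho (darts g (~: [set x; y]))) (darts g (~: [set x; y]))) ->
  1 < #|~: [set x; y]| -> removable g x y.
Proof.
move=> xy cS [rho [rot oc]] S1.
have nxy : x != y by apply: contraTneq xy => ->; rewrite girr.
split=> //; first exact: no_bridge.
split=> //; exists rho; split=> //.
have /card_gt0P[v vS] : 0 < #|~: [set x; y]| by apply: ltn_trans S1.
have [w wS vw] := conn_in_edge cS S1 vS.
by apply: (nfaces_one_cycle gsym rot (d := (v, w))) => //; rewrite dartsE vw vS.
Qed.

Lemma card_K4 x a b c : nb g x [:: a; b; c] -> [/\ g a b, g a c & g b c] ->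
  #|T| = 4 /\ forall z, z \in [:: x; a; b; c].
Proof.
move=> nx [ab ac bc]; have [_ us h] := nx; have [_ [conT _]] := two.
have xa : g x a by rewrite h inE eqxx.
have xb : g x b by rewrite h !inE eqxx orbT.
have xc : g x c by rewrite h !inE eqxx !orbT.
have ne u v : g u v -> u != v by move=> uv; apply: contraTneq uv => ->; rewrite girr.
have nb' y p q r : p != q -> p != r -> q != r -> g y p -> g y q -> g y r ->
    forall z, g y z = (z \in [:: p; q; r]).
  move=> pq pr qr yp yq yr z; have us' : uniq [:: p; q; r].
    by rewrite /= !inE negb_or pq pr qr.
  by have [_ _ ->] := nb3 cub us' yp yq yr.
have nxa := ne _ _ xa; have nxb := ne _ _ xb; have nxc := ne _ _ xc.
have nab := ne _ _ ab; have nac := ne _ _ ac; have nbc := ne _ _ bc.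
have closed4 y z : y \in [:: x; a; b; c] -> g y z -> z \in [:: x; a; b; c].
  rewrite !inE => /or4P[]/eqP->.
  - by rewrite h !inE => ->; rewrite orbT.
  - by rewrite (nb' a x b c nxb nxc nbc _ ab ac) 1?gsym // !inE => /or3P[]->; rewrite ?orbT.
  - by rewrite (nb' b x a c nxa nxc nac _ _ bc) 1?gsym // !inE => /or3P[]->; rewrite ?orbT.
  - by rewrite (nb' c x a b nxa nxb nab) 1?gsym // !inE => /or3P[]->; rewrite ?orbT.
have all4 z : z \in [:: x; a; b; c].
  apply/negPn/negP => nz; pose A := [set y in [:: x; a; b; c]].
  have [||u [v []]] := connect_exit (conT x z (in_setT _) (in_setT _)) (P := A).
  - by rewrite !inE eqxx.
  - by rewrite in_set.
  by rewrite !in_set => uA /negP vA /= /andP[/andP[uv _] _]; apply: vA (closed4 _ _ uA uv).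
split=> //; have u4 : uniq [:: x; a; b; c].
  by rewrite /= !inE !negb_or nxa nxb nxc nab nac nbc.
by have /= <- := card_uniqP u4; apply: eq_card => z; rewrite all4.
Qed.

(** What remains is the single edge [bc]. It is a tree, so the construction applies with no centre
    at all. *)
Lemma removable_K4 x a b c : nb g x [:: a; b; c] -> [/\ g a b, g a c & g b c] ->
  removable g x a.
Proof.
move=> nx abc; have [T4 all4] := card_K4 nx abc.
have [ab ac bc] := abc; have [_ us h] := nx.
have xa : g x a by rewrite h inE eqxx.
have xb : g x b by rewrite h !inE eqxx orbT.
have nxa : x != a by apply: contraTneq xa => ->; rewrite girr.
have nxb : x != b by apply: contraTneq xb => ->; rewrite girr.
have nab : a != b by apply: contraTneq ab => ->; rewrite girr.
set S := ~: [set x; a].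
have S2 : #|S| = 2 by have := cardsC [set x; a]; rewrite cards2 nxa T4 -/S /=; move: #|S|; clear; lia.
have inS z : z \in S -> z = b \/ z = c.
  rewrite !inE negb_or => /andP[zx za]; have := all4 z; rewrite !inE (negbTE zx) (negbTE za) /=.
  by case/orP=> /eqP; [left|right].
have dS : #|darts g S| = 2 by have := card_darts_setC2 xa; rewrite T4 -/S; move: #|darts g S|; clear; lia.
have cS : conn_in g S.
  move=> u w uS wS; have [->|nuw] := eqVneq u w; first exact: connect0.
  apply: connect1; rewrite /= uS wS !andbT; move: nuw.
  by case: (inS u uS) => ->; case: (inS w wS) => ->; rewrite ?eqxx // gsym.
have bS : b \in S by rewrite !inE negb_or !(eq_sym b) nxb nab.
apply: removableI => //; rewrite -/S ?S2 //.
apply: (@one_face_exists _ _ gsym girr S _ set0 id b) => //.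
- exact: darts_sym.
- by move=> v; rewrite inE.
- move=> u w uS wS; have := cS u w uS wS; apply: connect_sub => p q /= /andP[/andP[pq pS] qS].
  by apply: connect1; rewrite /= dartsE !in_set0 pq pS qS.
by rewrite dS S2 cards0.
Qed.

End TwoConnected.

(** * Triangles and diamonds *)

Section ClawFree.
Variables (T : finType) (g : rel T).
Context {cfc : claw_free_cubic g}.

Let gsym : symmetric g := cfc_sym.
Let girr : irreflexive g := cfc_irr.
Let cub : cubic g := cfc_cubic.
Let clf : claw_free g := cfc_claw_free.
Let noK4 := @cfc_noK4 T g cfc.

Notation nb := (nb g).

(* The components of [te] are the vertex-triangles and the diamonds. *)
Definition te x y := g x y && [exists z, g x z && g y z].

Lemma te_sym : symmetric te.
Proof. by move=> x y; rewrite /te gsym; congr (_ && _); apply: eq_existsb => z; rewrite andbC. Qed.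

Lemma teI x y z : g x y -> g x z -> g y z -> te x y.
Proof. by move=> xy xz yz; rewrite /te xy; apply/existsP; exists z; rewrite xz. Qed.

Lemma te_nb x s y : nb x s -> te x y = (y \in s) && has (g y) s.
Proof.
move=> [_ _ h]; rewrite /te h; congr (_ && _); apply/existsP/hasP => [[z /andP[]]|[z zs yz]].
  by rewrite h; exists z.
by exists z; rewrite h zs.
Qed.

(* In a diamond, the two middle vertices. *)
Definition mid x := [forall y, g x y ==> te x y].

Lemma mid_nb x s : nb x s -> mid x = all (fun y => has (g y) s) s.
Proof.
move=> nx; have [_ _ h] := nx; apply/forallP/allP => [m y ys|m y].
  by have := m y; rewrite h ys /= (te_nb _ nx) ys.
by apply/implyP; rewrite h => ys; rewrite (te_nb _ nx) ys m.
Qed.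

(** Among the three neighbours some pair is adjacent, by claw-freeness, and some pair is not, by the
    exclusion of [K4]; hence one neighbour belongs to a pair of each kind. *)
Lemma nb_sorted x : exists a b c, [/\ nb x [:: a; b; c], g a b & ~~ g a c].
Proof.
have [a [b [c nx]]] := nb_exists cub x; have [_ /= us h] := nx.
move: us; rewrite !inE !negb_or => /and3P[/andP[nab nac] nbc _].
have [ab|ab] := boolP (g a b); have [ac|ac] := boolP (g a c).
- exists b, a, c; split; [|by rewrite gsym|by apply/negP => bc; case: (noK4 nx)].
  by apply: nb_perm nx; apply/seq.permP => P /=; lia.
- by exists a, b, c.
- by exists a, c, b; split=> //; apply: nb_perm nx; apply/seq.permP => P /=; lia.
have [bc|bc] := boolP (g b c).
  exists b, c, a; split=> //; last by rewrite gsym.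
  by apply: nb_perm nx; apply/seq.permP => P /=; lia.
exfalso; apply: clf; exists x, a, b, c; split; rewrite ?h ?inE ?eqxx ?orbT //.
by rewrite nab nac nbc ab ac bc.
Qed.

(* [out x] is meant for [x] not a middle vertex, [mate x] for [x] a middle vertex, and [opp x] for [x]
   an end of a diamond; in particular [opp] fixes the vertices of vertex-triangles. *)
Definition out x := odflt x [pick y | g x y && ~~ te x y].
Definition mate x := odflt x [pick y | g x y && mid y].
Definition opp x := odflt x [pick y | [&& y != x, ~~ mid y & [exists m, [&& mid m, g x m & g y m]]]].

Definition tv x := ~~ mid x && [forall y, g x y ==> ~~ mid y].
Definition de x := ~~ mid x && ~~ tv x.

Lemma nonmidP x : ~~ mid x ->
  exists a b, [/\ nb x [:: a; b; out x], g a b, ~~ g a (out x) & ~~ g b (out x)].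
Proof.
move=> mx; have [a [b [c [nx ab ac]]]] := nb_sorted x.
have bc : ~~ g b c.
  by apply: contra mx => bc; rewrite (mid_nb nx) /= ab bc (gsym b a) (gsym c b) ab bc !orbT.
have oc : out x = c.
  rewrite /out; case: pickP => [y|/(_ c)].
    have [_ _ h] := nx; rewrite h (te_nb _ nx) !inE /=.
    by move=> /andP[/or3P[]/eqP-> //]; rewrite !eqxx ?ab ?(gsym b) ?ab ?orbT.
  have [_ _ h] := nx; rewrite h (te_nb _ nx) !inE eqxx !orbT /=.
  by rewrite girr !(gsym c) (negbTE ac) (negbTE bc).
by exists a, b; rewrite oc.
Qed.

(** The third neighbour [e] of [a] is adjacent neither to [x] nor to [b], whose neighbourhoods are
    already full, so the edge [ae] lies in no triangle. *)
Lemma end_nonmid x a b c : nb x [:: a; b; c] -> g a b -> g b c -> ~~ g a c -> ~~ mid a.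
Proof.
move=> nx ab bc ac; have [_ us h] := nx.
have xa : g x a by rewrite h inE eqxx.
have xb : g x b by rewrite h !inE eqxx orbT.
have xc : g x c by rewrite h !inE eqxx !orbT.
move: us; rewrite /= !inE !negb_or => /and3P[/andP[nab nac] nbc _].
have nxb : x != b by apply: contraTneq xb => ->; rewrite girr.
have nxc : x != c by apply: contraTneq xc => ->; rewrite girr.
have nxa : x != a by apply: contraTneq xa => ->; rewrite girr.
have nb_b : nb b [:: a; x; c].
  by apply: (nb3 cub) => //=; rewrite 1?gsym // !inE !negb_or nac eq_sym nxa nxc.
have [e na] := nb2 cub (etrans (gsym _ _) xa) ab nxb.
have [_ /= + ha] := na; rewrite !inE negb_or => /and3P[/andP[_ nxe] nbe _].
have ae : g a e by rewrite ha !inE eqxx !orbT.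
have nae : a != e by apply: contraTneq ae => ->; rewrite girr.
have nce : c != e by apply: contraNneq ac => ->.
have [_ _ hb] := nb_b.
rewrite (mid_nb na) /= (gsym e x) (gsym e b) (h e) (hb e) !inE !(eq_sym e) girr.
by rewrite (negbTE nae) (negbTE nbe) (negbTE nce) (negbTE nxe) !girr /= !andbF.
Qed.

Lemma midP x : mid x -> exists u v, [/\ nb x [:: u; mate x; v], nb (mate x) [:: u; x; v],
  ~~ g u v, mid (mate x) & ~~ mid u /\ ~~ mid v].
Proof.
move=> mx; have [a [b [c [nx ab ac]]]] := nb_sorted x.
have bc : g b c.
  by move: mx; rewrite (mid_nb nx) /= !girr (gsym c a) (gsym c b) (negbTE ac) /= !orbF andbT => /and3P[].
have [_ us h] := nx.
have xb : g x b by rewrite h !inE eqxx orbT.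
move: us; rewrite /= !inE !negb_or => /and3P[/andP[nab nac] nbc _].
have ma : ~~ mid a := end_nonmid nx ab bc ac.
have mc : ~~ mid c.
  apply: (@end_nonmid x c b a); rewrite 1?gsym //.
  by apply: nb_perm nx; apply/seq.permP => P /=; lia.
have xa : g x a by rewrite h inE eqxx.
have xc : g x c by rewrite h !inE eqxx !orbT.
have nxa : x != a by apply: contraTneq xa => ->; rewrite girr.
have nxc : x != c by apply: contraTneq xc => ->; rewrite girr.
have nb_b : nb b [:: a; x; c].
  by apply: (nb3 cub) => //=; rewrite 1?gsym // !inE !negb_or nac eq_sym nxa nxc.
have mb : mid b.
  by rewrite (mid_nb nb_b) /= !girr !(gsym _ x) !h !inE !eqxx !orbT.
have -> : mate x = b.
  rewrite /mate; case: pickP => [y|/(_ b)]; last by rewrite xb mb.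
  by rewrite h !inE => /andP[/or3P[]/eqP-> //]; rewrite ?(negbTE ma) ?(negbTE mc).
by exists a, c.
Qed.

Lemma te_nonmid x y : ~~ mid x -> g x y -> ~~ te x y -> y = out x.
Proof.
move=> mx; have [a [b [nx ab _ _]]] := nonmidP mx; have [_ _ h] := nx.
rewrite h (te_nb _ nx) !inE /= => /or3P[]/eqP-> //; rewrite !eqxx ?ab ?(gsym b) ?ab ?orbT //.
Qed.

Lemma g_out x : ~~ mid x -> g x (out x).
Proof. by move=> /nonmidP[a [b [[_ _ ->] _ _ _]]]; rewrite !inE eqxx !orbT. Qed.

Lemma te_out x : ~~ mid x -> ~~ te x (out x).
Proof.
move=> /nonmidP[a [b [nx _ oa ob]]]; rewrite (te_nb _ nx) /= girr !(gsym (out x)).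
by rewrite (negbTE oa) (negbTE ob) andbF.
Qed.

Lemma mid_te x y : mid x -> g x y -> te x y.
Proof. by move=> /forallP/(_ y)/implyP. Qed.

Lemma nonmid_out x : ~~ mid x -> ~~ mid (out x).
Proof.
move=> mx; apply: contra (te_out mx) => mo; rewrite te_sym; apply: mid_te => //.
by rewrite gsym g_out.
Qed.

Lemma outK x : ~~ mid x -> out (out x) = x.
Proof.
move=> mx; apply/esym/te_nonmid; rewrite ?nonmid_out // 1?gsym ?g_out //.
by rewrite te_sym te_out.
Qed.

Lemma te_g x y : te x y -> g x y. Proof. by case/andP. Qed.

Lemma g_cases x y : g x y -> te x y \/ ~~ mid x /\ y = out x.
Proof.
move=> xy; have [|nt] := boolP (te x y); [by left|right].
have mx : ~~ mid x by apply: contra nt => mx; apply: mid_te.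
by split=> //; apply: te_nonmid.
Qed.

(* [u] and [v] are the ends of the diamond. *)
Definition dia u v x m := [/\ nb x [:: u; m; v], nb m [:: u; x; v],
  nb u [:: x; m; out u], nb v [:: x; m; out v] & [/\ de u, de v, mid x & mid m]].

Definition tri x a b := [/\ nb x [:: a; b; out x], nb a [:: x; b; out a],
  nb b [:: x; a; out b] & [/\ tv x, tv a & tv b]].

Lemma dia_swap u v x m : dia u v x m -> dia v u x m.
Proof.
by case=> nx nm nu nv [du dv mx mm]; split=> //; [apply: nb_perm nx|apply: nb_perm nm];
  apply/seq.permP => P /=; lia.
Qed.

Lemma dia_mate u v x m : dia u v x m -> dia u v m x.
Proof.
by case=> nx nm nu nv [du dv mx mm]; split=> //; [apply: nb_perm nu|apply: nb_perm nv];
  apply/seq.permP => P /=; lia.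
Qed.

Lemma nonmid_nb x a b : ~~ mid x -> te x a -> te x b -> a != b -> nb x [:: a; b; out x].
Proof.
move=> mx ta tb nab; apply: (nb3 cub); [|exact: te_g|exact: te_g|exact: g_out].
rewrite /= !inE negb_or nab andbT /=.
by apply/andP; split; [apply: contraTneq ta|apply: contraTneq tb] => ->; apply: te_out.
Qed.

Lemma mid_dia x : mid x -> exists u v, dia u v x (mate x).
Proof.
move=> mx; have [u [v [nx nm uv mm [mu mv]]]] := midP mx.
have [_ /= us h] := nx; have [_ _ hm] := nm.
have xu : g x u by rewrite h inE eqxx.
have xv : g x v by rewrite h !inE eqxx !orbT.
have xm : g x (mate x) by rewrite h !inE eqxx !orbT.
have um : g (mate x) u by rewrite hm inE eqxx.
have vm : g (mate x) v by rewrite hm !inE eqxx !orbT.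
have nxm : x != mate x by apply: contraTneq xm => <-; rewrite girr.
have deI w : ~~ mid w -> g x w -> de w.
  move=> mw xw; rewrite /de mw /tv mw /= negb_forall; apply/existsP; exists x.
  by rewrite gsym xw mx.
exists u, v; split=> //; last by split=> //; apply: deI.
  by apply: nonmid_nb; rewrite // te_sym mid_te.
by apply: nonmid_nb; rewrite // te_sym mid_te.
Qed.

Lemma de_dia u : de u -> exists v x, dia u v x (mate x).
Proof.
rewrite /de /tv; case mu : (mid u) => //=; rewrite negb_forall => /existsP[x].
rewrite negb_imply negbK => /andP[ux mx].
have [a [b D]] := mid_dia mx; have [[_ _ h] _ _ _ [_ _ _ mm]] := D.
move: ux; rewrite gsym h !inE => /or3P[]/eqP E; rewrite E in mu *.
- by exists b, x.
- by rewrite mm in mu.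
by exists a, x; apply: dia_swap.
Qed.

Lemma tv_tri x : tv x -> exists a b, tri x a b.
Proof.
move=> tx; have [mx /forallP nm] := andP tx.
have [a [b [nx ab _ _]]] := nonmidP mx; have [_ /= us h] := nx.
have xa : g x a by rewrite h inE eqxx.
have xb : g x b by rewrite h !inE eqxx orbT.
have ma : ~~ mid a by have := nm a; rewrite xa.
have mb : ~~ mid b by have := nm b; rewrite xb.
have nxa : x != a by apply: contraTneq xa => <-; rewrite girr.
have nxb : x != b by apply: contraTneq xb => <-; rewrite girr.
have nab : a != b by apply: contraTneq ab => <-; rewrite girr.
have na : nb a [:: x; b; out a].
  apply: nonmid_nb => //; first by rewrite te_sym; apply: (teI xa xb).
  by apply: (@teI _ _ x) => //; rewrite gsym.
have nb_b : nb b [:: x; a; out b].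
  apply: nonmid_nb => //; first by rewrite te_sym; apply: (teI xb xa); rewrite gsym.
  by apply: (@teI _ _ x); rewrite 1?gsym.
exists a, b; split=> //; split=> //; rewrite /tv ?ma ?mb /=; apply/forallP => y; apply/implyP.
  have [_ _ ->] := na; rewrite !inE => /or3P[]/eqP-> //; exact: nonmid_out.
have [_ _ ->] := nb_b; rewrite !inE => /or3P[]/eqP-> //; exact: nonmid_out.
Qed.

Lemma opp_dia u v x m : dia u v x m -> opp u = v.
Proof.
case=> nx nm nu nv [/andP[mu _] /andP[mv _] mx mm].
have [_ _ hu] := nu; have [_ us hx] := nx; have [_ _ hm] := nm; have [_ _ hv] := nv.
rewrite /opp; case: pickP => [y /and3P[yu my /existsP[w /and3P[mw uw yw]]]|/(_ v)] /=.
  move: uw; rewrite hu !inE => /or3P[]/eqP E; last by move: mw; rewrite E (negbTE (nonmid_out mu)).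
    move: yw; rewrite gsym E hx !inE (negbTE yu) /= => /orP[]/eqP // Ey.
    by rewrite Ey mm in my.
  move: yw; rewrite gsym E hm !inE (negbTE yu) /= => /orP[]/eqP // Ey.
  by rewrite Ey mx in my.
move: us; rewrite /= !inE !negb_or => /and3P[/andP[_ uv] _ _].
rewrite eq_sym uv mv /= => /existsP[]; exists x.
by rewrite mx hu hv !inE eqxx.
Qed.

Lemma opp_tv x : tv x -> opp x = x.
Proof.
move=> /andP[mx /forallP nm]; rewrite /opp; case: pickP => //= y /and3P[_ _ /existsP[w]].
by move=> /and3P[mw xw _]; have := nm w; rewrite xw mw.
Qed.

Lemma tv_or_de x : ~~ mid x -> tv x \/ de x.
Proof. by move=> mx; rewrite /de mx /=; case: (tv x); [left|right]. Qed.

(** A block is named by the root of its component, so that blocks are indexed by elements of [T]. *)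
Definition blk : T -> T := root te.

Lemma blkP x y : reflect (blk x = blk y) (connect te x y).
Proof. exact/rootP/sym_connect_sym/te_sym. Qed.

Lemma te_blk x y : te x y -> blk x = blk y.
Proof. by move=> xy; apply/blkP/connect1. Qed.

Lemma blk_eq x (s : seq T) : x \in s -> (forall y z, y \in s -> te y z -> z \in s) ->
  (forall y, y \in s -> connect te x y) -> forall y, (blk y == blk x) = (y \in s).
Proof.
move=> xs cl cs y; rewrite eq_sym; apply/eqP/idP => [/blkP xy|/cs/blkP //].
case/connectP: xy => w; elim: w x xs {cs} => [|z w IH] x xs /=; first by move=> _ ->.
by move=> /andP[xz zw]; apply: IH zw; apply: cl xz.
Qed.

Lemma nb_te x a b y : ~~ mid x -> nb x [:: a; b; out x] -> te x y -> (y == a) || (y == b).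
Proof.
move=> mx [_ _ h] xy; have := te_g xy; rewrite h !inE => /or3P[]/eqP E; rewrite ?E ?eqxx ?orbT //.
by move: xy; rewrite E (negbTE (te_out mx)).
Qed.

Lemma tri_te x a b : tri x a b -> [/\ te x a, te x b & te a b].
Proof.
case=> [[_ _ hx] [_ _ ha] [_ _ hb] _].
have xa : g x a by rewrite hx !inE eqxx.
have xb : g x b by rewrite hx !inE eqxx orbT.
have ab : g a b by rewrite ha !inE eqxx orbT.
by split; [apply: (teI xa xb)|apply: (teI xb xa); rewrite gsym|apply: (teI ab (z := x)); rewrite gsym].
Qed.

Lemma dia_te u v x m : dia u v x m ->
  [/\ te u x, te u m, te v x & te v m] /\ [/\ te x m, g u v = false & u != v].
Proof.
move=> [[_ us hx] [_ _ hm] nu nv [du dv mx mm]].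
have [mu _] := andP du; have [mv _] := andP dv.
have tx y : y \in [:: u; m; v] -> te x y by rewrite -hx; apply: mid_te.
have tm y : y \in [:: u; x; v] -> te m y by rewrite -hm; apply: mid_te.
split; first by split; rewrite te_sym ?tx ?tm // !inE eqxx ?orbT.
split; first by rewrite tx // !inE eqxx ?orbT.
  apply/negbTE/negP => uv; have [_ _ hu] := nu; have [_ _ hv] := nv.
  have ouv : out u = v.
    move: uv; rewrite hu !inE => /or3P[]/eqP E //; first by rewrite E mx in mv.
    by rewrite E mm in mv.
  apply: (negP (te_out mu)); rewrite ouv; apply: (teI uv (z := x)).
    by rewrite hu inE eqxx.
  by rewrite hv inE eqxx.
by move: us; rewrite /= !inE negb_or => /andP[/andP[]].
Qed.

Lemma blk_tri x a b : tri x a b -> forall y, (blk y == blk x) = (y \in [:: x; a; b]).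
Proof.
move=> t; have [xa xb ab] := tri_te t; case: t => nx na nb_b [/andP[mx _] /andP[ma _] /andP[mb _]].
apply: blk_eq; first by rewrite inE eqxx.
  move=> y z; rewrite !inE => /or3P[]/eqP->.
  - by move/(nb_te mx nx) => /orP[]->; rewrite ?orbT.
  - by move/(nb_te ma na) => /orP[]->; rewrite ?orbT.
  - by move/(nb_te mb nb_b) => /orP[]->; rewrite ?orbT.
by move=> y; rewrite !inE => /or3P[]/eqP->; rewrite ?connect0 ?connect1.
Qed.

Lemma blk_dia u v x m : dia u v x m ->
  forall y, (blk y == blk u) = (y \in [:: u; v; x; m]).
Proof.
move=> D; have [[ux um vx vm] _] := dia_te D.
case: D => [[_ us hx] [_ _ hm] nu nv [/andP[mu _] /andP[mv _] mx mm]].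
apply: blk_eq; first by rewrite inE eqxx.
  move=> y z; rewrite !inE => /or4P[]/eqP->.
  - by move/(nb_te mu nu) => /orP[]->; rewrite ?orbT.
  - by move/(nb_te mv nv) => /orP[]->; rewrite ?orbT.
  - by move/te_g; rewrite hx !inE => /or3P[]->; rewrite ?orbT.
  - by move/te_g; rewrite hm !inE => /or3P[]->; rewrite ?orbT.
have uv : connect te u v by apply: (connect_trans (connect1 ux)); apply: connect1; rewrite te_sym.
by move=> y; rewrite !inE => /or4P[]/eqP->; rewrite ?uv ?connect0 // connect1.
Qed.

Lemma dia_uniq u v x m : dia u v x m -> uniq [:: u; v; x; m].
Proof.
move=> D; have [[ux um vx vm] [xm _ uv]] := dia_te D.
have ne a b : te a b -> a != b.
  by move=> /te_g ab; apply: contraTneq ab => ->; rewrite girr.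
by rewrite /= !inE !negb_or uv !ne.
Qed.

Lemma tri_uniq x a b : tri x a b -> uniq [:: x; a; b].
Proof.
move=> /tri_te[xa xb ab].
have ne y z : te y z -> y != z.
  by move=> /te_g yz; apply: contraTneq yz => ->; rewrite girr.
by rewrite /= !inE !negb_or !ne.
Qed.

Lemma blk_cases x :
  (exists a b, tri x a b) \/ (exists u v y m, dia u v y m /\ x \in [:: u; v; y; m]).
Proof.
have [mx|mx] := boolP (mid x).
  right; have [u [v D]] := mid_dia mx; exists u, v, x, (mate x); split=> //.
  by rewrite !inE eqxx !orbT.
case: (tv_or_de mx) => [/tv_tri[a [b t]]|/de_dia[v [y D]]]; first by left; exists a, b.
by right; exists x, v, y, (mate y); rewrite inE eqxx.
Qed.

Lemma blk_out x : ~~ mid x -> blk (out x) != blk x.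
Proof.
move=> mx; case: (tv_or_de mx) => [/tv_tri[a [b t]]|/de_dia[v [y D]]].
  rewrite (blk_tri t) !inE; case: t => [[_ us _] _ _ _].
  move: us; rewrite /= !inE !negb_or => /and3P[/andP[_ a1] a2 _].
  rewrite !(eq_sym (out x)) (negbTE a1) (negbTE a2) andbT.
  by apply: contraTneq (g_out mx) => <-; rewrite girr.
have [_ [_ uv _]] := dia_te D.
rewrite (blk_dia D) !inE; case: D => _ _ [_ us hu] _ _.
move: us; rewrite /= !inE !negb_or => /and3P[/andP[_ a1] a2 _].
rewrite !(eq_sym (out x)) (negbTE a1) (negbTE a2) !andbT; apply/andP; split.
  by apply: contraTneq (g_out mx) => <-; rewrite girr.
by apply: contraTneq (g_out mx) => <-; rewrite uv.
Qed.

Lemma crossE x y : g x y && (blk x != blk y) = ~~ mid x && (y == out x).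
Proof.
apply/idP/idP => [/andP[xy]|/andP[mx /eqP->]]; last by rewrite g_out //= eq_sym blk_out.
by case: (g_cases xy) => [/te_blk ->|[-> ->]]; rewrite eqxx.
Qed.

(** * Counting by triangles and diamonds *)

Definition blocks := blk @: [set: T].
Definition triblk i := [exists x, (blk x == i) && tv x].
Definition ntri := #|[set i in blocks | triblk i]|.
Definition ndia := #|[set i in blocks | ~~ triblk i]|.

Lemma triblkT x a b : tri x a b -> triblk (blk x).
Proof. by case=> _ _ _ [tx _ _]; apply/existsP; exists x; rewrite eqxx. Qed.

Lemma triblkF u v x m : dia u v x m -> triblk (blk u) = false.
Proof.
move=> D; apply/negbTE/negP => /existsP[y]; rewrite (blk_dia D) !inE.
case: D => _ _ _ _ [/andP[mu du] /andP[mv dv] mx mm].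
by case/andP=> /or4P[]/eqP->; rewrite ?(negbTE du) ?(negbTE dv) // /tv ?mx ?mm.
Qed.

Lemma blockP i : i \in blocks ->
  (triblk i /\ exists x a b, tri x a b /\ i = blk x) \/
  (~~ triblk i /\ exists u v x m, dia u v x m /\ i = blk u).
Proof.
move=> /imsetP[x _ ->]; case: (blk_cases x) => [[a [b t]]|[u [v [y [m [D xs]]]]]].
  by left; split; [apply: triblkT t|exists x, a, b].
have e : blk x = blk u by apply/eqP; rewrite (blk_dia D).
by right; rewrite e (triblkF D); split=> //; exists u, v, y, m.
Qed.

(** Grouping the vertices by blocks turns any statistic with a constant total on triangles and a
    constant total on diamonds into a linear form in [ntri] and [ndia]. *)
Lemma sum_blk (F : T -> nat) ct cd :
  (forall x a b, tri x a b -> F x + F a + F b = ct) ->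
  (forall u v x m, dia u v x m -> F u + F v + F x + F m = cd) ->
  \sum_x F x = ct * ntri + cd * ndia.
Proof.
move=> ht hd; rewrite (partition_big blk (mem blocks)) /=; last by move=> x _; apply: imset_f.
rewrite (bigID triblk) /=; congr (_ + _).
  rewrite (eq_bigr (fun=> ct)) ?sum_nat_const; last first.
    move=> i /andP[/blockP[[_ [x [a [b [t ->]]]]]|[/negbTE-> //]]].
    rewrite (eq_bigl _ _ (blk_tri t)) -big_uniq ?tri_uniq //=.
    by rewrite !big_cons big_nil -(ht _ _ _ t) addn0 addnA.
  by rewrite mulnC; congr (_ * _); apply: eq_card => i; rewrite !inE.
rewrite (eq_bigr (fun=> cd)) ?sum_nat_const; last first.
  move=> i /andP[/blockP[[->]//|[_ [u [v [x [m [D ->]]]]]]]] _.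
  rewrite (eq_bigl _ _ (blk_dia D)) -big_uniq ?dia_uniq //=.
  by rewrite !big_cons big_nil -(hd _ _ _ _ D) addn0 !addnA.
by rewrite mulnC; congr (_ * _); apply: eq_card => i; rewrite !inE.
Qed.

Lemma card_blk (P : pred T) ct cd :
  (forall x a b, tri x a b -> P x + P a + P b = ct) ->
  (forall u v x m, dia u v x m -> P u + P v + P x + P m = cd) ->
  #|P| = ct * ntri + cd * ndia.
Proof.
move=> ht hd; rewrite -sum1_card big_mkcond -(sum_blk (F := fun x => P x) ht hd).
by apply: eq_bigr => x _; rewrite unfold_in; case: (P x).
Qed.

Lemma card_vertices : #|T| = 3 * ntri + 4 * ndia.
Proof. exact: card_blk. Qed.

Lemma card_nonmid : #|[pred x | ~~ mid x]| = 3 * ntri + 2 * ndia.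
Proof.
apply: card_blk => [x a b [_ _ _ [/andP[mx _] /andP[ma _] /andP[mb _]]]|] /=.
  by rewrite mx ma mb.
by move=> u v x m [_ _ _ _ [/andP[mu _] /andP[mv _] mx mm]] /=; rewrite mu mv mx mm.
Qed.

Lemma card_tv : #|[pred x | tv x]| = 3 * ntri.
Proof.
rewrite -[RHS]addn0 -(mul0n ndia).
apply: card_blk => [x a b [_ _ _ [tx ta tb]]|u v x m] /=; first by rewrite tx ta tb.
by move=> [_ _ _ _ [/andP[_ /negbTE->] /andP[_ /negbTE->] mx mm]]; rewrite /tv mx mm.
Qed.

(** The share of block [i] in the bound of [faces_lower_bound] for the subgraph induced by [S]. A
    whole triangle has weight 2 since [3 + 3] is even, a whole diamond weight 1 since [4 + 5] is
    odd. *)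
Definition weight (S : {set T}) i :=
  1 + ~~ odd (#|[set v in S | blk v == i]| + #|in_block g S blk i|./2).

Lemma weightE (S : {set T}) i (s : seq T) : uniq s -> (forall v, (v \in s) = (v \in S) && (blk v == i)) ->
  weight S i = 1 + ~~ odd (size s + (\sum_(x <- s) \sum_(y <- s) g x y)./2).
Proof.
move=> us hs; rewrite /weight; congr (1 + ~~ odd (_ + _./2)).
  by rewrite -(card_uniqP us); apply: eq_card => v; rewrite in_set hs.
rewrite card_pairs (big_uniq _ us) /= [RHS]big_mkcond; apply: eq_bigr => x _.
case: ifP => xs; last first.
  apply: big1 => y _; rewrite in_sep dartsE /=; move: xs; rewrite hs.
  by case: (x \in S) => /= [->|]; rewrite ?andbF.
rewrite (big_uniq _ us) /= [RHS]big_mkcond; apply: eq_bigr => y _.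
have [xS xi] := andP (etrans (esym (hs x)) xs).
by rewrite in_sep dartsE /= xS xi hs; case: (g x y); case: (y \in S); case: (_ == i).
Qed.

Lemma weight_ext (S S' : {set T}) i :
  (forall v, blk v = i -> (v \in S) = (v \in S')) -> weight S i = weight S' i.
Proof.
move=> e; rewrite /weight; congr (1 + ~~ odd (_ + _./2)).
  by apply: eq_card => v; rewrite !in_set; case: eqP => [/e ->|]; rewrite ?andbF.
apply: eq_card => -[x y]; rewrite !in_sep !dartsE /=.
by case: eqP => [/e ->|]; rewrite ?andbF //; case: eqP => [/e ->|]; rewrite ?andbF.
Qed.

Lemma weight_setT i : i \in blocks -> weight setT i = if triblk i then 2 else 1.
Proof.
move=> /blockP[[-> [x [a [b [t ->]]]]]|[/negbTE -> [u [v [x [m [D ->]]]]]]].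
  rewrite (@weightE _ _ [:: x; a; b]) ?tri_uniq //; last first.
    by move=> v; rewrite in_setT (blk_tri t).
  have [/te_g xa /te_g xb /te_g ab] := tri_te t.
  by rewrite !(big_cons, big_nil) !girr (gsym a x) (gsym b x) (gsym b a) xa xb ab.
rewrite (@weightE _ _ [:: u; v; x; m]) ?dia_uniq //; last first.
  by move=> w; rewrite in_setT (blk_dia D).
have [[/te_g ux /te_g um /te_g vx /te_g vm] [/te_g xm uv _]] := dia_te D.
rewrite !(big_cons, big_nil) !girr (gsym v u) !(gsym x) !(gsym m).
by rewrite ux um vx vm xm uv.
Qed.

Lemma faces_bound (S : {set T}) rho : rotation_system g S rho -> conn_in g S -> 1 < #|S| ->
  \sum_(i in blk @: S) weight S i <= nfaces g S rho + #|cross g S blk|./2.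
Proof.
move=> rot cS S1; apply: faces_lower_bound => // [v vS|]; first exact: conn_in_edge.
have /card_gt0P[v vS] : 0 < #|S| by apply: ltn_trans S1.
have [w wS vw] := conn_in_edge cS S1 vS.
by apply/card_gt0P; exists (v, w); rewrite dartsE vw vS.
Qed.

Lemma card_cross (S : {set T}) :
  #|cross g S blk| = #|[pred x | [&& ~~ mid x, x \in S & out x \in S]]|.
Proof.
rewrite -(card_in_imset (f := fst)); last first.
  move=> [x y] [x' y']; rewrite !in_sep !dartsE /=.
  move=> /andP[/and3P[xy _ _] n] /andP[/and3P[xy' _ _] n'] xx.
  have := crossE x y; have := crossE x' y'; rewrite xy n xy' n' /=.
  by move=> /esym/andP[_ /eqP->] /esym/andP[_ /eqP->]; rewrite xx.
apply: eq_card => x; rewrite inE; apply/imsetP/idP => [[[a b]]|/and3P[mx xS oS]].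
  rewrite in_sep dartsE /= => /andP[/and3P[ab aS bS] n] ->.
  by have := crossE a b; rewrite ab n => /esym/andP[-> /eqP <-]; rewrite aS.
by exists (x, out x); rewrite // in_sep dartsE g_out // xS oS eq_sym /= blk_out.
Qed.

Lemma card_cross_setT : #|cross g setT blk| = 3 * ntri + 2 * ndia.
Proof. by rewrite card_cross -card_nonmid; apply: eq_card => x; rewrite !inE !andbT. Qed.

(** Each vertex [z] that is not a middle vertex owns exactly one cross dart, the one to [out z], so
    the lost cross darts can be listed by their tails. *)
Lemma card_crossD (S : {set T}) s : uniq s -> {in s, forall z, ~~ mid z} ->
  (forall z, ~~ mid z -> (z \in s) = (z \notin S) || (out z \notin S)) ->
  #|cross g S blk| + size s = 3 * ntri + 2 * ndia.
Proof.
move=> us ms hs; rewrite -card_nonmid card_cross -(card_uniqP us).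
rewrite -(cardID (mem s) [pred x | ~~ mid x]) addnC; congr (_ + _); apply: eq_card => x.
  by rewrite !inE; case: (boolP (x \in s)) => [/ms ->|//]; rewrite ?andbF.
rewrite !inE; case: (boolP (mid x)) => mx /=; rewrite ?andbF //.
by rewrite hs // -negb_and negbK andbT.
Qed.

Lemma sum_weight_setT : \sum_(i in blocks) weight setT i = 2 * ntri + ndia.
Proof.
rewrite (eq_bigr (fun i => if triblk i then 2 else 1)); last by move=> i; apply: weight_setT.
rewrite (bigID triblk) /=; congr (_ + _).
  rewrite (eq_bigr (fun=> 2)) => [|i /andP[_ ->//]].
  by rewrite sum_nat_const mulnC; congr (_ * _); apply: eq_card => i; rewrite !inE.
rewrite (eq_bigr (fun=> 1)) => [|i /andP[_ /negbTE->//]].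
by rewrite sum_nat_const muln1; apply: eq_card => i; rewrite !inE.
Qed.

(** With [t] triangles and [d] diamonds the bound is [2t + d <= 2 + (3t + 2d)/2]. *)
Lemma ntri_le4 rho : connected_graph g -> 1 < #|T| -> rotation_system g setT rho ->
  nfaces g setT rho <= 2 -> ntri <= 4.
Proof.
move=> cT T1 rot nf; have := faces_bound rot cT; rewrite cardsT => /(_ T1).
rewrite -/blocks sum_weight_setT card_cross_setT => le.
have := leq_trans le (leq_add nf (leqnn _)); clear.
by move: ntri ndia; lia.
Qed.

(** Only the block [i0] changes its weight. The old weight stands on the left in place of a
    subtraction on the right. *)
Lemma sum_weightD1 (S : {set T}) i0 : i0 \in blocks -> (forall v, blk v != i0 -> v \in S) ->
  \sum_(i in blocks) weight S i + weight setT i0 = 2 * ntri + ndia + weight S i0.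
Proof.
move=> bi hS; rewrite -sum_weight_setT (bigD1 i0) //= [in RHS](bigD1 i0) //=.
have -> : \sum_(i in blocks | i != i0) weight S i = \sum_(i in blocks | i != i0) weight setT i.
  apply: eq_bigr => i /andP[_ ni]; apply: weight_ext => v vi.
  by rewrite inE hS // vi.
by rewrite addnC addnA addnAC.
Qed.

Lemma sum_weightD2 (S : {set T}) i0 i1 : i0 \in blocks -> i1 \in blocks -> i0 != i1 ->
  (forall v, blk v != i0 -> blk v != i1 -> v \in S) ->
  \sum_(i in blocks) weight S i + weight setT i0 + weight setT i1 =
  2 * ntri + ndia + weight S i0 + weight S i1.
Proof.
move=> b0 b1 n01 hS; have b1' : (i1 \in blocks) && (i1 != i0) by rewrite b1 eq_sym.
rewrite -sum_weight_setT (bigD1 i0) //= (bigD1 i1) //=.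
rewrite [in RHS](bigD1 i0) //= [in RHS](bigD1 i1) //=.
have -> : \sum_(i | (i \in blocks) && (i != i0) && (i != i1)) weight S i =
          \sum_(i | (i \in blocks) && (i != i0) && (i != i1)) weight setT i.
  apply: eq_bigr => i /andP[/andP[_ n0] n1]; apply: weight_ext => v vi.
  by rewrite inE hS // vi.
by move: (\sum_(i | _) _) (weight S _) (weight S _) (weight setT _) => A ? ? ?; clear; lia.
Qed.

(** Every block has at least three vertices, so none disappears with two of them. *)
Lemma blocks_setC2 x y : blocks \subset blk @: ~: [set x; y].
Proof.
have big (s : seq T) i : uniq s -> 2 < size s -> (forall z, z \in s -> blk z = i) ->
    i \in blk @: ~: [set x; y].
  move=> us s2 hs; have /hasP[z zs] : has (fun z => z \notin [:: x; y]) s.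
    apply/negPn; rewrite -all_predC; apply/negP => /allP sub.
    suff : size s <= 2 by rewrite leqNgt s2.
    by apply: (@uniq_leq_size _ s [:: x; y]) => // z /sub /=; rewrite negbK.
  rewrite !inE negb_or => zxy; rewrite -(hs z zs); apply: imset_f.
  by rewrite !inE negb_or.
apply/subsetP => i /blockP[[_ [a [b [c [t ->]]]]]|[_ [u [v [w [m [D ->]]]]]]].
  by apply: (big [:: a; b; c]); rewrite ?(tri_uniq t) // => z; rewrite -(blk_tri t) => /eqP.
by apply: (big [:: u; v; w; m]); rewrite ?(dia_uniq D) // => z; rewrite -(blk_dia D) => /eqP.
Qed.

Lemma te_cases x y : te x y -> [\/ exists b, tri x y b, exists u v, dia u v x y,
  exists v m, dia y v x m | exists v m, dia x v y m].
Proof.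
move=> xy; have e : blk y == blk x by rewrite (te_blk xy).
have nxy : y != x by apply: contraTneq (te_g xy) => ->; rewrite girr.
case: (blk_cases x) => [[a [b t]]|[u [v [w [m [D xs]]]]]].
  constructor 1; move: e; rewrite (blk_tri t) !inE (negbTE nxy) /= => /orP[]/eqP E.
    by exists b; rewrite E.
  exists a; rewrite E; case: t => nx na nb_b [tx ta tb]; split=> //.
  by apply: nb_perm nx; apply/seq.permP => P /=; lia.
have [mx|mx] := boolP (mid x).
  have [u' [v' D']] := mid_dia mx; have [nx _ _ _ _] := D'.
  have := te_g xy; have [_ _ ->] := nx; rewrite !inE => /or3P[]/eqP E.
  - by constructor 3; exists v', (mate x); rewrite E.
  - by constructor 2; exists u', v'; rewrite E.
  by constructor 3; exists u', (mate x); rewrite E; apply: dia_swap.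
constructor 4.
have [z [p D']] : exists z p, dia x z p (mate p).
  case: D xs => nw nm nu nv [du dv mw mm]; rewrite !inE => /or4P[]/eqP E.
  - by rewrite E; apply: de_dia.
  - by rewrite E; apply: de_dia.
  - by rewrite E mw in mx.
  by rewrite E mm in mx.
have [_ _ nx _ _] := D'; have /orP[/eqP->|/eqP->] : (y == p) || (y == mate p) by apply: nb_te mx nx xy.
  by exists z, (mate p).
by exists z, p; apply: dia_mate.
Qed.

Lemma tri_swap x a b : tri x a b -> tri a x b.
Proof.
case=> nx na nb_b [tx ta tb]; split=> //.
exact: nb_perm (perm_213 _ _ _) nb_b.
Qed.

Lemma tri_132 x a b : tri x a b -> tri x b a.
Proof. by case=> nx na nb_b [tx ta tb]; split=> //; apply: nb_perm (perm_213 _ _ _) nx. Qed.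

(** * No removable pair when four triangles are separated by diamonds *)

Section NoRemovable.

Hypothesis ntri4 : ntri = 4.
Hypothesis tv_out : forall z, tv z -> de (out z).

Section Pair.
Variables (x y : T) (rho : {perm T * T}).
Let S := ~: [set x; y].
Hypotheses (rot : rotation_system g S rho) (cS : conn_in g S) (nf : nfaces g S rho <= 2).

Let inS v : (v \in S) = (v != x) && (v != y).
Proof. by rewrite !inE negb_or. Qed.

Lemma weights_le : \sum_(i in blocks) weight S i <= 2 + #|cross g S blk|./2.
Proof.
have S1 : 1 < #|S|.
  have := cardsC [set x; y]; rewrite -/S cards2 card_vertices ntri4.
  by case: (_ != _) => /=; move: ndia #|S|; clear; lia.
have := faces_bound rot cS S1; have -> : blk @: S = blocks.
  by apply/eqP; rewrite eqEsubset blocks_setC2 imsetS ?subsetT.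
by move=> le; apply: leq_trans le _; rewrite leq_add2r.
Qed.

(** For four triangles the bound on the whole graph is the equality [8 + d = 2 + (12 + 2d)/2]. Every
    lost cross edge lowers the right side by one; [s] contains both its ends, hence the halving. The
    block would have to lose at least as much weight, which the last hypothesis excludes. *)
Lemma removed_block i0 l s : i0 \in blocks -> (forall v, blk v != i0 -> v \in S) ->
  uniq l -> (forall v, (v \in l) = (v \in S) && (blk v == i0)) ->
  uniq s -> {in s, forall z, ~~ mid z} ->
  (forall z, ~~ mid z -> (z \in s) = (z \notin S) || (out z \notin S)) -> ~~ odd (size s) ->
  (if triblk i0 then 2 else 1) <=
    ~~ odd (size l + (\sum_(x <- l) \sum_(y <- l) g x y)./2) + (size s)./2 -> False.
Proof.
move=> bi hS ul hl us ms hs od le; have := sum_weightD1 bi hS; have := weights_le.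
have := card_crossD us ms hs; rewrite weight_setT // (weightE ul hl) ntri4.
move: le od; clear.
by move: (\sum_(i in _) _) ndia #|cross g S blk| (size s) (~~ odd (size l + _)) (if _ then _ else _); lia.
Qed.

(** The edge [xy] is the only cross edge lost. It lowers the right side of the bound by one, so the
    joint weight of the two blocks would have to drop. *)
Lemma removed_cross : ~~ mid x -> y = out x ->
  weight setT (blk x) + weight setT (blk y) <= weight S (blk x) + weight S (blk y) -> False.
Proof.
move=> mx ey le; have my : ~~ mid y by rewrite ey nonmid_out.
have nb : blk x != blk y by rewrite ey eq_sym blk_out.
have xin z : blk z \in blocks by apply: imset_f.
have hS v : blk v != blk x -> blk v != blk y -> v \in S.
  by move=> vx vy; rewrite inS; apply/andP; split; [apply: contraNneq vx|apply: contraNneq vy] => ->.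
have := sum_weightD2 (xin x) (xin y) nb hS; have := weights_le.
have us : uniq [:: x; y] by rewrite /= inE andbT; apply: contraNneq nb => ->.
have ms : {in [:: x; y], forall z, ~~ mid z} by move=> z; rewrite !inE => /orP[]/eqP->.
have hs z : ~~ mid z -> (z \in [:: x; y]) = (z \notin S) || (out z \notin S).
  move=> mz; rewrite !inS !negb_and !negbK !inE.
  have -> : (out z == x) = (z == y) by rewrite ey; apply/eqP/eqP => [<-|->]; rewrite outK.
  have -> : (out z == y) = (z == x).
    by rewrite ey; apply/eqP/eqP => [E|->//]; rewrite -(outK mz) E outK.
  by case: (z == x); case: (z == y).
have := card_crossD us ms hs; rewrite ntri4 /=; move: le; clear.
move: (\sum_(i in _) _) ndia #|cross g S blk| (weight setT (blk x)) (weight setT (blk y)).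
by move: (weight S (blk x)) (weight S (blk y)); lia.
Qed.

End Pair.

Lemma setC2_blk x y i : blk x = i -> blk y = i -> forall v, blk v != i -> v \in ~: [set x; y].
Proof.
by move=> xi yi v; apply: contraNT; rewrite in_setC negbK in_set2 => /orP[]/eqP->; rewrite ?xi ?yi.
Qed.

Lemma out_eq x z : ~~ mid x -> ~~ mid z -> (out z == x) = (z == out x).
Proof. by move=> mx mz; apply/eqP/eqP => [<-|->]; rewrite outK. Qed.

(* Each case produces a block with an extra face that the lost cross edges do not pay for. *)
Theorem not_removable x y : ~ removable g x y.
Proof.
case=> nxy xy _ [cS [rho [rot nf]]].
have blkin z : blk z \in blocks by apply: imset_f.
have swap : [/\ conn_in g (~: [set y; x]), rotation_system g (~: [set y; x]) rho
  & nfaces g (~: [set y; x]) rho <= 2] by rewrite setUC.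
(* An end and a middle vertex of a diamond: the edge left behind has weight 1 like the whole
   diamond, but the outgoing edge of the end is lost. *)
have de_end x' y' : (exists v m, dia y' v x' m) ->
  conn_in g (~: [set x'; y']) -> rotation_system g (~: [set x'; y']) rho ->
  nfaces g (~: [set x'; y']) rho <= 2 -> False.
  move=> [v [m D]] cS' rot' nf'.
  have [_ _ _ _ [/andP[my _] /andP[mv _] mx mm]] := D.
  have yb : blk x' = blk y' by apply/eqP; rewrite (blk_dia D) !inE eqxx !orbT.
  have ou : out y' \notin [:: y'; v; x'; m] by rewrite -(blk_dia D) blk_out.
  have [[/te_g ux /te_g um /te_g vx /te_g vm] [/te_g xm uv _]] := dia_te D.
  have /= ud := dia_uniq D; rewrite !inE !negb_or in ud.
  have /and4P[/and3P[yv yx ym] /andP[vx' vm'] xm' _] := ud.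
  apply: (removed_block rot' cS' nf' (i0 := blk y') (l := [:: v; m]) (s := [:: y'; out y'])) => //.
  - exact: setC2_blk.
  - by rewrite /= inE vm'.
  - move=> z; rewrite in_setC2 (blk_dia D) !inE.
    have [->|zx] := eqVneq z x'; first by rewrite !(eq_sym x') (negbTE vx') (eq_sym m) (negbTE xm').
    have [->|zy] := eqVneq z y'; first by rewrite (negbTE yv) (negbTE ym).
    by [].
  - by rewrite /= inE andbT; apply: contraNneq ou => <-; rewrite inE eqxx.
  - by move=> z; rewrite !inE => /orP[]/eqP-> //; apply: nonmid_out.
  - move=> z mz; rewrite !in_setC2 !negb_and !negbK !inE.
    have -> : z == x' = false by apply: contraNF mz => /eqP->.
    have -> : out z == x' = false by apply: contraNF (nonmid_out mz) => /eqP->.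
    by rewrite out_eq.
  by rewrite (triblkF D) !(big_cons, big_nil) !girr (gsym m v) vm.
have [te_xy|nte] := boolP (te x y).
  case: (te_cases te_xy) => [[b t]|[u [v D]]|h|h].
  (* Two vertices of a triangle: the weight drops only from 2 to 1, while two cross edges are
     lost. *)
  - have [_ _ _ [/andP[mx _] /andP[my _] /andP[mb _]]] := t.
    have xb : blk x = blk y by apply/eqP; rewrite eq_sym (blk_tri t) !inE eqxx orbT.
    have [ox oy] : out x \notin [:: x; y; b] /\ out y \notin [:: x; y; b].
      by split; rewrite -(blk_tri t); [|rewrite xb]; apply: blk_out.
    have /= := tri_uniq t; rewrite !inE !negb_or => /and3P[/andP[xy' xb'] yb' _].
    have oxy : out x != out y by apply: contraNneq xy' => E; rewrite -(outK mx) E outK.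
    move: ox oy; rewrite !inE !negb_or => /and3P[ox1 ox2 _] /and3P[oy1 oy2 _].
    apply: (removed_block rot cS nf (i0 := blk x) (l := [:: b]) (s := [:: x; y; out x; out y])) => //.
    + exact: setC2_blk.
    + move=> z; rewrite in_setC2 (blk_tri t) !inE.
      have [->|zx] := eqVneq z x; first by rewrite (negbTE xb').
      have [->|zy] := eqVneq z y; first by rewrite (negbTE yb').
      by [].
    + by rewrite /= !inE !negb_or xy' oxy !(eq_sym x) !(eq_sym y) ox1 ox2 oy1 oy2.
    + by move=> z; rewrite !inE => /or4P[]/eqP-> //; apply: nonmid_out.
    + move=> z mz; rewrite !in_setC2 !negb_and !negbK !inE.
      by rewrite !out_eq // !orbA.
    by rewrite (triblkT t) !(big_cons, big_nil) !girr.
  (* Both middle vertices: the two isolated ends left behind give an even sum, so the weight rises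
     from 1 to 2 and no cross edge is lost. *)
  - have [_ _ _ _ [/andP[mu _] /andP[mv _] mx my]] := D.
    have xu : blk x = blk u by apply/eqP; rewrite (blk_dia D) !inE eqxx !orbT.
    have yu : blk y = blk u by apply/eqP; rewrite (blk_dia D) !inE eqxx !orbT.
    have /= := dia_uniq D; rewrite !inE !negb_or.
    move=> /and4P[/and3P[uv ux uy] /andP[vx vy] _ _].
    have [_ [_ guv _]] := dia_te D.
    have nm z : ~~ mid z -> (z == x = false) * (z == y = false).
      by move=> mz; split; apply: contraNF mz => /eqP->.
    apply: (removed_block rot cS nf (i0 := blk u) (l := [:: u; v]) (s := [::])) => //.
    + exact: setC2_blk.
    + by rewrite /= inE uv.
    + move=> z; rewrite in_setC2 (blk_dia D) !inE.
      have [->|zx] := eqVneq z x; first by rewrite !(eq_sym x) (negbTE ux) (negbTE vx).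
      have [->|zy] := eqVneq z y; first by rewrite !(eq_sym y) (negbTE uy) (negbTE vy).
      by rewrite /= orbF.
    + by move=> z mz; rewrite !in_setC2 !nm // nonmid_out.
    by rewrite (triblkF D) !(big_cons, big_nil) !girr (gsym v u) guv.
  - exact: (de_end x y h).
  - by case: swap; apply: de_end.
have [//|[mx ey]] := g_cases xy; first by rewrite (negbTE nte).
have my : ~~ mid y by rewrite ey nonmid_out.
have ex : x = out y by rewrite ey outK.
have xy_blk : blk x != blk y by rewrite ey eq_sym blk_out.
(* Losing one end of a cross edge takes a triangle from weight 2 to 1 and a diamond from 1 to 2. The
   sum can drop only if both blocks are triangles, which [tv_out] rules out. *)
have other z z' : ~~ mid z -> ~: [set x; y] = ~: [set z; z'] -> blk z != blk z' ->
    weight (~: [set x; y]) (blk z) = if tv z then 1 else 2.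
  move=> mz -> nzz'; have inb w : blk w = blk z -> (w \in ~: [set z; z']) = (w != z).
    by move=> bw; rewrite in_setC2; case: eqP => //= _; apply: contraNneq nzz' => <-; rewrite bw.
  case: (tv_or_de mz) => [tz|dz].
    have [a [b t]] := tv_tri tz; have /te_g ab : te a b by case: (tri_te t).
    have /= := tri_uniq t; rewrite !inE !negb_or => /and3P[/andP[za zb] nab _].
    rewrite tz (weightE (s := [:: a; b])) ?(big_cons, big_nil) /= ?inE ?nab //.
      by rewrite !girr (gsym b a) ab.
    move=> w; case: (boolP (blk w == blk z)) => [/[dup]/eqP/inb ->|].
      by rewrite (blk_tri t) !inE; case: eqVneq => [->|//]; rewrite (negbTE za) (negbTE zb).
    by rewrite (blk_tri t) !inE andbF => /norP[_] /negbTE.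
  have [v [p D]] := de_dia dz; have [_ /negbTE->] := andP dz; move: D; set m := mate p => D.
  have [[/te_g zp /te_g zm /te_g vp /te_g vm] [/te_g pm _ _]] := dia_te D.
  have /= := dia_uniq D; rewrite !inE !negb_or.
  move=> /and4P[/and3P[zv' zp' zm'] /andP[vp' vm'] pm' _].
  rewrite (weightE (s := [:: v; p; m])) ?(big_cons, big_nil) /= ?inE ?negb_or ?vp' ?vm' ?pm' //.
    by rewrite !girr (gsym p v) !(gsym m) vp vm pm.
  move=> w; case: (boolP (blk w == blk z)) => [/[dup]/eqP/inb ->|].
    rewrite (blk_dia D) !inE; case: (eqVneq w z) => [->|//].
    by rewrite (negbTE zv') (negbTE zp') (negbTE zm').
  by rewrite (blk_dia D) !inE andbF => /norP[_] /negbTE.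
apply: (removed_cross rot cS nf mx ey).
rewrite (other x y) // (other y x) 1?setUC // 1?eq_sym // !weight_setT //.
have tvb z : ~~ mid z -> triblk (blk z) = tv z.
  move=> mz; case: (tv_or_de mz) => [tz|dz].
    by have [a [b t]] := tv_tri tz; rewrite (triblkT t) tz.
  by have [v [p D]] := de_dia dz; have [_ /negbTE->] := andP dz; rewrite (triblkF D).
rewrite !tvb //; case: (boolP (tv x)) => tx; case: (boolP (tv y)) => ty //.
by have := tv_out tx; rewrite -ey /de ty andbF.
Qed.

End NoRemovable.

(** * Centres, and one-face embeddings of claw-free graphs *)

Lemma dia_mateE u v x m : dia u v x m -> mate x = m.
Proof.
case=> nx nm _ _ [/andP[mu _] /andP[mv _] mx mm].
have [u' [v' [[_ _ h'] _ _ mmx _]]] := midP mx; have [_ _ h] := nx.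
have : g x (mate x) by rewrite h' !inE eqxx orbT.
by rewrite h !inE => /or3P[]/eqP E //; move: mmx; rewrite E ?(negbTE mu) ?(negbTE mv).
Qed.

(* One middle vertex out of each diamond. *)
Definition centre x := mid x && (enum_rank x < enum_rank (mate x)).

Lemma centre_dia u v x m : dia u v x m -> centre x = ~~ centre m.
Proof.
move=> D; rewrite /centre (dia_mateE D) (dia_mateE (dia_mate D)).
have xm : x != m by move: (dia_uniq D); rewrite /= !inE !negb_or => /and4P[].
case: D => _ _ _ _ [_ _ -> ->] /=; case: ltngtP => // /val_inj/enum_rank_inj E.
by rewrite E eqxx in xm.
Qed.

Lemma card_centre : #|[pred x | centre x]| = ndia.
Proof.
rewrite -[RHS](mul1n) -[RHS]add0n -(mul0n ntri).
apply: card_blk => [x a b [_ _ _ [/andP[mx _] /andP[ma _] /andP[mb _]]]|u v x m D] /=.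
  by rewrite /centre (negbTE mx) (negbTE ma) (negbTE mb).
rewrite (centre_dia D); case: D => _ _ _ _ [/andP[mu _] /andP[mv _] _ _].
by rewrite /centre (negbTE mu) (negbTE mv) /=; case: (_ && _).
Qed.

(** The neighbour to which a centre keeps its edge. In a triangle the anchor is another vertex of
    the triangle, so the withheld pair includes the outgoing edge: a centre there cuts the string
    that starts at it. *)
Definition anchor x := if mid x then mate x else odflt x [pick y | te x y].

Section Build.
Variables (S Y : {set T}) (ex : {set T * T}).
Let M := [set x in S | centre x || (x \in Y)].
Hypotheses (YS : Y \subset S) (Ytv : {in Y, forall y, tv y}).
Hypothesis Yout : forall y, y \in Y -> out y \notin Y.
Hypothesis Yte : forall y z, y \in Y -> z \in Y -> ~~ te y z.
Hypothesis MS : forall x z, x \in M -> g x z -> z \in S.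
Hypotheses (ex_sym : symset ex) (exM : forall d, d \in ex -> d.1 \notin M).
Hypothesis ex_tri : forall d, d \in ex -> te d.1 d.2 && tv d.1.

Let X0 := darts g S :\: ex.

(* At a vertex of [M] only the edge to its anchor is kept; the other two are added as a pair. *)
Definition keep x y :=
  [&& (x, y) \in X0, (x \in M) ==> (y == anchor x) & (y \in M) ==> (x == anchor y)].

Definition joined := connect [rel x y | keep x y && (x \in S) && (y \in S)].

Let X0_sym : symset X0.
Proof. by move=> d; rewrite !in_setD symset_sw // => /andP[-> /(darts_sym gsym)]. Qed.

Let keep_sym : symmetric keep.
Proof.
have imp x y : keep x y -> keep y x by move=> /and3P[/X0_sym h1 h2 h3]; apply/and3P.
by move=> x y; apply/idP/idP; apply: imp.
Qed.

Lemma anchor_mid u v x m : dia u v x m -> anchor x = m.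
Proof. by move=> D; rewrite /anchor; have [_ _ _ _ [_ _ -> _]] := D; apply: dia_mateE D. Qed.

Lemma anchor_tv x a b : tri x a b -> anchor x = a \/ anchor x = b.
Proof.
move=> t; have [nx _ _ [/andP[mx _] _ _]] := t; rewrite /anchor (negbTE mx).
case: pickP => [y xy|/(_ a)] /=; last by have [-> _ _] := tri_te t.
by have /orP[/eqP|/eqP] : (y == a) || (y == b) by [apply: nb_te mx nx xy]; [left|right].
Qed.

Lemma centre_M x : mid x -> (x \in M) = (x \in S) && centre x.
Proof.
move=> mx; rewrite in_sep; congr (_ && _); case: (boolP (x \in Y)) => [/Ytv/andP[]|]; last by rewrite orbF.
by rewrite mx.
Qed.

Lemma nonmid_M x : ~~ mid x -> (x \in M) = (x \in Y).
Proof.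
move=> mx; rewrite in_sep /centre (negbTE mx) /= andb_idl //; exact: (subsetP YS).
Qed.

(** No withheld edge joins two centres: ends of diamonds are not centres, [Yte] allows one centre
    per triangle, and [Yout] forbids a centre at the other end of an outgoing edge. *)
Theorem build r : r \in S -> conn_in keep S -> #|X0| + 2 = 2 * #|S| + 4 * #|M| ->
  exists rho, rotation_system g S rho /\ one_cycle (phi rho X0) (darts g S).
Proof.
move=> rS cS c0.
have XD : X0 \subset darts g S by apply: subsetDl.
apply: (one_face_exists gsym girr (M := M) (q := anchor) X0_sym XD rS _ cS c0).
move=> x xM; have xS : x \in S by move: xM; rewrite in_sep => /andP[].
have inX z : g x z -> (x, z) \in X0.
  move=> xz; rewrite in_setD dartsE xz xS (MS xM xz) /= andbT.
  by apply/negP => /exM; rewrite /= xM.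
have at_x s : nb x s -> forall w, (x, w) \in darts g S -> w \in s.
  by move=> [_ _ h] w; rewrite dartsE h => /and3P[].
have [mx|mx] := boolP (mid x).
  have [u [v D]] := mid_dia mx; have [nx _ _ _ [/andP[mu dtu] /andP[mv dtv] _ _]] := D.
  have [_ /= us h] := nx; rewrite (anchor_mid D); exists u, v.
  have inD z : z \in [:: u; mate x; v] -> (x, z) \in X0 by rewrite -h; apply: inX.
  split.
  - by split; rewrite ?(subsetP XD) ?inD // !inE eqxx ?orbT.
  - by move: us; rewrite !inE !negb_or => /and3P[/andP[? ?] + _]; rewrite eq_sym.
  - by move=> w /(at_x _ nx); rewrite !inE => /or3P[]->; rewrite ?orbT.
  - by rewrite nonmid_M //; apply: contra dtu; apply: Ytv.
  by rewrite nonmid_M //; apply: contra dtv; apply: Ytv.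
have xY : x \in Y by rewrite -nonmid_M.
have [a [b t]] := tv_tri (Ytv xY).
have [xa xb ab] := tri_te t.
have [nx _ _ [_ /andP[ma _] /andP[mb _]]] := t; have [_ /= us h] := nx.
have inD z : z \in [:: a; b; out x] -> (x, z) \in X0 by rewrite -h; apply: inX.
move: us; rewrite !inE !negb_or => /and3P[/andP[nab nao] nbo _].
have oM : out x \notin M by rewrite nonmid_M ?nonmid_out // Yout.
have noM z : ~~ mid z -> te x z -> z \notin M.
  by move=> mz xz; rewrite nonmid_M //; apply: contraL xz => zY; apply: Yte.
have inN z : z \in [:: a; b; out x] -> g x z && (x \in S) && (z \in S).
  by rewrite -h xS andbT => xz; rewrite xz (MS xM xz).
have aM := noM a ma xa; have bM := noM b mb xb.
case: (anchor_tv t) => ->; [exists b|exists a]; exists (out x); split=> //.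
- by split; [apply: inD|apply: inD|apply: inN]; rewrite !inE eqxx ?orbT.
- by split; rewrite // eq_sym.
- by move=> w /(at_x _ nx); rewrite !inE => /or3P[]->; rewrite ?orbT.
- by split; [apply: inD|apply: inD|apply: inN]; rewrite !inE eqxx ?orbT.
- by split; rewrite // eq_sym.
by move=> w /(at_x _ nx); rewrite !inE => /or3P[]->; rewrite ?orbT.
Qed.

Lemma joined_sym : connect_sym [rel x y | keep x y && (x \in S) && (y \in S)].
Proof. by apply: sym_connect_sym => x y /=; rewrite keep_sym andbAC. Qed.

Lemma joined_edge x y : g x y -> x \in S -> y \in S -> (x, y) \notin ex ->
  (x \notin M) || (y == anchor x) -> (y \notin M) || (x == anchor y) -> joined x y.
Proof.
move=> xy xS yS nex hx hy; apply: connect1; rewrite /= /keep xS yS in_setD nex dartsE xy xS yS.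
by rewrite !implybE hx hy.
Qed.

Lemma joined_centre c (s : seq T) : (forall z, z \in s -> joined c z) ->
  {in s &, forall z w, joined z w}.
Proof.
move=> h z w /h cz /h cw; apply: connect_trans cw; by rewrite joined_sym.
Qed.

Lemma joined_cross z : ~~ mid z -> z \in S -> out z \in S -> z \notin Y -> out z \notin Y ->
  joined z (out z).
Proof.
move=> mz zS oS zY oY; apply: joined_edge; rewrite ?g_out ?nonmid_M ?nonmid_out ?zY ?oY //.
by apply: contra (te_out mz) => /ex_tri/andP[].
Qed.

(** The middle vertex that is not a centre keeps all its edges and joins the other three
    vertices. *)
Lemma joined_dia u v x m : dia u v x m -> {subset [:: u; v; x; m] <= S} ->
  {in [:: u; v; x; m] &, forall z w, joined z w}.
Proof.
have gen x' m' : dia u v x' m' -> centre x' -> {subset [:: u; v; x'; m'] <= S} ->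
    {in [:: u; v; x'; m'] &, forall z w, joined z w}.
    move=> D cx sS; have [[/te_g ux /te_g um /te_g vx /te_g vm] [/te_g xm _ _]] := dia_te D.
    have [_ _ _ _ [/andP[mu tu] /andP[mv tv'] mx mm]] := D.
    have notY z : ~~ tv z -> z \notin Y by apply: contra; apply: Ytv.
    have nex z : (m', z) \notin ex.
      by apply/negP => /ex_tri/andP[_ /andP[/=]]; rewrite mm.
    have mM : m' \notin M.
      by rewrite centre_M // (centre_dia (dia_mate D)) cx andbF.
    have inS z : z \in [:: u; v; x'; m'] -> z \in S by apply: sS.
    apply: (@joined_centre m') => z; rewrite !inE => /or4P[]/eqP->; last exact: connect0.
    + by apply: joined_edge; rewrite 1?gsym ?inS ?mM ?nonmid_M ?notY // !inE eqxx ?orbT.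
    + by apply: joined_edge; rewrite 1?gsym ?inS ?mM ?nonmid_M ?notY // !inE eqxx ?orbT.
    by apply: joined_edge; rewrite 1?gsym ?inS ?mM ?(anchor_mid D) ?eqxx ?orbT // !inE eqxx ?orbT.
move=> D sS; case: (boolP (centre x)) => cx; first exact: gen.
have pm : [:: u; v; x; m] =i [:: u; v; m; x].
  exact/perm_mem/perm_1243.
move=> z w; rewrite !pm; apply: gen; rewrite ?(centre_dia (dia_mate D)) //; first exact: dia_mate.
by move=> y; rewrite -pm; apply: sS.
Qed.

(** If the triangle has a centre, the anchor of that centre serves as hub: it is not a centre
    itself, so it keeps its edges to the centre and to the third vertex. *)
Lemma joined_tri x a b : tri x a b -> {subset [:: x; a; b] <= S} ->
  {in [:: x; a; b] &, forall z w, (z, w) \notin ex} ->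
  {in [:: x; a; b] &, forall z w, joined z w}.
Proof.
have gen y c d : tri y c d -> d \notin Y -> c \notin Y -> (y \notin Y) || (anchor y == c) ->
    {subset [:: y; c; d] <= S} -> (c, y) \notin ex -> (c, d) \notin ex ->
    {in [:: y; c; d] &, forall z w, joined z w}.
  move=> t dY cY yY sS cy cd; have [/te_g yc /te_g yd /te_g ycd] := tri_te t.
  have [_ _ _ [/andP[my _] /andP[mc _] /andP[md _]]] := t.
  apply: (@joined_centre c) => z; rewrite !inE => /or3P[]/eqP->; first last.
  + by apply: joined_edge; rewrite ?sS ?nonmid_M ?cY ?dY // !inE eqxx ?orbT.
  + exact: connect0.
  apply: joined_edge; rewrite 1?gsym ?sS ?nonmid_M ?cY //; rewrite ?inE ?eqxx ?orbT //.
  by rewrite [c == _]eq_sym.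
move=> t sS hex; have [xa xb ab] := tri_te t.
have tr y c d : tri y c d -> perm_eq [:: y; c; d] [:: x; a; b] -> y \in Y ->
    {in [:: x; a; b] &, forall z w, joined z w}.
  move=> t' pt yY z w; rewrite -!(perm_mem pt); move: z w.
  have [yc yd cd] := tri_te t'.
  have nY z : te y z -> z \notin Y by apply: contraL => zY; apply: Yte.
  have sS' : {subset [:: y; c; d] <= S} by move=> z; rewrite (perm_mem pt); apply: sS.
  have nex z w : z \in [:: y; c; d] -> w \in [:: y; c; d] -> (z, w) \notin ex.
    by rewrite !(perm_mem pt); apply: hex.
  case: (anchor_tv t') => an.
    apply: (gen y c d t' (nY _ yd) (nY _ yc) _ sS'); first by rewrite an eqxx orbT.
      by apply: nex; rewrite !inE eqxx ?orbT.
    by apply: nex; rewrite !inE eqxx ?orbT.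
  have t2 := tri_132 t'.
  have pm : [:: y; c; d] =i [:: y; d; c].
    exact/perm_mem/perm_132.
  have sS2 : {subset [:: y; d; c] <= S} by move=> u; rewrite -pm; apply: sS'.
  move=> z w; rewrite !pm; move: z w.
  apply: (gen y d c t2 (nY _ yc) (nY _ yd) _ sS2); first by rewrite an eqxx orbT.
    by apply: nex; rewrite !inE eqxx ?orbT.
  by apply: nex; rewrite !inE eqxx ?orbT.
have t1 := tri_swap t; have [xY|xY] := boolP (x \in Y); first exact: (tr x a b).
have [aY|aY] := boolP (a \in Y).
  by apply: (tr a x b) => //; apply: perm_213.
have [bY|bY] := boolP (b \in Y).
  by apply: (tr b x a) => //; [apply/tri_swap/tri_132|apply: perm_231].
apply: (gen x a b t bY aY _ sS); rewrite ?xY //.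
  by apply: hex; rewrite !inE eqxx ?orbT.
by apply: hex; rewrite !inE eqxx ?orbT.
Qed.

(** For a triangle whose edge [ab] may be in [ex]; the opposite vertex [x] is the hub. *)
Lemma joined_tri_off x a b : tri x a b -> {subset [:: x; a; b] <= S} ->
  [/\ x \notin Y, a \notin Y & b \notin Y] -> (x, a) \notin ex -> (x, b) \notin ex ->
  {in [:: x; a; b] &, forall z w, joined z w}.
Proof.
move=> t sS [xY aY bY] xa xb; have [/te_g txa /te_g txb _] := tri_te t.
have [_ _ _ [/andP[mx _] /andP[ma _] /andP[mb _]]] := t.
apply: (@joined_centre x) => z; rewrite !inE => /or3P[]/eqP->; first exact: connect0.
  by apply: joined_edge; rewrite ?sS ?nonmid_M ?xY ?aY ?bY // !inE eqxx ?orbT.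
by apply: joined_edge; rewrite ?sS ?nonmid_M ?xY ?aY ?bY // !inE eqxx ?orbT.
Qed.

End Build.

(** * Rings of diamonds *)

Section Ring.

Hypothesis two : two_connected g.

Let conT : conn_in g setT. Proof. by case: two => _ []. Qed.

Lemma keep_conn (S Y : {set T}) ex : conn_in (keep S Y ex) S -> conn_in g S.
Proof.
move=> cS x y xS yS; have := cS x y xS yS; apply: connect_sub => u v /= /andP[/andP[uv uS] vS].
by apply: connect1; move: uv; rewrite /= uS vS !andbT => /and3P[]; rewrite in_setD dartsE => /andP[_ /and3P[]].
Qed.

Lemma joined_conn (S Y : {set T}) ex r : symset ex ->
  (forall z, z \in S -> joined S Y ex r z) -> conn_in (keep S Y ex) S.
Proof.
move=> se h x y xS yS; apply: connect_trans (h y yS).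
by rewrite (joined_sym S Y se); apply: h.
Qed.

(** Taking both middle vertices out of one diamond opens the ring into a chain, in which each
    remaining diamond supplies a centre and nothing is left unpaired. *)
Lemma removable_ring : ntri = 0 -> exists x y, removable g x y.
Proof.
move=> t0; have [T2 [_ conV]] := two.
have notv z : ~~ tv z.
  have := card_tv; rewrite t0 => /card0_eq/(_ z).
  by rewrite inE => ->.
have [x [u [v [m D]]]] : exists x u v m, dia u v x m.
  have /card_gt0P[z _] : 0 < #|T| by apply: ltn_trans T2.
  case: (blk_cases z) => [[a [b [_ _ _ [tz _ _]]]]|]; first by have := notv z; rewrite tz.
  by move=> [u [v [x [m [D _]]]]]; exists x, u, v, m.
exists x, m; set S := ~: [set x; m].
have inS z : (z \in S) = (z != x) && (z != m) by apply: in_setC2.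
have [[/te_g ux /te_g um /te_g vx /te_g vm] [/te_g xm guv nuv]] := dia_te D.
have [[_ _ hx] [_ _ hm] _ _ [/andP[mu _] /andP[mv _] mx mm]] := D.
have nmS z : ~~ mid z -> z \in S.
  by move=> mz; rewrite inS; apply/andP; split; apply: contraNneq mz => ->.
have nbS z y : z \in S -> y \notin S -> g z y -> z \in [:: u; v].
  rewrite !inS negb_and !negbK !inE => /andP[/negbTE zx /negbTE zm] /orP[]/eqP->; rewrite gsym.
    by rewrite hx !inE zm /= orbC orbC.
  by rewrite hm !inE zx.
have se : symset (set0 : {set T * T}) by move=> d; rewrite !in_set0.
pose M := [set y in S | centre y || (y \in (set0 : {set T}))].
have MS y z : y \in M -> g y z -> z \in S.
  rewrite in_sep in_set0 orbF => /andP[yS /andP[my _]] yz; apply/negPn/negP => zS.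
  by have := nbS y z yS zS yz; rewrite !inE => /orP[]/eqP E; move: my; rewrite E ?(negbTE mu) ?(negbTE mv).
pose J := joined S set0 set0.
have Ytv0 : {in (set0 : {set T}), forall y, tv y} by move=> y; rewrite in_set0.
have ex0 d : d \in (set0 : {set T * T}) -> te d.1 d.2 && tv d.1 by rewrite in_set0.
have Jte z w : z \in S -> w \in S -> te z w -> J z w.
  move=> zS wS zw; have bzw := te_blk zw.
  case: (blk_cases z) => [[a [b [_ _ _ [tz _ _]]]]|]; first by have := notv z; rewrite tz.
  move=> [u' [v' [x' [m' [D' zD]]]]].
  have zb : blk z = blk u' by apply/eqP; rewrite (blk_dia D').
  have wD : w \in [:: u'; v'; x'; m'] by rewrite -(blk_dia D') -bzw zb.
  have [ee|ne] := eqVneq (blk z) (blk u).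
    have : z \in [:: u; v] /\ w \in [:: u; v].
      have : z \in [:: u; v; x; m] /\ w \in [:: u; v; x; m] by rewrite -!(blk_dia D) -bzw ee.
      move: zS wS; rewrite !inS !inE => /andP[/negbTE-> /negbTE->] /andP[/negbTE-> /negbTE->].
      by rewrite !orbF.
    rewrite !inE => -[/orP[]/eqP Ez /orP[]/eqP Ew]; move: (te_g zw); rewrite Ez Ew ?girr ?guv //.
    by rewrite gsym guv.
  apply: (joined_dia (sub0set S) Ytv0 se ex0 D' _ zD wD).
  move=> y; rewrite -(blk_dia D') -zb => /eqP yz; rewrite inS.
  by apply/andP; split; apply: contraNneq ne => E; rewrite -yz E (blk_dia D) !inE eqxx ?orbT.
have Jg z w : z \in S -> w \in S -> g z w -> J z w.
  move=> zS wS zw; case: (g_cases zw) => [|[mz E]]; first exact: Jte.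
  by rewrite E; apply: (joined_cross (sub0set S) ex0 mz); rewrite -?E ?in_set0.
have Jall z : z \in S -> J u z.
  move=> zS; have [uv|uv] := boolP (J u v).
    apply/negPn/negP => nz; pose A := [set y | (y \notin S) || J u y].
    have inA y : (y \in A) = (y \notin S) || J u y by apply: in_set.
    have [||p [q []]] := connect_exit (conT (in_setT u) (in_setT z)) (P := A).
    - by rewrite inA /J /joined connect0 orbT.
    - by rewrite inA zS.
    rewrite !inA negb_or negbK => pA /andP[qS /negP nq] /= /andP[/andP[pq _] _].
    case/orP: pA => [pS|pJ].
      have := nbS q p qS pS; rewrite gsym => /(_ pq); rewrite !inE => /orP[]/eqP E.
        by apply: nq; rewrite E; apply: connect0.
      by apply: nq; rewrite E.
    have [pS|pS] := boolP (p \in S); first by apply: nq; apply: connect_trans pJ (Jg _ _ pS qS pq).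
    have := nbS q p qS pS; rewrite gsym => /(_ pq); rewrite !inE => /orP[]/eqP E.
      by apply: nq; rewrite E; apply: connect0.
    by apply: nq; rewrite E.
  (* Suppose [u] and [v] are not joined. In [G - u] the part joined to [u] can be left only through
     a neighbour of [x] or [m] other than [u], and that is [v]. *)
  pose A := [set y in S | J u y && (y != u)].
  have ou : out u != u by apply: contraTneq (g_out mu) => ->; rewrite girr.
  have xu : x != u by apply: contraTneq ux => ->; rewrite girr.
  have uV y : (y \in [set: T] :\ u) = (y != u) by rewrite !inE andbT.
  have oS : out u \in S by apply: nmS; apply: nonmid_out.
  have [||||p [q []]] := connect_exit (conV u (out u) x _ _) (P := A).
  - by rewrite uV.
  - by rewrite uV.
  - by rewrite in_sep oS ou andbT; apply: (Jg _ _ _ oS); [apply: nmS|apply: g_out].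
  - by rewrite in_sep inS eqxx.
  rewrite !in_sep => /and3P[pS pJ pu] qA /= /andP[/andP[pq _]]; rewrite uV => qu.
  have [qS|qS] := boolP (q \in S).
    by move: qA; rewrite qS qu andbT /= => /negP[]; apply: connect_trans pJ (Jg _ _ pS qS pq).
  have := nbS p q pS qS pq; rewrite !inE (negbTE pu) /= => /eqP E.
  by move: uv; rewrite -E pJ.
have cK : conn_in (keep S set0 set0) S by apply: (@joined_conn _ _ _ u).
have nxm : x != m by apply: contraTneq xm => ->; rewrite girr.
have cardS := cardsC [set x; m]; rewrite cards2 nxm -/S /= in cardS.
(* Exactly one of the removed vertices [x] and [m] was a centre. *)
have cardM : #|M| + 1 = ndia.
  rewrite -card_centre -[in RHS]sum1_card big_mkcond -(sum_setC2 _ nxm) -addnA; congr (_ + _).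
    rewrite -sum1_card big_mkcond [RHS]big_mkcond; apply: eq_bigr => y _.
    by rewrite in_sep in_set0 orbF; case: (y \in S).
  by rewrite !inE (centre_dia D); case: (centre m).
have cT := card_vertices; rewrite t0 in cT.
have cD := card_darts_setC2 gsym girr cub xm; rewrite -/S in cD.
apply: (removableI gsym girr two) => //.
- exact: keep_conn cK.
(* Since [#|T| = 4 * ndia], both sides are [12 * ndia - 8]. *)
- have c0 : #|darts g S :\: set0| + 2 = 2 * #|S| + 4 * #|M|.
    rewrite setD0; move: cardS cardM cT cD; clear.
    by move: #|darts g S| #|S| #|M| #|T| ndia; lia.
  have [|||rho [rot oc]] := build (sub0set S) Ytv0 _ _ MS se _ (nmS u mu) cK c0.
  + by move=> y; rewrite in_set0.
  + by move=> y z; rewrite in_set0.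
  + by move=> d; rewrite in_set0.
  by exists rho; rewrite setD0 in oc.
by move: cardS cT T2; clear; move: #|S| #|T| ndia; lia.
Qed.

End Ring.

(** * Walking along a string *)

Lemma opp_nonmid x : ~~ mid x -> ~~ mid (opp x).
Proof.
move=> mx; case: (tv_or_de mx) => [tx|dx]; first by rewrite opp_tv.
by have [v [y D]] := de_dia dx; rewrite (opp_dia D); case: D => _ _ _ _ [_ /andP[]].
Qed.

Lemma oppK x : ~~ mid x -> opp (opp x) = x.
Proof.
move=> mx; case: (tv_or_de mx) => [tx|dx]; first by rewrite !opp_tv.
by have [v [y D]] := de_dia dx; rewrite (opp_dia D) (opp_dia (dia_swap D)).
Qed.

Lemma opp_de x : de x -> de (opp x).
Proof. by move=> dx; have [v [y D]] := de_dia dx; rewrite (opp_dia D); case: D => _ _ _ _ []. Qed.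

Lemma opp_neq x : de x -> opp x != x.
Proof.
move=> dx; have [v [y D]] := de_dia dx; rewrite (opp_dia D) eq_sym.
by have [_ [_ _]] := dia_te D.
Qed.

Lemma blk_opp x : ~~ mid x -> blk (opp x) = blk x.
Proof.
move=> mx; case: (tv_or_de mx) => [tx|dx]; first by rewrite opp_tv.
have [v [y D]] := de_dia dx; rewrite (opp_dia D); apply/eqP.
by rewrite (blk_dia D) !inE eqxx orbT.
Qed.

Lemma out_inj x y : ~~ mid x -> ~~ mid y -> out x = out y -> x = y.
Proof. by move=> mx my e; rewrite -(outK mx) e outK. Qed.

Lemma tv_nonmid x : tv x -> ~~ mid x. Proof. by case/andP. Qed.
Lemma de_nonmid x : de x -> ~~ mid x. Proof. by case/andP. Qed.

(* Crosses a diamond from one end to the other, and then the next edge; at a triangle vertex it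
   goes back along the outgoing edge. *)
Definition hop x := if mid x then x else out (opp x).

Lemma hop_nonmid x : ~~ mid x -> ~~ mid (hop x).
Proof. by move=> mx; rewrite /hop (negbTE mx) nonmid_out ?opp_nonmid. Qed.

Lemma hop_inj : injective hop.
Proof.
move=> x y; rewrite /hop; case: (boolP (mid x)) => mx; case: (boolP (mid y)) => my //.
- by move=> E; move: mx; rewrite E (negbTE (nonmid_out (opp_nonmid my))).
- by move=> E; move: my; rewrite -E (negbTE (nonmid_out (opp_nonmid mx))).
by move=> /out_inj e; rewrite -(oppK mx) e ?oppK // opp_nonmid.
Qed.

(* The string leaving the triangle vertex [z] enters its diamonds at [walk z 0], ..., [walk z (nu z - 1)]
   and ends at the triangle vertex [zeta z]. *)
Definition walk z i := iter i hop (out z).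
Definition nu z := find tv (traject hop (out z) #|T|).
Definition zeta z := walk z (nu z).

Lemma walk0 z : walk z 0 = out z. Proof. by []. Qed.

Lemma walk_nonmid z i : ~~ mid z -> ~~ mid (walk z i).
Proof. by move=> mz; elim: i => [|i IH]; [apply: nonmid_out|apply: hop_nonmid]. Qed.

Lemma walkS z i : ~~ mid z -> walk z i.+1 = out (opp (walk z i)).
Proof. by move=> mz; rewrite /= /hop (negbTE (walk_nonmid i mz)). Qed.

(** [hop] is a permutation, so the walk returns to [out z]. The predecessor of [out z] is [z]
    itself, hence a triangle vertex is met before the return at the latest. *)
Lemma walk_has_tv z : tv z -> has tv (traject hop (out z) #|T|).
Proof.
move=> tz; have mz := tv_nonmid tz.
have ord_le : order hop (out z) <= #|T|.
  by rewrite -size_orbit -(card_uniqP (orbit_uniq hop (out z))); apply: max_card.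
have : iter (order hop (out z)) hop (out z) = out z by apply: iter_order hop_inj _.
rewrite -orderSpred; set n := (order _ _).-1 => e.
have {}e : out (opp (walk z n)) = out z by rewrite -walkS.
have ez : walk z n = z.
  rewrite -(oppK (walk_nonmid n mz)) (out_inj (opp_nonmid (walk_nonmid n mz)) mz e).
  exact: opp_tv.
apply/hasP; exists z => //; apply/trajectP; exists n => //.
by rewrite /n orderSpred.
Qed.

Lemma nu_lt z : tv z -> nu z < #|T|.
Proof. by move=> /walk_has_tv; rewrite has_find size_traject. Qed.

Lemma zeta_tv z : tv z -> tv (zeta z).
Proof.
move=> tz; have := nth_find (out z) (walk_has_tv tz).
by rewrite nth_traject // nu_lt.
Qed.

Lemma walk_de z i : tv z -> i < nu z -> de (walk z i).
Proof.
move=> tz lt; have := before_find (out z) lt; rewrite nth_traject; last exact: ltn_trans lt (nu_lt tz).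
by move=> h; rewrite /de h walk_nonmid // tv_nonmid.
Qed.

Lemma nu_unique z k : tv z -> tv (walk z k) -> (forall i, i < k -> ~~ tv (walk z i)) -> nu z = k.
Proof.
move=> tz tk hk; case: (ltngtP (nu z) k) => // [lt|lt].
  by have := hk _ lt; rewrite zeta_tv.
by have /andP[_] := walk_de tz lt; rewrite tk.
Qed.

Lemma walk_rev z i : tv z -> i < nu z -> walk (zeta z) i = opp (walk z (nu z - i.+1)).
Proof.
move=> tz; have mz := tv_nonmid tz; elim: i => [|i IH] lt.
  rewrite walk0 /zeta; have -> : nu z = (nu z - 1).+1 by move: lt; clear; lia.
  by rewrite walkS // outK ?opp_nonmid ?walk_nonmid // subSS subn0.
rewrite walkS ?IH ?(ltnW lt) // ?oppK ?walk_nonmid ?tv_nonmid ?zeta_tv //.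
have -> : nu z - i.+1 = (nu z - i.+2).+1 by move: lt; clear; lia.
by rewrite walkS // outK ?opp_nonmid ?walk_nonmid.
Qed.

Lemma walk_zeta z : tv z -> walk (zeta z) (nu z) = z.
Proof.
move=> tz; have mz := tv_nonmid tz; case E : (nu z) => [|n].
  by rewrite walk0 /zeta E walk0 outK.
rewrite walkS ?tv_nonmid ?zeta_tv // walk_rev ?E // subnn oppK ?walk_nonmid //.
by rewrite walk0 outK.
Qed.

Lemma nu_zeta z : tv z -> nu (zeta z) = nu z.
Proof.
move=> tz; apply: nu_unique; rewrite ?zeta_tv ?walk_zeta // => i lt.
rewrite walk_rev //; have /opp_de/andP[_ //] : de (walk z (nu z - i.+1)).
by apply: walk_de => //; move: lt; clear; lia.
Qed.

Lemma zetaK z : tv z -> zeta (zeta z) = z.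
Proof. by move=> tz; rewrite {1}/zeta nu_zeta // walk_zeta. Qed.

(* A string returning to its origin would be folded at a diamond or at an edge. *)
Lemma zeta_neq z : tv z -> zeta z != z.
Proof.
move=> tz; have mz := tv_nonmid tz; apply/eqP => e.
have rev i : i < nu z -> walk z i = opp (walk z (nu z - i.+1)).
  by move=> lt; rewrite -(walk_rev tz lt) e.
have := odd_double_half (nu z); case o : (odd _) => /= E.
  have lt : (nu z)./2 < nu z by move: E; clear; lia.
  have := rev _ lt; have -> : nu z - (nu z)./2.+1 = (nu z)./2 by move: E; clear; lia.
  by move/esym/eqP; rewrite (negbTE (opp_neq (walk_de tz lt))).
case E' : (nu z)./2 => [|m]; rewrite E' in E.
  have n0 : nu z = 0 by move: E; clear; lia.
  by have := g_out mz; rewrite -walk0 -n0 -/(zeta z) e girr.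
have lt : m.+1 < nu z by move: E; clear; lia.
have := rev _ lt; have -> : nu z - m.+2 = m by move: E; clear; lia.
rewrite walkS // => e'; have mo := opp_nonmid (walk_nonmid m mz).
by have := g_out mo; rewrite e' girr.
Qed.

(** Injectivity of [hop] runs both walks backwards until one is at its start. The start of a walk is
    not an inner position of another one, because its predecessor under [hop] is a triangle
    vertex. *)
Lemma walk_inj z z' i i' : tv z -> tv z' -> i <= nu z -> i' <= nu z' ->
  walk z i = walk z' i' -> z = z' /\ i = i'.
Proof.
have aux y y' j : tv y -> tv y' -> j < nu y' -> out y <> walk y' j.+1.
  move=> ty ty' lt; rewrite walkS ?tv_nonmid // => /out_inj e.
  have /opp_de/andP[mw tw] := walk_de ty' lt.
  by move: tw; rewrite -(e (tv_nonmid ty) mw) ty.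
move=> tz tz'; have mz := tv_nonmid tz; have mz' := tv_nonmid tz'.
elim: i i' => [|i IH] [|i'] lt lt'.
- by move=> /out_inj -> //.
- by move/aux => [].
- by move/esym/aux => [].
by move=> /hop_inj e; have [||-> ->] := IH i' _ _ e; rewrite 1?ltnW.
Qed.

Lemma walk_rev_neq z z' i i' : tv z -> tv z' -> i < nu z -> i' < nu z' ->
  walk z i = opp (walk z' i') -> z = zeta z'.
Proof.
move=> tz tz' lt lt' e; have lt2 : nu z' - i'.+1 < nu z' by move: lt'; clear; lia.
have e2 : walk (zeta z') (nu z' - i'.+1) = opp (walk z' i').
  by rewrite walk_rev //; congr (opp (walk _ _)); move: lt'; clear; lia.
have [||-> //] := @walk_inj z (zeta z') i (nu z' - i'.+1) tz (zeta_tv tz') (ltnW lt) _ _.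
  by rewrite nu_zeta // ltnW.
by rewrite e2.
Qed.

Section Closed.
Variable A : {set T}.
Hypotheses (Atv : {in A, forall z, tv z}) (Azeta : {in A, forall z, zeta z \in A}).

Definition on_string y := exists z i, [/\ z \in A, i < nu z & blk y = blk (walk z i)].

Lemma on_string_te y y' : on_string y -> te y y' -> on_string y'.
Proof. by case=> z [i [zA lt e]] /te_blk e'; exists z, i; rewrite -e' e. Qed.

Lemma walk_end y z i : z \in A -> i < nu z -> blk y = blk (walk z i) ->
  ~~ mid y -> y = walk z i \/ y = opp (walk z i).
Proof.
move=> zA lt e my; have dw := walk_de (Atv zA) lt; have [v [x D]] := de_dia dw.
have : y \in [:: walk z i; v; x; mate x] by rewrite -(blk_dia D) e.
rewrite (opp_dia D) !inE => /or4P[]/eqP E; [by left|by right| |];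
  by case: D => _ _ _ _ [_ _ mx mm]; move: my; rewrite E ?mx ?mm.
Qed.

Lemma on_string_nottv y : on_string y -> ~~ tv y.
Proof.
case=> z [i [zA lt e]]; apply/negP => ty; have dw := walk_de (Atv zA) lt.
have [] := walk_end zA lt e (tv_nonmid ty) => E; move: ty; rewrite E.
  by have /andP[_ /negbTE->] := dw.
by have /andP[_ /negbTE->] := opp_de dw.
Qed.

(** Together with [on_string_te], this shows that a path can leave [A] and its strings only along a
    triangle edge at a vertex of [A]. In this form 2-connectedness will exclude loops and triple
    edges of the base multigraph. *)
Lemma on_string_out y : ~~ mid y -> y \in A \/ on_string y ->
  out y \in A \/ on_string (out y).
Proof.
move=> my [yA|[z [i [zA lt e]]]].
  have zy := Azeta yA; case E : (nu y) => [|n]; last by right; exists y, 0; rewrite E.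
  by left; move: zy; rewrite /zeta E.
have tz := Atv zA; have mz := tv_nonmid tz.
have [->|->] := walk_end zA lt e my.
  case: i lt {e} => [|i] lt; first by left; rewrite walk0 outK.
  right; exists z, i; split=> //; first exact: ltnW.
  by rewrite walkS // outK ?blk_opp ?opp_nonmid ?walk_nonmid.
rewrite -walkS //; have [lt2|le] := ltnP i.+1 (nu z); first by right; exists z, i.+1.
left; have -> : i.+1 = nu z by move: lt le; clear; lia.
exact: Azeta.
Qed.

End Closed.

(** * Strings of diamonds between triangles *)

Section Labels.

Hypothesis two : two_connected g.
Hypothesis ntri4 : ntri = 4.

Let ex_tv (s : seq T) : size s < 12 -> exists2 z, tv z & z \notin s.
Proof.
move=> ls; have [/existsP[z /andP[]]|] := boolP [exists z, tv z && (z \notin s)]; first by exists z.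
rewrite negb_exists => /forallP no; suff : #|[pred z | tv z]| <= size s.
  by rewrite card_tv ntri4 leqNgt ls.
apply: leq_trans (card_size s); apply/subset_leq_card/subsetP => z; rewrite inE => tz.
by have := no z; rewrite tz negbK.
Qed.

Lemma tri_te_in z a b y : tri z a b -> te z y -> y \in [:: a; b].
Proof.
move=> t zy; have [nx _ _ [tz _ _]] := t; rewrite !inE; apply: nb_te zy => //.
exact: tv_nonmid.
Qed.

(** If a string returned to its own triangle, the third vertex [w] of the triangle would separate
    this string from the other triangles. *)
Lemma zeta_blk z : tv z -> blk (zeta z) != blk z.
Proof.
move=> tz; apply/negP => bz.
have [w t] : exists w, tri z (zeta z) w.
  have [a [b t]] := tv_tri tz; move: bz; rewrite (blk_tri t) !inE (negbTE (zeta_neq tz)) /=.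
  by move=> /orP[]/eqP->; [exists b|exists a; apply: tri_132].
pose A := [set z; zeta z].
have Atv : {in A, forall y, tv y} by move=> y /set2P[]->; rewrite ?zeta_tv.
have Az : {in A, forall y, zeta y \in A}.
  by move=> y /set2P[]->; rewrite !inE ?zetaK ?eqxx ?orbT.
have [_ [_ conV]] := two.
have [y ty] := @ex_tv [:: z; zeta z; w] isT; rewrite !inE !negb_or => /and3P[yz yz' yw].
have zw : z != w by have := tri_uniq t; rewrite /= !inE !negb_or => /andP[/andP[]].
have := conV w z y; rewrite !inE zw yw => /(_ isT isT) con.
have : y \in A \/ on_string A y.
  apply: (connect_prop (P := fun y => y \in A \/ on_string A y) con) => [|u v uQ]; first by left; rewrite !inE eqxx.
  rewrite /= !in_setD1 !in_setT !andbT => /andP[/andP[uv _] vw]; case: (g_cases uv) => [tuv|[mu ->]]; last first.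
    exact: (on_string_out Atv Az mu uQ).
  case: uQ => [uA|us]; last by right; apply: on_string_te tuv.
  left; move: tuv; have /set2P[->|->] := uA; [move/(tri_te_in t)|move/(tri_te_in (tri_swap t))];
    by rewrite !inE (negbTE vw) orbF => ->; rewrite ?orbT.
by case=> [/set2P[]/eqP|/(on_string_nottv Atv)]; rewrite ?(negbTE yz) ?(negbTE yz') ?ty.
Qed.

Definition strings i j := [pred z | [&& tv z, blk z == i & blk (zeta z) == j]].
Notation mult i j := #|strings i j|.

Lemma mult_sym i j : mult i j = mult j i.
Proof.
have le i' j' : mult i' j' <= mult j' i'.
  rewrite -(card_in_imset (f := zeta) (D := strings i' j')); last first.
    move=> x y; rewrite !inE => /andP[tx _] /andP[ty _] e.
    by rewrite -(zetaK tx) e zetaK.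
  apply/subset_leq_card/subsetP => _ /imsetP[z + ->]; rewrite !inE => /and3P[tz bz bz'].
  by rewrite zeta_tv // zetaK // bz bz'.
by apply/eqP; rewrite eqn_leq !le.
Qed.

Lemma mult_diag i : mult i i = 0.
Proof.
apply: eq_card0 => z; rewrite !inE; apply/negP => /and3P[tz /eqP zi zi'].
by have := zeta_blk tz; rewrite zi zi'.
Qed.

Lemma card_tvblk i : i \in blocks -> triblk i -> #|[pred z | tv z && (blk z == i)]| = 3.
Proof.
move=> /blockP[[_ [x [a [b [t ->]]]]]|[/negbTE-> //]] _.
have /= <- := card_uniqP (tri_uniq t); apply: eq_card => z.
rewrite !inE (blk_tri t) !inE; have [_ _ _ [tx ta tb]] := t.
by apply/andb_idl => /or3P[]/eqP->.
Qed.

(** Three strings between two triangles would close up into a component containing only six of the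
    twelve triangle vertices. *)
Lemma mult_lt3 i j : i \in blocks -> triblk i -> triblk j -> j \in blocks -> mult i j < 3.
Proof.
move=> ib ti tj jb; rewrite ltn_neqAle; have le i' j' : i' \in blocks -> triblk i' ->
    mult i' j' <= 3 ?= iff [forall z, tv z ==> (blk z == i') ==> (blk (zeta z) == j')].
  move=> bi' ti'; rewrite -(card_tvblk bi' ti').
  have sub : strings i' j' \subset [pred z | tv z && (blk z == i')].
    by apply/subsetP => z; rewrite !inE => /and3P[-> ->].
  apply/leqifP; case: ifP => [/forallP h|/negbT].
    apply/eqP/eq_card => z; rewrite !inE; have := h z.
    by case: (tv z) => //=; case: (blk z == i') => //= ->.
  rewrite negb_forall => /existsP[z]; rewrite !negb_imply => /and3P[tz bz nz].
  apply: proper_card; rewrite properE sub; apply/subsetPn; exists z; rewrite !inE tz bz //=.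
have [lei eqi] := le i j ib ti; rewrite lei andbT; apply/negP => m3.
have m3' : mult j i == 3 by rewrite -mult_sym.
move: m3 m3'; rewrite eqi; have [_ ->] := le j i jb tj => /forallP hi /forallP hj.
pose A := [set z | tv z & (blk z == i) || (blk z == j)].
have inA z : (z \in A) = tv z && ((blk z == i) || (blk z == j)) by apply: in_set.
have Atv : {in A, forall y, tv y} by move=> y; rewrite inA => /andP[].
have Az : {in A, forall y, zeta y \in A}.
  move=> y; rewrite !inA => /andP[ty /orP[]yb]; rewrite zeta_tv //=.
    by have := hi y; rewrite ty yb /= => ->; rewrite orbT.
  by have := hj y; rewrite ty yb /= => ->.
have [x [a [b [t ei]]]] : exists x a b, tri x a b /\ i = blk x.
  by case: (blockP ib) => [[_ //]|[]]; rewrite ti.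
have [x' [a' [b' [t' ej]]]] : exists x a b, tri x a b /\ j = blk x.
  by case: (blockP jb) => [[_ //]|[]]; rewrite tj.
have [y ty] := @ex_tv [:: x; a; b; x'; a'; b'] isT.
rewrite -[_ :: _]/([:: x; a; b] ++ [:: x'; a'; b']) mem_cat -(blk_tri t) -(blk_tri t') -ei -ej => ny.
have [_ [conT _]] := two.
have xA : x \in A by rewrite inA ei eqxx andbT; case: t => _ _ _ [].
have : y \in A \/ on_string A y.
  apply: (connect_prop (P := fun y => y \in A \/ on_string A y) (conT x y (in_setT _) (in_setT _))) => [|u v uQ]; first by left.
  move=> /= /andP[/andP[uv _] _]; case: (g_cases uv) => [tuv|[mu ->]]; last first.
    exact: (on_string_out Atv Az mu uQ).
  case: uQ => [uA|us]; last by right; apply: on_string_te tuv.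
  left; move: uA; rewrite !inA -(te_blk tuv) => /andP[tu ->]; rewrite andbT.
  have [c [d t2]] := tv_tri tu; have := tri_te_in t2 tuv; case: t2 => _ _ _ [_ tc td].
  by rewrite !inE => /orP[]/eqP->.
by case=> [|/(on_string_nottv Atv)]; rewrite ?inA ?(negbTE ny) ?andbF ?ty.
Qed.

Lemma tvblk_enum : exists ns, [/\ size ns = 4, uniq ns &
  forall i, (i \in ns) = (i \in blocks) && triblk i].
Proof.
exists (enum [set i in blocks | triblk i]); split; rewrite ?enum_uniq -?cardE //.
by move=> i; rewrite mem_enum inE.
Qed.

Lemma sum_mult ns i : uniq ns -> (forall j, (j \in ns) = (j \in blocks) && triblk j) ->
  i \in ns -> \sum_(j <- ns) mult i j = 3.
Proof.
move=> un hn; rewrite hn => /andP[ib ti]; rewrite -(card_tvblk ib ti) (big_uniq _ un) /=.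
rewrite -sum1_card [in RHS](partition_big (fun z => blk (zeta z)) (mem ns)) /=.
  apply: eq_bigr => j _; rewrite -sum1_card; apply: eq_bigl => z.
  by rewrite !inE andbA.
move=> z /andP[tz _]; rewrite hn; apply/andP; split; first exact: imset_f.
have tz' := zeta_tv tz; have [a [b t]] := tv_tri tz'; exact: triblkT t.
Qed.

(* Rank of an edge of the base multigraph among its parallel edges. *)
Definition parallel (b : bool) (e : nat) : nat := ~~ b && ((e == 1) || (e == 4)).

(** The strict inequality guarantees a string of rank [parallel b e] among those joining the two
    nodes. *)
Definition labelling_nodes b n0 n1 n2 n3 :=
  [/\ uniq [:: n0; n1; n2; n3],
      forall i, (i \in [:: n0; n1; n2; n3]) = (i \in blocks) && triblk i &
      forall e, e < 6 -> parallel b e <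
        mult (nth n0 [:: n0; n1; n2; n3] (endpoint b e false))
             (nth n0 [:: n0; n1; n2; n3] (endpoint b e true))].

Section Pick.
Variables i0 i1 i2 i3 : T.
Hypothesis un : uniq [:: i0; i1; i2; i3].
Hypothesis hn : forall i, (i \in [:: i0; i1; i2; i3]) = (i \in blocks) && triblk i.

Lemma pick_K4 : [/\ 0 < mult i0 i1, 0 < mult i0 i2 & 0 < mult i0 i3] ->
  [/\ 0 < mult i1 i2, 0 < mult i1 i3 & 0 < mult i2 i3] -> labelling_nodes true i0 i1 i2 i3.
Proof.
by move=> [m01 m02 m03] [m12 m13 m23]; split=> // -[|[|[|[|[|[|]]]]]].
Qed.

Lemma pick_L4 n0 n1 n2 n3 : perm_eq [:: i0; i1; i2; i3] [:: n0; n1; n2; n3] ->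
  1 < mult n0 n1 -> 0 < mult n1 n2 -> 1 < mult n2 n3 -> 0 < mult n3 n0 ->
  labelling_nodes false n0 n1 n2 n3.
Proof.
move=> p m01 m12 m23 m30; split=> [|i|]; first by rewrite -(perm_uniq p).
  by rewrite -(perm_mem p).
by move=> [|[|[|[|[|[|]]]]]] //= _; apply: ltnW.
Qed.
End Pick.

Lemma three_split a b c : 0 + (a + (b + c)) = 3 -> a < 3 -> b < 3 -> c < 3 ->
  (0 < a /\ 0 < b /\ 0 < c) \/ (a = 2 /\ b = 1) \/ (a = 2 /\ c = 1) \/ (b = 2 /\ a = 1) \/
  (b = 2 /\ c = 1) \/ (c = 2 /\ a = 1) \/ (c = 2 /\ b = 1).
Proof. by clear; lia. Qed.

(** Since every node has degree 3, opposite pairs of nodes have equal multiplicities. The multigraph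
    is thus given by three numbers below 3 with sum 3: [1, 1, 1] is [K4], and each order of
    [2, 1, 0] is an [L4]. *)
Lemma nodes_exist : exists b n0 n1 n2 n3, labelling_nodes b n0 n1 n2 n3.
Proof.
have [[|i0 [|i1 [|i2 [|i3 [|? ?]]]]] [// _ un hn]] := tvblk_enum.
have s0 := @sum_mult _ i0 un hn; have s1 := @sum_mult _ i1 un hn.
have s2 := @sum_mult _ i2 un hn; have s3 := @sum_mult _ i3 un hn.
have lt i j : i \in [:: i0; i1; i2; i3] -> j \in [:: i0; i1; i2; i3] -> mult i j < 3.
  by rewrite !hn => /andP[ib ti] /andP[jb tj]; apply: mult_lt3.
have := lt i0 i1; have := lt i0 i2; have := lt i0 i3; move: s0 s1 s2 s3 {lt}.
rewrite !inE !eqxx !orbT /= !big_cons !big_nil !addn0 !mult_diag.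
have [m10 m20 m30] : [/\ mult i1 i0 = mult i0 i1, mult i2 i0 = mult i0 i2 & mult i3 i0 = mult i0 i3].
  by split; apply: mult_sym.
have [m21 m31 m32] : [/\ mult i2 i1 = mult i1 i2, mult i3 i1 = mult i1 i3 & mult i3 i2 = mult i2 i3].
  by split; apply: mult_sym.
rewrite m10 m20 m30 m21 m31 m32.
move=> /(_ isT) s0 /(_ isT) s1 /(_ isT) s2 /(_ isT) s3 /(_ isT isT) c3 /(_ isT isT) b3 /(_ isT isT) a3.
have [ea eb ec] : [/\ mult i2 i3 = mult i0 i1, mult i1 i3 = mult i0 i2 & mult i1 i2 = mult i0 i3].
  move: s0 s1 s2 s3; clear.
  move: (mult i0 i1) (mult i0 i2) (mult i0 i3) (mult i1 i2) (mult i1 i3) (mult i2 i3).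
  by move=> *; split; lia.
have L n0 n1 n2 n3 := @pick_L4 _ _ _ _ un hn n0 n1 n2 n3.
have := three_split s0 a3 b3 c3.
case=> [[pa [pb pc]]|[[e e']|[[e e']|[[e e']|[[e e']|[[e e']|[e e']]]]]]].
- by exists true, i0, i1, i2, i3; apply: pick_K4 => //; split; rewrite ?ea ?eb ?ec.
- exists false, i0, i1, i3, i2; apply: L; rewrite ?m10 ?m20 ?m30 ?m21 ?m31 ?m32 ?ea ?eb ?ec ?e ?e' //.
  by clear; apply/seq.permP => P /=; lia.
- exists false, i0, i1, i2, i3; apply: L; rewrite ?m10 ?m20 ?m30 ?m21 ?m31 ?m32 ?ea ?eb ?ec ?e ?e' //.
- exists false, i0, i2, i3, i1; apply: L; rewrite ?m10 ?m20 ?m30 ?m21 ?m31 ?m32 ?ea ?eb ?ec ?e ?e' //.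
  by clear; apply/seq.permP => P /=; lia.
- exists false, i0, i2, i1, i3; apply: L; rewrite ?m10 ?m20 ?m30 ?m21 ?m31 ?m32 ?ea ?eb ?ec ?e ?e' //.
  by clear; apply/seq.permP => P /=; lia.
- exists false, i0, i3, i2, i1; apply: L; rewrite ?m10 ?m20 ?m30 ?m21 ?m31 ?m32 ?ea ?eb ?ec ?e ?e' //.
  by clear; apply/seq.permP => P /=; lia.
exists false, i0, i3, i1, i2; apply: L; rewrite ?m10 ?m20 ?m30 ?m21 ?m31 ?m32 ?ea ?eb ?ec ?e ?e' //.
by clear; apply/seq.permP => P /=; lia.
Qed.

(** [lab e s] is the triangle vertex destined to correspond to [inl (e, s)]. Each string receives
    the orientation of its base edge, and [zeta] exchanges the two ends. *)
Definition labelling (b : bool) (lab : nat -> bool -> T) :=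
  [/\ forall e s, e < 6 -> tv (lab e s),
      forall e s, e < 6 -> zeta (lab e s) = lab e (~~ s),
      forall e s e' s', e < 6 -> e' < 6 ->
        (blk (lab e s) == blk (lab e' s')) = (endpoint b e s == endpoint b e' s'),
      forall e s e' s', e < 6 -> e' < 6 -> lab e s = lab e' s' -> e = e' /\ s = s' &
      forall z, tv z -> exists e s, e < 6 /\ z = lab e s].

Lemma endpoint_lt4 b e s : endpoint b e s < 4.
Proof.
rewrite /endpoint; case: (ltnP e 6) => [|le]; last by case: b; rewrite nth_default //; case: s.
by move: e => [|[|[|[|[|[|e]]]]]]; case: b; case: s.
Qed.

(** Parallel edges are listed in the same direction, so the ordered pair of end nodes determines the
    side [s], and the edge up to its rank. *)
Lemma endpoint_inj b e s e' s' : e < 6 -> e' < 6 -> endpoint b e s = endpoint b e' s' ->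
  endpoint b e (~~ s) = endpoint b e' (~~ s') ->
  s = s' /\ (parallel b e = parallel b e' -> e = e').
Proof.
by move: e e' => [|[|[|[|[|[|e]]]]]] [|[|[|[|[|[|e']]]]]] //=; case: b; case: s; case: s'.
Qed.

(** Parallel base edges receive different strings through their rank in [enum (strings i j)]. Once
    injectivity is known, surjectivity follows because both sides have twelve elements. *)
Lemma labels_exist : exists b lab, labelling b lab.
Proof.
have [b [n0 [n1 [n2 [n3 [un hn hm]]]]]] := nodes_exist.
set ns := [:: n0; n1; n2; n3] in un hn hm; pose nd k := nth n0 ns k.
have ndE k k' : k < 4 -> k' < 4 -> (nd k == nd k') = (k == k') by move=> *; apply: nth_uniq.
pose Z i j := enum (strings i j).
pose la e := nth n0 (Z (nd (endpoint b e false)) (nd (endpoint b e true))) (parallel b e).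
have laP e : e < 6 -> [/\ tv (la e), blk (la e) = nd (endpoint b e false)
    & blk (zeta (la e)) = nd (endpoint b e true)].
  move=> e6; have : la e \in Z (nd (endpoint b e false)) (nd (endpoint b e true)).
    by rewrite mem_nth // /Z -cardE hm.
  by rewrite mem_enum inE => /and3P[? /eqP ? /eqP ?].
pose lab e s := if s then zeta (la e) else la e.
have lab_tv e s : e < 6 -> tv (lab e s) by move=> /laP[]; rewrite /lab; case: s => // /zeta_tv.
have lab_zeta e s : e < 6 -> zeta (lab e s) = lab e (~~ s).
  by move=> /laP[tl _ _]; rewrite /lab; case: s => //=; apply: zetaK.
have lab_blk e s : e < 6 -> blk (lab e s) = nd (endpoint b e s).
  by move=> /laP[_ b1 b2]; rewrite /lab; case: s.
have lab_inj e s e' s' : e < 6 -> e' < 6 -> lab e s = lab e' s' -> e = e' /\ s = s'.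
  move=> e6 e6' E.
  have E1 : endpoint b e s = endpoint b e' s'.
    by apply/eqP; rewrite -ndE ?endpoint_lt4 // -!lab_blk // E.
  have E2 : endpoint b e (~~ s) = endpoint b e' (~~ s').
    by apply/eqP; rewrite -ndE ?endpoint_lt4 // -!lab_blk // -!lab_zeta // E.
  have [ss ee] := endpoint_inj e6 e6' E1 E2; split=> //.
  have {E} : la e = la e'.
    move: E; rewrite /lab -ss; case: s {E1 E2 ss} => // E.
    by have [t1 _ _] := laP e e6; have [t2 _ _] := laP e' e6'; rewrite -(zetaK t1) E zetaK.
  have E1' : endpoint b e false = endpoint b e' false by move: E1 E2; rewrite -ss; case: (s).
  have E2' : endpoint b e true = endpoint b e' true by move: E1 E2; rewrite -ss; case: (s).
  rewrite /la -E1' -E2' => /eqP; rewrite nth_uniq ?enum_uniq // /Z -?cardE ?hm //.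
    by move=> /eqP /ee.
  by rewrite E1' E2' hm.
exists b, lab; split=> //.
  by move=> e s e' s' e6 e6'; rewrite !lab_blk // ndE ?endpoint_lt4.
pose f (x : 'I_6 * bool) := lab x.1 x.2.
have f_inj : injective f.
  move=> [e s] [e' s'] /lab_inj [] // /= /val_inj -> -> //.
have /eqP eqf : f @: setT == [set z | tv z].
  rewrite eqEcard; apply/andP; split.
    by apply/subsetP => _ /imsetP[[e s] _ ->]; rewrite inE; apply: lab_tv.
  rewrite card_imset // cardsT card_prod card_ord card_bool.
  have c := card_tv; rewrite ntri4 in c; rewrite -[6 * 2]/(3 * 4) -c.
  by apply: eq_leq; apply: eq_card => z; rewrite !inE.
move=> z tz; have : z \in f @: setT by rewrite eqf inE.
by case/imsetP => -[e s] _ ->; exists e, s.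
Qed.

End Labels.

(** * Embeddings from spanning trees of the base multigraph *)

Section TriangleEmbeddings.

Hypothesis two : two_connected g.
Hypothesis ntri4 : ntri = 4.

Variables (b : bool) (lab : nat -> bool -> T).
Hypothesis labP : labelling b lab.

Let lab_tv e s : e < 6 -> tv (lab e s). Proof. by case: labP => h _ _ _ _; apply: h. Qed.
Let lab_zeta e s : e < 6 -> zeta (lab e s) = lab e (~~ s).
Proof. by case: labP => _ h _ _ _; apply: h. Qed.
Let lab_blk e s e' s' : e < 6 -> e' < 6 ->
  (blk (lab e s) == blk (lab e' s')) = (endpoint b e s == endpoint b e' s').
Proof. by case: labP => _ _ h _ _; apply: h. Qed.
Let lab_inj e s e' s' : e < 6 -> e' < 6 -> lab e s = lab e' s' -> e = e' /\ s = s'.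
Proof. by case: labP => _ _ _ h _; apply: h. Qed.
Let lab_surj z : tv z -> exists e s, e < 6 /\ z = lab e s.
Proof. by case: labP => _ _ _ _; apply. Qed.

Lemma tv_te z w : tv z -> te z w -> tv w.
Proof.
move=> tz zw; have [a [c t]] := tv_tri tz.
by have := tri_te_in t zw; case: t => _ _ _ [_ ta tc]; rewrite !inE => /orP[]/eqP->.
Qed.

Lemma tv_blk z w : tv z -> tv w -> blk z = blk w -> z = w \/ te z w.
Proof.
move=> tz tw e; have [a [c t]] := tv_tri tz; have [za zc _] := tri_te t.
have : w \in [:: z; a; c] by rewrite -(blk_tri t) e.
by rewrite !inE => /or3P[]/eqP->; [left|right|right].
Qed.

(* [cut] lists the string ends used as centres, [rem] the deleted edges, and [tr] a spanning tree of
   the remaining base multigraph, each edge being traversed from its end [s]. *)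
Fixpoint spans (cut : seq (nat * bool)) (rem : seq nat) (R : seq nat) (tr : seq (nat * bool)) :=
  if tr is (e, s) :: tr' then
    [&& endpoint b e s \in R, e < 6, e \notin rem, e \notin unzip1 cut
      & spans cut rem (endpoint b e (~~ s) :: R) tr']
  else all (mem R) (iota 0 4).

(** The requirements on centres: at most one on each string, at most one in each triangle, none on a
    removed edge, and none in a triangle that loses a vertex, where a centre would lack a
    neighbour. *)
Definition cut_ok cut rem :=
  [&& all (fun e => e < 6) (unzip1 cut), uniq (unzip1 cut),
      uniq [seq endpoint b c.1 c.2 | c <- cut], all (fun e => e \notin rem) (unzip1 cut)
    & all (fun e => all (fun s => endpoint b e s \notin [seq endpoint b c.1 c.2 | c <- cut])
        [:: false; true]) rem].

Section Connected.
Variables (cut : seq (nat * bool)) (rem : seq nat) (tr : seq (nat * bool)) (v0 : nat).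
Hypothesis cutP : cut_ok cut rem.
Hypothesis trP : spans cut rem [:: v0] tr.
Variables (S : {set T}) (ex : {set T * T}).
Let Y := [set z in [seq lab c.1 c.2 | c <- cut]].
Hypothesis tvS : forall e s, e < 6 -> (lab e s \in S) = (e \notin rem).
Hypothesis ntvS : forall z, ~~ tv z -> z \in S.
Hypothesis rem0 : forall e, e \in rem -> e < 6 -> nu (lab e false) = 0.
Hypotheses (ex_sym : symset ex) (ex_tri : forall d, d \in ex -> te d.1 d.2 && tv d.1).

Let c6 c : c \in cut -> c.1 < 6.
Proof. by case/and5P: cutP => /allP h _ _ _ _ cc; apply: h; apply: map_f. Qed.

Lemma cutY e s : e < 6 -> (lab e s \in Y) = ((e, s) \in cut).
Proof.
move=> e6; rewrite in_set; apply/mapP/idP => [[[e' s'] c]|c]; last by exists (e, s).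
by move=> /lab_inj[] //; [apply: c6 c|move=> /= -> ->].
Qed.

Lemma Ytv : {in Y, forall y, tv y}.
Proof. by move=> y; rewrite in_set => /mapP[c /c6 ? ->]; apply: lab_tv. Qed.

Lemma YS : Y \subset S.
Proof.
apply/subsetP => y; rewrite in_set => /mapP[c cc ->]; rewrite tvS ?c6 //.
by case/and5P: cutP => _ _ _ /allP h _; apply: h; apply: map_f.
Qed.

Lemma Yzeta y : y \in Y -> zeta y \in S /\ zeta y \notin Y.
Proof.
rewrite in_set => /mapP[[e s] c ->] /=; have e6 := c6 c; rewrite lab_zeta //; split.
  by rewrite tvS // -(tvS s e6) (subsetP YS) // cutY.
rewrite cutY //; apply/negP => c'; case/and5P: cutP => _ u _ _ _.
have := (uniqP 0 u) (index (e, s) cut) (index (e, ~~ s) cut).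
rewrite !inE size_map !index_mem c c' => /(_ isT isT).
rewrite !(nth_map (0, false)) ?index_mem // !nth_index // => /(_ erefl) E.
by have := nth_index (0, false) c; rewrite E nth_index // => -[]; case: (s).
Qed.

Lemma out_tv z : tv z -> tv (out z) -> zeta z = out z.
Proof. by move=> tz to; rewrite /zeta (nu_unique (k := 0)). Qed.

Lemma Yout y : y \in Y -> out y \notin Y.
Proof.
move=> yY; apply/negP => oY; have [_] := Yzeta yY.
by rewrite (out_tv (Ytv yY) (Ytv oY)) oY.
Qed.

Lemma Yte y z : y \in Y -> z \in Y -> ~~ te y z.
Proof.
rewrite !in_set => /mapP[c cc ->] /mapP[c' cc' ->]; apply/negP => yz.
have := te_blk yz => /eqP; rewrite lab_blk ?c6 // => /eqP E.
have ec : c = c'.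
  case/and5P: cutP => _ _ u _ _.
  have := (uniqP 0 u) (index c cut) (index c' cut).
  rewrite !inE size_map !index_mem cc cc' => /(_ isT isT).
  rewrite !(nth_map (0, false)) ?index_mem // !nth_index // => /(_ E) E'.
  by rewrite -(nth_index (0, false) cc) E' nth_index.
by move: (te_g yz); rewrite ec girr.
Qed.

Let J := joined S Y ex.

Let J_sym z w : J z w -> J w z.
Proof. by rewrite /J /joined (joined_sym S Y ex_sym). Qed.

Let J_trans z w u : J z w -> J w u -> J z u.
Proof. exact: connect_trans. Qed.

Let deS z : de z -> z \in S. Proof. by case/andP => _ /ntvS. Qed.
Let deY z : de z -> z \notin Y. Proof. by case/andP => _; apply: contra; apply: Ytv. Qed.

Lemma J_dia u v x m : dia u v x m -> {in [:: u; v; x; m] &, forall z w, J z w}.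
Proof.
move=> D; apply: (joined_dia YS Ytv ex_sym ex_tri D) => z; rewrite !inE => zD.
apply: ntvS; apply/negP => tz; have : triblk (blk u).
  by apply/existsP; exists z; rewrite tz (blk_dia D) !inE zD.
by rewrite (triblkF D).
Qed.

Lemma J_opp z : de z -> J z (opp z).
Proof.
move=> dz; have [v [x D]] := de_dia dz; rewrite (opp_dia D).
by apply: (J_dia D); rewrite !inE eqxx ?orbT.
Qed.

Lemma J_cross z : ~~ mid z -> z \in S -> out z \in S -> z \notin Y -> out z \notin Y -> J z (out z).
Proof. exact: joined_cross YS ex_tri z. Qed.

Lemma J_walk z i : tv z -> z \in S -> z \notin Y -> i < nu z -> J z (walk z i).
Proof.
move=> tz zS zY; have mz := tv_nonmid tz; elim: i => [|i IH] lt.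
  by have d0 := walk_de tz lt; apply: J_cross => //; [apply: deS d0|apply: deY d0].
have dS := walk_de tz lt; have d := walk_de tz (ltnW lt); have d' := opp_de d.
apply: J_trans (IH (ltnW lt)) _; apply: J_trans (J_opp d) _.
rewrite walkS // in dS *; apply: J_cross; [exact: de_nonmid d'|exact: deS|exact: deS|exact: deY|exact: deY].
Qed.

Lemma J_zeta z : tv z -> z \in S -> z \notin Y -> zeta z \in S -> zeta z \notin Y -> J z (zeta z).
Proof.
move=> tz zS zY; have mz := tv_nonmid tz; rewrite /zeta; case E : (nu z) => [|n].
  by rewrite walk0 => oS oY; apply: J_cross.
have lt : n < nu z by rewrite E.
have d := walk_de tz lt; have d' := opp_de d.
rewrite walkS // => oS oY; apply: J_trans (J_walk tz zS zY lt) _.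
by apply: J_trans (J_opp d) _; apply: J_cross => //; [apply: de_nonmid d'|apply: deS|apply: deY].
Qed.

Lemma Y_block y z : y \in Y -> te y z -> z \in S.
Proof.
move=> yY yz; have ty := Ytv yY; have [e [s [e6 E]]] := lab_surj (tv_te ty yz).
rewrite E tvS //; apply/negP => er; move: yY; rewrite in_set => /mapP[c cc Ey].
have /eqP := te_blk yz; rewrite E Ey lab_blk ?c6 // => /eqP Ec.
case/and5P: cutP => _ _ _ _ /allP/(_ _ er)/allP/(_ s); rewrite -Ec.
by case: s {E Ec} => /(_ isT) /negP[]; apply: (map_f (fun c => endpoint b c.1 c.2)).
Qed.

Lemma M_nb v z : v \in [set x in S | centre x || (x \in Y)] -> g v z -> z \in S.
Proof.
rewrite in_sep => /andP[vS /orP[/andP[mv _]|vY]] vz.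
  by apply: ntvS; apply/negP => /andP[_ /forallP/(_ v)]; rewrite gsym vz mv.
case: (g_cases vz) => [|[mv ->]]; first exact: Y_block.
have [to|] := boolP (tv (out v)); last exact: ntvS.
by rewrite -(out_tv (Ytv vY) to); have [] := Yzeta vY.
Qed.

Lemma card_M : #|[set x in S | centre x || (x \in Y)]| = ndia + size cut.
Proof.
have cY : #|Y| = size cut.
  rewrite cardsE -(size_map (fun c => lab c.1 c.2)); apply/card_uniqP.
  rewrite map_inj_in_uniq => [|[e s] [e' s'] c c' /= /lab_inj[]]; first last.
  - by move=> -> ->.
  - exact: c6 c'.
  - exact: c6 c.
  by case/and5P: cutP => _ /map_uniq.
have -> : ndia = #|[set x | centre x]| by rewrite cardsE; apply/esym/card_centre.
rewrite -cY -cardsUI [X in _ + X](_ : _ = 0) ?addn0.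
  apply: eq_card => x; rewrite in_setU in_sep (in_set (centre)).
  apply/andb_idl => /orP[/andP[mx _]|]; last exact: (subsetP YS).
  by apply: ntvS; apply/negP => /andP[]; rewrite mx.
apply: eq_card0 => x; rewrite in_setI (in_set (centre)); apply/negP => /andP[/andP[mx _]].
by move=> /Ytv/andP[]; rewrite mx.
Qed.

Lemma J_te_tv z w : (forall u v, blk u = blk z -> (u, v) \notin ex) ->
  tv z -> z \in S -> w \in S -> te z w -> J z w.
Proof.
move=> nex tz zS wS zw; have tw := tv_te tz zw.
have J_Y y v : tv y -> te y v -> y \in Y -> (forall u v, blk u = blk y -> (u, v) \notin ex) -> J y v.
  move=> ty yv yY nexy; have [a [c t]] := tv_tri ty; have [ya yc _] := tri_te t.
  have vt : v \in [:: y; a; c] by rewrite inE (tri_te_in t yv) orbT.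
  apply: (joined_tri YS Yte ex_sym t _ _ _ vt); last by rewrite inE eqxx.
    by move=> u; rewrite !inE => /or3P[]/eqP->; [apply: (subsetP YS)|apply: Y_block yY ya|apply: Y_block yY yc].
  by move=> u u'; rewrite -(blk_tri t) => /eqP/nexy.
have [zY|zY] := boolP (z \in Y); first exact: J_Y.
have [wY|wY] := boolP (w \in Y).
  by apply: J_sym; apply: J_Y => //; [rewrite te_sym|rewrite -(te_blk zw)].
apply: (joined_edge (te_g zw) zS wS (nex _ _ erefl)).
  by rewrite nonmid_M ?zY ?(tv_nonmid tz) //; apply: YS.
by rewrite nonmid_M ?wY ?(tv_nonmid tw) //; apply: YS.
Qed.

(** Left open here because a triangle containing an edge of [ex] needs its own argument, while
    [J_te_tv] deals with the others. *)
Hypothesis J_te_triangle : forall z w, tv z -> z \in S -> w \in S -> te z w -> J z w.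

Lemma J_te z w : z \in S -> w \in S -> te z w -> J z w.
Proof.
move=> zS wS zw; case: (blk_cases z) => [[a [c [_ _ _ [tz _ _]]]]|]; first exact: J_te_triangle.
move=> [u [v [x [m [D zD]]]]]; apply: (J_dia D zD); rewrite -(blk_dia D) -(te_blk zw).
by rewrite (blk_dia D).
Qed.

Let rel v w := forall e s e' s', e < 6 -> e' < 6 -> e \notin rem -> e' \notin rem ->
  endpoint b e s = v -> endpoint b e' s' = w -> J (lab e s) (lab e' s').

Let rel_node v : rel v v.
Proof.
move=> e s e' s' e6 e6' er er' ev ev'.
have [->|zw] : lab e s = lab e' s' \/ te (lab e s) (lab e' s'); last first.
- by apply: J_te; rewrite ?tvS.
- exact: connect0.
by apply: tv_blk; rewrite ?lab_tv //; apply/eqP; rewrite lab_blk // ev ev'.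
Qed.

Let J_edge e s : e < 6 -> e \notin rem -> e \notin unzip1 cut -> J (lab e s) (lab e (~~ s)).
Proof.
move=> e6 er ec; rewrite -lab_zeta //.
have nY s' : lab e s' \notin Y.
  by rewrite cutY //; apply: contra ec => /(map_f fst).
by apply: J_zeta; rewrite ?lab_zeta ?tvS ?lab_tv.
Qed.

Let spans_rel R tr' : spans cut rem R tr' -> {in R &, forall v w, rel v w} ->
  forall v w, v < 4 -> w < 4 -> rel v w.
Proof.
elim: tr' R => [|[e s] tr' IH] R /=.
  move=> /and5P[r0 r1 r2 r3 _] h v w v4 w4.
  by apply: h; move: v w v4 w4 => [|[|[|[|?]]]] [|[|[|[|?]]]].
move=> /and5P[eR e6 er ec sp] h; apply: (IH _ sp) => v w.
have to w' : w' \in R -> rel w' (endpoint b e (~~ s)).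
  move=> w'R e1 s1 e2 s2 e16 e26 e1r e2r E1 E2.
  apply: J_trans (h _ _ w'R eR _ _ e s e16 e6 e1r er E1 erefl) _.
  by apply: J_trans (J_edge s e6 er ec) _; apply: rel_node E2.
have fro w' : w' \in R -> rel (endpoint b e (~~ s)) w'.
  by move=> w'R e1 s1 e2 s2 ? ? ? ? E1 E2; apply: J_sym; apply: (to w').
by rewrite !inE => /predU1P[->|vR] /predU1P[->|wR]; [apply: rel_node|apply: fro|apply: to|apply: h].
Qed.

Lemma J_tv z w : tv z -> tv w -> z \in S -> w \in S -> J z w.
Proof.
move=> /lab_surj[e [s [e6 ->]]] /lab_surj[e' [s' [e6' ->]]]; rewrite !tvS // => er er'.
apply: (spans_rel trP _ (endpoint_lt4 b e s) (endpoint_lt4 b e' s') e6 e6' er er' erefl erefl).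
by move=> i j; rewrite !inE => /eqP-> /eqP->; apply: rel_node.
Qed.

(** The inside of a cut string is reached from its other end, which is not a centre. A removed
    vertex has an empty string, so its outgoing edge leads to no diamond. *)
Lemma all_joined r z : tv r -> r \in S -> z \in S -> J r z.
Proof.
move=> tr' rS zS; have [_ [conT _]] := two.
have : z \notin S \/ J r z; last by rewrite zS => -[].
apply: (connect_prop (P := fun z => z \notin S \/ J r z) (conT r z (in_setT _) (in_setT _))).
  by right; apply: connect0.
move=> u v uC /= /andP[/andP[uv _] _].
have [vS|] := boolP (v \in S); last by left.
right; have [tv_v|tv_v] := boolP (tv v); first exact: J_tv.
have [uS|uS] := boolP (u \in S); last first.
  have tu : tv u by apply: contraNT uS; apply: ntvS.
  case: (g_cases uv) => [tuv|[mu E]]; first by rewrite (tv_te tu tuv) in tv_v.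
  have [e [s [e6 E']]] := lab_surj tu; move: uS; rewrite E' tvS // negbK => er.
  have nu0 : nu u = 0.
    rewrite E'; case: s {E'}; last exact: rem0.
    by rewrite -[true]/(~~ false) -lab_zeta // nu_zeta ?lab_tv // rem0.
  have := zeta_tv tu; rewrite /zeta nu0 walk0 -E => h.
  by rewrite h in tv_v.
have {uC} ru : J r u by case: uC => //; rewrite uS.
case: (g_cases uv) => [tuv|[mu E]]; first by apply: J_trans ru (J_te uS vS tuv).
have vY : v \notin Y by apply: contra tv_v; apply: Ytv.
have [uY|uY] := boolP (u \in Y); last first.
  by apply: J_trans ru _; rewrite E; apply: J_cross; rewrite -?E.
have tu := Ytv uY; have [zS' zY'] := Yzeta uY; have tz := zeta_tv tu.
have nu_pos : 0 < nu u.
  by rewrite lt0n; apply: contraNneq tv_v => n0; rewrite E -walk0 -n0.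
apply: J_trans (J_tv tr' tz rS zS') _.
(* Seen from [zeta u], the diamond next to the cut is the last one of the string. *)
have lt : (nu u).-1 < nu (zeta u) by rewrite nu_zeta // prednK.
apply: J_trans (J_walk tz zS' zY' lt) _.
rewrite walk_rev ?prednK // subnn walk0 -E; apply: J_sym; apply: J_opp.
by rewrite E -walk0; apply: walk_de.
Qed.

Theorem embed_labelled r : tv r -> r \in S -> (forall d, d \in ex -> d.1 \notin Y) ->
  #|darts g S :\: ex| + 2 = 2 * #|S| + 4 * (ndia + size cut) ->
  conn_in g S /\ exists rho, rotation_system g S rho /\
    one_cycle (phi rho (darts g S :\: ex)) (darts g S).
Proof.
move=> tr' rS exY c0; have cK : conn_in (keep S Y ex) S.
  by apply: (joined_conn (r := r) ex_sym) => z zS; apply: all_joined.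
split; first exact: keep_conn cK.
apply: (build YS Ytv Yout Yte M_nb ex_sym _ rS cK); last by rewrite card_M.
move=> d de; rewrite in_sep negb_and negb_or exY // andbT.
by have /andP[_ /andP[md _]] := ex_tri de; rewrite /centre (negbTE md) orbT.
Qed.

End Connected.

End TriangleEmbeddings.

(** * Embeddings in the case of four triangles *)

Section FourTriangles.

Hypothesis two : two_connected g.
Hypothesis ntri4 : ntri = 4.

(** The five base edges other than [e] are divided into two cut edges and a spanning tree. The cut
    ends sit at the two nodes off [e], since both triangles at [e] lose a vertex. The entries are
    verified by computation in [cut_edgeP]. *)
Definition cut_edge (b : bool) (e : nat) : seq (nat * bool) :=
  nth [::] (if b then
    [:: [:: (1, true); (4, true)]; [:: (0, true); (5, true)]; [:: (0, true); (5, false)];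
        [:: (0, false); (5, true)]; [:: (0, false); (5, false)]; [:: (1, false); (4, false)]]
  else
    [:: [:: (3, false); (4, true)]; [:: (3, false); (4, true)]; [:: (0, false); (3, true)];
        [:: (0, false); (1, true)]; [:: (0, false); (1, true)]; [:: (0, true); (3, false)]]) e.

Definition tree_edge (b : bool) (e : nat) : seq (nat * bool) :=
  nth [::] (if b then
    [:: [:: (2, false); (5, true); (3, true)]; [:: (2, false); (4, true); (3, false)];
        [:: (1, false); (3, true); (4, false)]; [:: (1, false); (2, false); (4, true)];
        [:: (1, false); (2, false); (3, true)]; [:: (0, false); (2, false); (3, false)]]
  else
    [:: [:: (1, false); (2, false); (5, true)]; [:: (0, false); (2, false); (5, true)];
        [:: (1, false); (5, true); (4, true)]; [:: (5, true); (4, true); (2, true)];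
        [:: (5, true); (3, true); (2, true)]; [:: (1, false); (2, false); (4, false)]]) e.

Lemma cut_edgeP b e : e < 6 ->
  [/\ cut_ok b (cut_edge b e) [:: e], spans b (cut_edge b e) [:: e] [:: 0] (tree_edge b e)
    & size (cut_edge b e) = 2].
Proof. by case: b; move: e => [|[|[|[|[|[|]]]]]]. Qed.

(* If two triangles are joined by an edge, deleting its ends costs one cotree edge of the base
   multigraph and two triangle edges, after which everything can be paired off. *)
Theorem removable_direct z : tv z -> tv (out z) -> exists x y, removable g x y.
Proof.
move=> tz to; have [b [lab labP]] := labels_exist two ntri4.
have [lab_tv lab_zeta _ lab_inj lab_surj] := labP.
have nu_z : nu z = 0 by apply: nu_unique.
have [e [e6 nu0]] : exists e, e < 6 /\ nu (lab e false) = 0.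
  have [e [s [e6 E]]] := lab_surj z tz; exists e; split=> //.
  case: s E => E; last by rewrite -E.
  by rewrite -[false]/(~~ true) -lab_zeta // nu_zeta ?lab_tv // -E.
have tx := lab_tv e false e6; have mx := tv_nonmid tx.
have oy : out (lab e false) = lab e true by rewrite -[true]/(~~ false) -lab_zeta // /zeta nu0.
pose x := lab e false; pose y := lab e true.
have xy : g x y by rewrite /y -oy g_out.
have nxy : x != y by apply: contraTneq xy => ->; rewrite girr.
have [cutP spP sz] := cut_edgeP b e6.
pose S := ~: [set x; y].
have inS v : (v \in S) = (v != x) && (v != y) by apply: in_setC2.
have tvS e' s : e' < 6 -> (lab e' s \in S) = (e' \notin [:: e]).
  move=> e6'; rewrite inS inE; have [->|ne] := eqVneq e' e.
    by rewrite /x /y; case: s; rewrite eqxx ?andbF.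
  by apply/andP; split; apply: contraNneq ne => /lab_inj[] // ->.
have ntvS v : ~~ tv v -> v \in S.
  by move=> tv'; rewrite inS; apply/andP; split; apply: contraNneq tv' => ->; apply: lab_tv.
have rem0 e' : e' \in [:: e] -> e' < 6 -> nu (lab e' false) = 0 by rewrite inE => /eqP->.
have sy : symset (set0 : {set T * T}) by move=> d; rewrite in_set0.
have extri d : d \in (set0 : {set T * T}) -> te d.1 d.2 && tv d.1 by rewrite in_set0.
have Jt v w : tv v -> v \in S -> w \in S -> te v w ->
    joined S [set z in [seq lab c.1 c.2 | c <- cut_edge b e]] set0 v w.
  by apply: (J_te_tv labP cutP tvS sy) => u u'; rewrite in_set0.
have [r tr rS] : exists2 r, tv r & r \in S.
  have [e' e6' ne] : exists2 e', e' < 6 & e' != e.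
    by case: (e) => [|e']; [exists 1|exists 0].
  by exists (lab e' false); [apply: lab_tv|rewrite tvS // inE].
have := cardsC [set x; y]; rewrite cards2 nxy -/S /= => cS.
have cT := card_vertices; rewrite ntri4 in cT.
have cD := card_darts_setC2 gsym girr cub xy; rewrite -/S in cD.
have [||conS [rho [rot oc]]] :=
  embed_labelled two labP cutP spP tvS ntvS rem0 sy extri Jt tr rS.
- by move=> d; rewrite in_set0.
(* With [d = ndia] this is [(12d + 26) + 2 = 2(4d + 10) + 4(d + 2)]. *)
- rewrite setD0 sz; move: cS cT cD; clear.
  by move: #|darts g S| #|S| #|T| ndia; lia.
exists x, y; apply: (removableI gsym girr two xy conS).
  by exists rho; rewrite setD0 in oc.
by rewrite -/S; move: cS cT; clear; move: #|S| #|T| ndia; lia.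
Qed.

(** A spanning tree leaves three of the six base edges to be cut, with one cut end at each of the
    nodes 1, 2 and 3. *)
Definition cut_all (b : bool) : seq (nat * bool) :=
  if b then [:: (3, false); (5, false); (4, true)] else [:: (1, true); (4, false); (5, false)].

Definition tree_all (b : bool) : seq (nat * bool) :=
  if b then [:: (0, false); (1, false); (2, false)] else [:: (0, false); (2, false); (3, false)].

(* The vertex-triangle of node [0] carries no centre; one of its edges is embedded last. *)
Definition third b := if b then (2, false) else (5, true).

Lemma cut_allP b : [/\ cut_ok b (cut_all b) [::], spans b (cut_all b) [::] [:: 0] (tree_all b)
    & size (cut_all b) = 3].
Proof. by case: b. Qed.

(** Here [beta = 2d + 7], where [d = ndia]: the [d + 3] centres account for two cotree edges each,
    and the one left over is a triangle edge at node 0, which yields at most a second face. *)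
Theorem two_faces : upper_embeddable g setT.
Proof.
have [b [lab labP]] := labels_exist two ntri4.
have [lab_tv lab_zeta lab_blk lab_inj lab_surj] := labP.
have [cutP spP sz] := cut_allP b.
(* The three string ends at node 0: in both multigraphs the edges 0 and 1 start there. *)
pose p := lab 0 false; pose p' := lab 1 false; pose r := lab (third b).1 (third b).2.
have t6 : (third b).1 < 6 by case: (b).
have [tp tp' tr] : [/\ tv p, tv p' & tv r] by split; apply: lab_tv.
have np : p != p' by apply/eqP => /lab_inj[].
have rp : r != p by apply/eqP => /lab_inj[] //; case: (b).
have rp' : r != p' by apply/eqP => /lab_inj[] //; case: (b).
have [bp bp'] : blk r = blk p /\ blk r = blk p'.
  by split; apply/eqP; rewrite lab_blk //; case: (b).
have neT z w : z != w -> tv z -> tv w -> blk z = blk w -> te z w.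
  by move=> nzw tz tw e; case: (tv_blk tz tw e) => // E; rewrite E eqxx in nzw.
have te_rp : te r p by apply: neT.
have te_rp' : te r p' by apply: neT.
have te_pp' : te p p' by apply: neT; rewrite // -bp.
pose Y := [set z in [seq lab c.1 c.2 | c <- cut_all b]].
pose ex := [set (p, p'); (p', p)].
have tvS e s : e < 6 -> (lab e s \in [set: T]) = (e \notin [::]) by rewrite in_setT.
have ntvS v : ~~ tv v -> v \in [set: T] by rewrite in_setT.
have rem0 e : e \in [::] -> e < 6 -> nu (lab e false) = 0 by [].
have sy : symset ex := @symset2 _ (p, p').
have extri d : d \in ex -> te d.1 d.2 && tv d.1.
  by move=> /set2P[]->; rewrite /= ?tp ?tp' ?te_pp' // te_sym te_pp'.
have YS' : Y \subset [set: T] by apply: subsetT.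
have notY v : tv v -> blk v = blk r -> v \notin Y.
  move=> tv_v bv; apply/negP; rewrite in_set => /mapP[c cc E].
  have c6 : c.1 < 6 by case/and5P: cutP => /allP h _ _ _ _; apply: h; apply: map_f.
  have : blk v == blk r by rewrite bv.
  by rewrite E lab_blk //; move: c cc {E c6}; case: (b) => /= c; rewrite !inE => /or3P[]/eqP->.
have [a [c t]] := tv_tri tr.
have t3 : tri r p p'.
  have := blk_tri t p; have := blk_tri t p'; rewrite -bp -bp' eqxx => /esym + /esym.
  rewrite !inE ![_ == r]eq_sym (negbTE rp) (negbTE rp') /= => /orP[]/eqP E /orP[]/eqP E';
    rewrite E E' in np *; rewrite ?eqxx in np => //; by [|apply: tri_132].
have Jt v w : tv v -> v \in [set: T] -> w \in [set: T] -> te v w -> joined setT Y ex v w.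
  move=> tv_v vS wS vw; have [bv|bv] := eqVneq (blk v) (blk r).
    have [rY pY p'Y] : [/\ r \notin Y, p \notin Y & p' \notin Y] by split; apply: notY.
    apply: (joined_tri_off YS' sy t3) => //.
    - by move=> u; rewrite in_setT.
    - by rewrite in_set2 !xpair_eqE (negbTE rp) (negbTE rp').
    - by rewrite in_set2 !xpair_eqE (negbTE rp) (negbTE rp').
    - by rewrite -(blk_tri t3) bv.
    by rewrite -(blk_tri t3) -(te_blk vw) bv.
  apply: (J_te_tv labP cutP tvS sy) => // u u' ue; apply: contra bv => /set2P[][E _].
    by rewrite -ue E bp.
  by rewrite -ue E bp'.
have cT := card_vertices; rewrite ntri4 in cT.
have cD := card_darts_setT cub.
have pD : (p, p') \in darts g setT by rewrite dartsE !in_setT !andbT; apply: te_g te_pp'.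
have cX : #|darts g setT :\: ex| + 2 = 3 * #|T|.
  rewrite -cD -(cardsID ex (darts g setT)) addnC; congr (_ + _).
  rewrite (_ : _ :&: _ = ex) ?cards2 ?xpair_eqE ?(negbTE np) //.
  apply/setIidPr/subsetP => d /set2P[]-> //.
  exact: (darts_sym gsym pD).
have [||conS [rho [rot oc]]] :=
  embed_labelled two labP cutP spP tvS ntvS rem0 sy extri Jt tr (in_setT r).
- by move=> d /set2P[]->; apply: notY.
- rewrite sz cX cardsT cT; clear; move: ndia; lia.
split=> //; exists rho; split=> //.
exact: (nfaces_one_cycle_setD gsym girr rot pD oc).
Qed.

End FourTriangles.

(** * Membership in F *)

Section MemberOfF.

Definition mid_of u := odflt u [pick y | g u y && mid y].

Lemma dia_mid_of u : de u -> dia u (opp u) (mid_of u) (mate (mid_of u)).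
Proof.
move=> du; have [v [x D]] := de_dia du; rewrite (opp_dia D).
have [nx nm nu' nv [_ _ mx mm]] := D; have [_ _ hu] := nu'.
rewrite /mid_of; case: pickP => [y /andP[uy my]|/(_ x)] /=; last by rewrite hu !inE eqxx mx.
move: uy; rewrite hu !inE => /or3P[]/eqP E; rewrite E.
- exact: D.
- by have D' := dia_mate D; rewrite (dia_mateE D').
by move: my; rewrite E (negbTE (nonmid_out (de_nonmid du))).
Qed.

Hypothesis two : two_connected g.
Hypothesis tv_out : forall z, tv z -> de (out z).

Variables (b : bool) (lab : nat -> bool -> T).
Hypothesis labP : labelling b lab.

Let lab_tv e s : e < 6 -> tv (lab e s). Proof. by case: labP => h _ _ _ _; apply: h. Qed.
Let lab_zeta e s : e < 6 -> zeta (lab e s) = lab e (~~ s).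
Proof. by case: labP => _ h _ _ _; apply: h. Qed.
Let lab_blk e s e' s' : e < 6 -> e' < 6 ->
  (blk (lab e s) == blk (lab e' s')) = (endpoint b e s == endpoint b e' s').
Proof. by case: labP => _ _ h _ _; apply: h. Qed.
Let lab_inj e s e' s' : e < 6 -> e' < 6 -> lab e s = lab e' s' -> e = e' /\ s = s'.
Proof. by case: labP => _ _ _ h _; apply: h. Qed.
Let lab_surj z : tv z -> exists e s, e < 6 /\ z = lab e s.
Proof. by case: labP => _ _ _ _; apply. Qed.

Let k e := nu (lab e false).

Let k_gt0 e : e < 6 -> 0 < k e.
Proof.
move=> e6; rewrite lt0n; apply/eqP => k0; have tz := lab_tv false e6.
have := zeta_tv tz; rewrite /zeta -/(k e) k0 walk0.
by have /andP[_ /negbTE->] := tv_out tz.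
Qed.

(** The isomorphism is explicit in the direction from [FV] to [T]; the map demanded by [in_F] is
    obtained from it by choosing preimages. *)
Definition fv_vertex (v : FV) : T :=
  match v with
  | inl (e, s) => lab e s
  | inr (e, i, j) => let u := walk (lab e false) i in
      nth u [:: u; mid_of u; mate (mid_of u); opp u] j
  end.

Notation h := fv_vertex.

Let h0 e i : h (inr (e, i, 0)) = walk (lab e false) i. Proof. by []. Qed.
Let h1 e i : h (inr (e, i, 1)) = mid_of (walk (lab e false) i). Proof. by []. Qed.
Let h2 e i : h (inr (e, i, 2)) = mate (mid_of (walk (lab e false) i)). Proof. by []. Qed.
Let h3 e i : h (inr (e, i, 3)) = opp (walk (lab e false) i). Proof. by []. Qed.

Let walkD e i : e < 6 -> i < k e -> let u := walk (lab e false) i in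
  dia u (opp u) (mid_of u) (mate (mid_of u)).
Proof. by move=> e6 lt; apply/dia_mid_of/walk_de => //; apply: lab_tv. Qed.

Let walk_next e i : e < 6 -> walk (lab e false) i.+1 = out (opp (walk (lab e false) i)).
Proof. by move=> e6; rewrite walkS // tv_nonmid // lab_tv. Qed.

Let walk_last e : e < 6 -> walk (lab e false) (k e) = lab e true.
Proof. by move=> e6; rewrite -[true]/(~~ false) -lab_zeta. Qed.

Let walk_nm e i : e < 6 -> ~~ mid (walk (lab e false) i).
Proof. by move=> e6; apply/walk_nonmid/tv_nonmid/lab_tv. Qed.

Let g_next e i : e < 6 -> g (opp (walk (lab e false) i)) (walk (lab e false) i.+1).
Proof. by move=> e6; rewrite walk_next // g_out // opp_nonmid // walk_nm. Qed.

Let adj0 v w : FV_valid k v -> FV_valid k w -> Fadj0 b k v w -> g (h v) (h w).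
Proof.
case: v w => [[e s]|[[e i] j]] [[e' s']|[[e' i'] j']] //=.
- move=> e6 e6' /andP[ne]; rewrite -lab_blk // => /eqP bb.
  case: (tv_blk (lab_tv s e6) (lab_tv s' e6') bb) => [/lab_inj[] // E E'|/te_g //].
  by rewrite E E' eqxx in ne.
- move=> e6 /and3P[_ lt j4] /andP[/eqP <-]; case: s => /andP[/eqP E /eqP ->] /=.
    by rewrite gsym -walk_last // -E g_next.
  by rewrite E g_out // tv_nonmid // lab_tv.
move=> /and3P[e6 lt j4] /and3P[_ lt' j4'] /andP[/eqP E]; rewrite -E in lt' *.
case/orP=> [/andP[/eqP <-]|/andP[/andP[/eqP-> /eqP->] /eqP->]]; last by apply: g_next.
have [[/te_g ux /te_g um /te_g vx /te_g vm] [/te_g xm _ _]] := dia_te (walkD e6 lt).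
rewrite /diamond_edge => /orP[/orP[/orP[/orP[]|]|]|] /eqP[-> ->] //=; by rewrite gsym.
Qed.

Let adj v w : FV_valid k v -> FV_valid k w -> Fadj b k v w -> g (h v) (h w).
Proof. by move=> vv vw /orP[]; [apply: adj0|rewrite gsym; apply: adj0]. Qed.

(** Neighbours lift along [h]. Connectedness turns this into surjectivity, and with [h_inj] it shows
    that every edge of [g] comes from an edge of the model. *)
Let adj_surj v y : FV_valid k v -> g (h v) y ->
  exists w, [/\ FV_valid k w, Fadj b k v w & h w = y].
Proof.
case: v => [[e s] /= e6|[[e i] j] /and3P[e6 lt j4]].
  have tz := lab_tv s e6; have mz := tv_nonmid tz; move=> zy.
  case: (g_cases zy) => [tzy|[_ ->]].
    have [e' [s' [e6' E]]] := lab_surj (tv_te tz tzy).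
    exists (inl (e', s')); split=> //; rewrite /Fadj /= -lab_blk // -E (te_blk tzy) eqxx andbT.
    rewrite (_ : (e, s) != (e', s')) //; apply: contraTneq tzy => -[-> ->].
    by rewrite E; apply/negP => /te_g; rewrite girr.
  case: s {zy tz} mz => mz.
    exists (inr (e, (k e).-1, 3)); rewrite /= e6 /Fadj /= eqxx !prednK ?k_gt0 // eqxx leqnn.
    split=> //; rewrite -walk_last // -[in RHS](prednK (k_gt0 e6)) walk_next //.
    by rewrite outK // opp_nonmid // walk_nm.
  by exists (inr (e, 0, 0)); rewrite /= e6 /Fadj /= eqxx k_gt0.
have D := walkD e6 lt; have [[_ _ nx] [_ _ nm] [_ _ nu'] [_ _ nv] _] := D.
have valid j' : j' < 4 -> FV_valid k (inr (e, i, j')) by move=> lj; rewrite /= e6 lt.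
have inD j' : j' < 4 -> diamond_edge j j' || diamond_edge j' j ->
    exists w, [/\ FV_valid k w, Fadj b k (inr (e, i, j)) w & h w = h (inr (e, i, j'))].
  move=> lj dj; exists (inr (e, i, j')); split=> //; first exact: valid.
  by rewrite /Fadj /= !eqxx /=; case/orP: dj => ->; rewrite ?orbT.
move: j j4 inD => [|[|[|[|//]]]] _ inD; rewrite ?h0 ?h1 ?h2 ?h3 ?nx ?nm ?nu' ?nv !inE.
- case/or3P=> /eqP->; [exact: (inD 1)|exact: (inD 2)|].
  case: i lt {D nx nm nu' nv valid inD} => [|i] lt.
    exists (inl (e, false)); split=> //; first by rewrite /Fadj /= !eqxx.
    by rewrite walk0 outK // tv_nonmid // lab_tv.
  exists (inr (e, i, 3)); split; rewrite /= ?e6 ?(ltnW lt) //; first by rewrite /Fadj /= !eqxx !orbT.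
  by rewrite -[hop _]/(walk (lab e false) i.+1) walk_next // outK // opp_nonmid // walk_nm.
- by case/or3P=> /eqP->; [exact: (inD 0)|exact: (inD 2)|exact: (inD 3)].
- by case/or3P=> /eqP->; [exact: (inD 0)|exact: (inD 1)|exact: (inD 3)].
case/or3P=> /eqP->; [exact: (inD 1)|exact: (inD 2)|].
have [lt2|le] := ltnP i.+1 (k e).
  exists (inr (e, i.+1, 0)); split; rewrite ?h0 ?walk_next //; first by rewrite /= e6 lt2.
  by rewrite /Fadj /= !eqxx !orbT.
have ek : i.+1 = k e by apply/eqP; rewrite eqn_leq lt le.
exists (inl (e, true)); split=> //; first by rewrite /Fadj /= eqxx ek eqxx.
by rewrite -walk_next // ek walk_last.
Qed.

Let h_blk e i j : e < 6 -> i < k e -> j < 4 ->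
  h (inr (e, i, j)) \in [:: walk (lab e false) i; opp (walk (lab e false) i);
    mid_of (walk (lab e false) i); mate (mid_of (walk (lab e false) i))].
Proof. by move: j => [|[|[|[|]]]] // *; rewrite !inE /= eqxx ?orbT. Qed.

(** Two different parameters could share a diamond only if strings ran through it in opposite
    directions, and this is impossible because all walks start at ends of the form [lab e false]. *)
Let h_inj v w : FV_valid k v -> FV_valid k w -> h v = h w -> v = w.
Proof.
have not_tv e i j s e' : e < 6 -> i < k e -> j < 4 -> e' < 6 -> h (inr (e, i, j)) <> lab e' s.
  move=> e6 lt j4 e6' E; have := h_blk e6 lt j4; rewrite E -(blk_dia (walkD e6 lt)) => bb.
  have : triblk (blk (walk (lab e false) i)) by apply/existsP; exists (lab e' s); rewrite bb lab_tv.
  by rewrite (triblkF (walkD e6 lt)).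
case: v w => [[e s]|[[e i] j]] [[e' s']|[[e' i'] j']].
- by move=> /= e6 e6' /lab_inj[] // -> ->.
- by move=> /= e6 /and3P[e6' lt j4] /esym/not_tv[].
- by move=> /= /and3P[e6' lt j4] e6 /not_tv[].
move=> /and3P[e6 lt j4] /and3P[e6' lt' j4'] E.
have tz := lab_tv false e6; have tz' := lab_tv false e6'.
have D := walkD e6 lt; have D' := walkD e6' lt'.
have [ew|ew] : walk (lab e' false) i' = walk (lab e false) i \/
    walk (lab e' false) i' = opp (walk (lab e false) i).
- have : blk (walk (lab e' false) i') = blk (walk (lab e false) i).
    have := h_blk e6 lt j4; rewrite E -(blk_dia D) => /eqP <-.
    by apply/esym/eqP; rewrite (blk_dia D'); apply: h_blk.
  move/eqP; rewrite (blk_dia D) !inE => /or4P[]/eqP Ew; [by left|by right| |];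
    have := walk_nm i' e6'; rewrite Ew; have [_ _ _ _ [_ _ mx mm]] := D; by rewrite ?mx ?mm.
- have [ee ei] := walk_inj tz' tz (ltnW lt') (ltnW lt) ew.
  have [{}ee _] := lab_inj e6' e6 ee; move: E; rewrite ee ei => /eqP /=.
  rewrite nth_uniq //; first by move/eqP->.
  have := dia_uniq D; rewrite /= !inE !negb_or !(eq_sym (opp _)).
  by move=> /and4P[/and3P[-> -> ->] /andP[-> ->] -> _].
have := walk_rev_neq tz' tz lt' lt ew; rewrite lab_zeta // => /lab_inj[] //.
Qed.

Theorem labelled_in_F : in_F g.
Proof.
have surj x : exists v, FV_valid k v && (h v == x).
  have [_ [conT _]] := two.
  have : exists v, FV_valid k v /\ h v = x.
    apply: (connect_prop (P := fun x => exists v, FV_valid k v /\ h v = x)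
      (conT (lab 0 false) x (in_setT _) (in_setT _))).
      by exists (inl (0, false)).
    move=> u w [v [vv hv]] /= /andP[/andP[uw _] _].
    by rewrite -hv in uw; have [v' [vv' _ hv']] := adj_surj vv uw; exists v'.
  by case=> v [vv hv]; exists v; rewrite vv hv eqxx.
pose f x := xchoose (surj x).
have fP x : FV_valid k (f x) /\ h (f x) = x by have /andP[-> /eqP] := xchooseP (surj x).
exists b, k; split; first exact: k_gt0.
exists f; split.
- by move=> x y E; have [_ <-] := fP x; have [_ <-] := fP y; rewrite E.
- by move=> x; have [] := fP x.
- by move=> v vv; exists (h v); have [vf hf] := fP (h v); apply: h_inj.
move=> x y; have [vx hx] := fP x; have [vy hy] := fP y; apply/idP/idP => [xy|].
  rewrite -[x]hx in xy; have [w [vw aw hw]] := adj_surj vx xy.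
  by have -> : f y = w by apply: h_inj; rewrite // hy.
by move/(adj vx vy); rewrite hx hy.
Qed.

End MemberOfF.

End ClawFree.

(** * Triangles and diamonds of a member of F *)

Lemma third_end b e s e' s' : e < 6 -> e' < 6 -> (e, s) != (e', s') ->
  endpoint b e s = endpoint b e' s' -> exists c, [/\ c.1 < 6, c != (e, s), c != (e', s')
    & endpoint b c.1 c.2 = endpoint b e s].
Proof.
move=> e6 e6' ne E; have : has (fun c => [&& c != (e, s), c != (e', s')
    & endpoint b c.1 c.2 == endpoint b e s]) [seq (x, y) | x <- iota 0 6, y <- [:: false; true]].
  by move: E ne; move: e e6 e' e6' => [|[|[|[|[|[|]]]]]] // _ [|[|[|[|[|[|]]]]]] // _;
    case: b s s' => [] [] [].
case/hasP=> c /allpairsP[[x y] [xi _ ->]] /and3P[? ? /eqP ?].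
by exists (x, y); split=> //; move: xi; rewrite mem_iota.
Qed.

Lemma diamond_edge_irr j : diamond_edge j j = false.
Proof. by move: j => [|[|[|[|]]]]. Qed.

Lemma Fadj_mid b k e i j w : (j == 1) || (j == 2) -> FV_valid k w ->
  Fadj b k (inr (e, i, j)) w -> exists j', [/\ w = inr (e, i, j'), j' < 4 & j' != j].
Proof.
move=> j12; have [j0 j3] : (j == 0) = false /\ (j == 3) = false by case/orP: j12 => /eqP->.
case: w => [[e' s] _|[[e' i'] j'] /and3P[_ _ j4]].
  by rewrite /Fadj /= j0 j3 !andbF; case: s; rewrite andbF.
rewrite /Fadj /= j0 j3 !andbF !orbF => /orP[]/and3P[/eqP-> /eqP-> dj]; exists j'; split=> //;
  by apply: contraTneq dj => ->; rewrite diamond_edge_irr.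
Qed.

Lemma Fadj_end b k e s w : FV_valid k w -> Fadj b k (inl (e, s)) w ->
  if w is inl (e', s') then (e, s) != (e', s') /\ endpoint b e s = endpoint b e' s'
  else w = if s then inr (e, (k e).-1, 3) else inr (e, 0, 0).
Proof.
case: w => [[e' s']|[[e' i'] j']] /=.
  rewrite /Fadj /= => _ /orP[]/andP[ne /eqP ->]; split=> //; by rewrite eq_sym.
rewrite /Fadj /= orbF => _ /andP[/eqP <-].
by case: s => /andP[/eqP E /eqP ->]; rewrite ?E // -E.
Qed.

Section FGraph.
Variables (T : finType) (g : rel T) (b : bool) (k : nat -> nat) (f : T -> FV).
Hypothesis girr : irreflexive g.
Hypothesis k_gt0 : forall e, e < 6 -> 0 < k e.
Hypotheses (f_inj : injective f) (f_valid : forall x, FV_valid k (f x)).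
Hypothesis f_surj : forall v, FV_valid k v -> exists x, f x = v.
Hypothesis f_adj : forall x y, g x y = Fadj b k (f x) (f y).

Definition is_triangle_vertex (v : FV) := if v is inl _ then true else false.

Lemma card_triangle_vertices : #|[pred x | is_triangle_vertex (f x)]| = 12.
Proof.
have ex (c : 'I_6 * bool) : exists x, f x == inl (val c.1, c.2).
  by have [x <-] := @f_surj (inl (val c.1, c.2)) (ltn_ord c.1); exists x.
pose F c := xchoose (ex c); have fF c : f (F c) = inl (val c.1, c.2) := eqP (xchooseP (ex c)).
have F_inj : injective F.
  by move=> [e s] [e' s'] /(congr1 f); rewrite !fF /= => -[/val_inj-> ->].
have <- : #|{: 'I_6 * bool}| = 12 by rewrite card_prod card_ord card_bool.
rewrite -(card_codom F_inj).
apply: eq_card => x; rewrite inE; apply/idP/codomP => [|[c ->]]; last by rewrite fF.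
have := f_valid x; case E : (f x) => [[e s]|//] /= e6 _.
by exists (Ordinal e6, s); apply: f_inj; rewrite fF E.
Qed.

Lemma card_F : 12 <= #|T|.
Proof. by rewrite -card_triangle_vertices; apply: max_card. Qed.

Lemma f_mid x e i j : f x = inr (e, i, j) -> (j == 1) || (j == 2) -> mid g x.
Proof.
move=> fx j12; apply/forallP => y; apply/implyP => xy; rewrite /te xy; apply/existsP.
have vx := f_valid x; rewrite fx in vx; have /and3P[e6 lt _] := vx.
have [j' [fy j4 jj]] : exists j', [/\ f y = inr (e, i, j'), j' < 4 & j' != j].
  by apply: (Fadj_mid (b := b) j12 (f_valid y)); rewrite -fx -f_adj.
(* A common neighbour of [x] and [y]: the end 0 if [y] is the other middle vertex, and the other
   middle vertex [3 - j] if [y] is an end. *)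
pose c := if (j' == 1) || (j' == 2) then 0 else 3 - j.
have [z fz] : exists z, f z = inr (e, i, c).
  by apply: f_surj; rewrite /= e6 lt /c; case/orP: j12 => /eqP->; case: ifP.
exists z; rewrite !f_adj fx fy fz /Fadj /= !eqxx /= /c.
move: (i == i.+1) j4 jj => t.
by case/orP: j12 => /eqP->; move: j' {fy c fz} => [|[|[|[|]]]] // _ _; case: t.
Qed.

(** As the string is nonempty, [x] is attached to a diamond end, and no other triangle vertex at the
    same node is adjacent to that end. So this edge lies in no triangle. *)
Lemma f_end_entry x e s : f x = inl (e, s) -> exists y, [/\ g x y, ~~ te g x y &
  f y = if s then inr (e, (k e).-1, 3) else inr (e, 0, 0)].
Proof.
move=> fx; have e6 : e < 6 by have := f_valid x; rewrite fx.
have k0 := k_gt0 e6.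
have [y fy] : exists y, f y = if s then inr (e, (k e).-1, 3) else inr (e, 0, 0).
  by apply: f_surj; case: (s); rewrite /= e6 ?prednK ?k0 ?leqnn.
have xy : g x y.
  by rewrite f_adj fx fy /Fadj; case: (s); rewrite /= ?prednK ?eqxx.
exists y; split=> //; apply/negP => /andP[_ /existsP[z /andP[]]].
rewrite f_adj fx => /(Fadj_end (f_valid z)); case fz : (f z) => [[e' s']|[[e' i'] j']]; last first.
  by rewrite -fz -fy => /f_inj ->; rewrite girr.
move=> [ne _]; rewrite f_adj fy fz /Fadj; move: ne; have [->|nee] := eqVneq e' e.
  by case: (s) (s') => [] []; rewrite ?eqxx //= ?andbF.
by case: (s) (s') => [] [] _; rewrite /= (negbTE nee).
Qed.

Lemma f_nonmid x e s : f x = inl (e, s) -> ~~ mid g x.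
Proof.
move=> /f_end_entry[y [xy nt _]]; apply: contra nt => /forallP/(_ y).
by rewrite xy.
Qed.

Lemma te_comm x y : symmetric g -> te g x y = te g y x.
Proof.
by move=> gs; rewrite /te gs; congr (_ && _); apply: eq_existsb => z; rewrite andbC.
Qed.

Lemma f_tv x : symmetric g -> tv g x = is_triangle_vertex (f x).
Proof.
move=> gs; case fx : (f x) => [[e s]|[[e i] j]] /=.
  rewrite /tv (f_nonmid fx) /=; apply/forallP => y; apply/implyP => xy.
  have := xy; rewrite f_adj fx => /(Fadj_end (f_valid y)).
  case fy : (f y) => [[e' s']|[[e' i'] j']]; first by move=> _; apply: f_nonmid fy.
  have [y' [xy' nt fy']] := f_end_entry fx; rewrite -fy' -fy => /f_inj ->.
  by apply: contra nt => /forallP/(_ x); rewrite te_comm // gs xy'.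
apply/negbTE/negP => /andP[nm /forallP m]; have vx := f_valid x; rewrite fx in vx.
have /and3P[e6 lt j4] := vx.
have [z fz] : exists z, f z = inr (e, i, 1) by apply: f_surj; rewrite /= e6 lt.
have mz : mid g z by apply: f_mid fz _.
have j03 : (j == 0) || (j == 3).
  have : ~~ ((j == 1) || (j == 2)) by apply: contra nm; apply: f_mid fx.
  by move: j j4 {fx m vx} => [|[|[|[|]]]].
have := m z; rewrite mz implybF f_adj fx fz /Fadj /= !eqxx /=.
by case/orP: j03 => /eqP->; case: (i == i.+1).
Qed.

(** Two adjacent triangle vertices share a node, and the third string end at that node completes the
    triangle. Consequently an edge between blocks never joins two triangles. *)
Lemma f_tv_out x y : symmetric g -> tv g x -> tv g y -> g x y -> te g x y.
Proof.
move=> gs; rewrite !f_tv //; case fx : (f x) => [[e s]|//]; case fy : (f y) => [[e' s']|//] _ _ xy.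
rewrite /te xy; apply/existsP; have := xy; rewrite f_adj fx fy => /Fadj_end-/(_ _)[].
  by rewrite -fy.
move=> ne E; have [e6 e6'] : e < 6 /\ e' < 6.
  by split; [have := f_valid x; rewrite fx|have := f_valid y; rewrite fy].
have [[e2 s2] /= [c6 c1 c2 Ec]] := third_end e6 e6' ne E.
have [z fz] : exists z, f z = inl (e2, s2) by apply: f_surj.
exists z; rewrite !f_adj fx fy fz /Fadj /= Ec -E eqxx !andbT.
by rewrite eq_sym c1 eq_sym c2.
Qed.

End FGraph.

Section FMember.
Variables (T : finType) (g : rel T).
Context {cfc : claw_free_cubic g}.

Lemma in_F_structure : in_F g -> ntri g = 4 /\ (forall z, tv g z -> de g (out g z)).
Proof.
case=> b [k [k0 [f [fi fv fs fa]]]].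
have gs := @cfc_sym T g cfc; have gi := @cfc_irr T g cfc.
have tvE x := f_tv gi k0 fi fv fs fa x gs.
split.
  have := card_tv (cfc := cfc); rewrite (eq_card (B := [pred x | is_triangle_vertex (f x)])).
    by rewrite (card_triangle_vertices fi fv fs); move: (ntri g); clear; lia.
  by move=> x; rewrite !inE tvE.
move=> z tz; have mz := tv_nonmid tz; case: (tv_or_de (nonmid_out mz)) => // to.
have := te_out (cfc := cfc) mz; rewrite (f_tv_out gi k0 fi fv fs fa gs tz to) //.
exact: g_out.
Qed.

End FMember.

(** * The equivalence *)

Section NoK4.
Variables (T : finType) (g : rel T).
Context {cfc : claw_free_cubic g}.
Hypothesis two : two_connected g.

Let gsym : symmetric g := cfc_sym.
Let girr : irreflexive g := cfc_irr.
Let cub : cubic g := cfc_cubic.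

(** A cubic graph on [n] vertices has [3n/2] edges, so [beta = n/2 + 1]. *)
Lemma odd_beta : odd (beta g setT) = (#|T| %% 4 == 0).
Proof.
have [_ ev] := odd_glue (@darts_sym T g gsym setT) (fun d dD => darts_neq girr dD).
move: ev; rewrite /beta /nedges cardsT (card_darts_setT cub); move: #|T|; clear; lia.
Qed.

Lemma tight_in_F : tightly_two_face_embeddable g -> in_F g.
Proof.
move=> [[_ [[conT [rho [rot nf]]] odd_b]] norem]; have [T2 _] := two.
have t4 : ntri g <= 4 by apply: (ntri_le4 conT (ltnW T2) rot nf).
have ntri4 : ntri g = 4.
  have [t0|tn0] := eqVneq (ntri g) 0; first by case: norem; apply: removable_ring.
  move: odd_b t4 tn0; rewrite odd_beta (card_vertices (cfc := cfc)); move: (ntri g) (ndia g).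
  by clear; lia.
have [b [lab labP]] := labels_exist two ntri4.
apply: (labelled_in_F two _ labP) => z tz.
case: (tv_or_de (nonmid_out (tv_nonmid tz))) => // to.
by case: norem; apply: removable_direct tz to.
Qed.

Lemma in_F_tight : in_F g -> tightly_two_face_embeddable g.
Proof.
move=> /in_F_structure[ntri4 tv_out]; split.
  split=> //; split; first exact: two_faces.
  by rewrite odd_beta (card_vertices (cfc := cfc)) ntri4; move: (ndia g); clear; lia.
by case=> x [y]; apply: not_removable.
Qed.

End NoK4.

Theorem theorem17 (T : finType) (g : rel T) :
  simple_graph g -> two_connected g -> claw_free g -> cubic g ->
  (tightly_two_face_embeddable g <-> in_F g).
Proof.
move=> [gsym girr] two clf cub.
(* [K4] satisfies neither side: it has a removable pair, and the graphs in [F] have at least twelve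
   vertices. *)
have [/existsP[x /existsP[a /existsP[b /existsP[c]]]]|noK4] :=
  boolP [exists x, exists a, exists b, exists c,
    [&& uniq [:: a; b; c], g x a, g x b, g x c, g a b, g a c & g b c]].
  move=> /and5P[us xa xb xc /and3P[ab ac bc]].
  have nx := nb3 cub us xa xb xc; split.
    case=> _ []; exists x, a.
    exact: (removable_K4 gsym girr two cub nx (And3 ab ac bc)).
  move=> [b' [k [_ [f [fi fv fs _]]]]]; have := card_F fi fv fs.
  by have [-> _] := card_K4 gsym girr two cub nx (And3 ab ac bc).
have cfc : claw_free_cubic g.
  split=> // x a b c [_ us h] [ab ac bc]; case/negP: noK4.
  apply/existsP; exists x; apply/existsP; exists a; apply/existsP; exists b; apply/existsP; exists c.
  by rewrite us !h !inE !eqxx !orbT ab ac bc.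
by split; [apply: tight_in_F|apply: in_F_tight].
Qed.
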